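(* Let $R$ be a commutative noetherian ring with a dualizing complex and with finite pure global dimension. If $\varinjlim\mathsf{Gproj}\,R=\mathsf{GFlat}\,R$ (this happens for example if $R$, in addition, has finite injective dimension over itself), then $\mathsf{K}(\mathsf{Add}(\mathsf{Gproj}\,R))$ is compactly generated.
   Context: $\mathsf{Gproj}\,R$ is the class of finitely generated Gorenstein projective modules, i.e. (over commutative noetherian $R$) finitely generated modules $M$ such that, with $M^*=\operatorname{Hom}_R(M,R)$, the biduality map $M\to M^{**}$ is an isomorphism and $\operatorname{Ext}^i_R(M,R)=0=\operatorname{Ext}^i_R(M^*,R)$ for all $i\geq1$. $\mathsf{GFlat}\,R$ is the class of Gorenstein flat modules: modules isomorphic to a kernel in an exact ($\mathbb{Z}$-indexed) complex $F$ of flat modules such that $I\otimes_RF$ is exact for every injective module $I$. $\varinjlim\mathsf{Gproj}\,R$ is the class of modules which can be written as a colimit in $\mathsf{Mod}\,R$ of a functor $I\to\mathsf{Gproj}\,R$ with $I$ a small filtering category. $\mathsf{Add}\,\mathbb{A}$ is the class of modules isomorphic to a direct summand of a coproduct $\coprod_{i\in I}A_i$ with $A_i\in\mathbb{A}$, $I$ an arbitrary set. For a class $\mathbb{X}=\mathsf{Add}\,\mathbb{X}$, $\mathsf{K}(\mathbb{X})$ is the triangulated category with objects the ($\mathbb{Z}$-indexed) chain complexes of modules from $\mathbb{X}$ and morphisms the chain maps modulo homotopy. A triangulated category $\mathsf{T}$ with set-indexed coproducts is compactly generated if there is a set $\mathcal{G}$ of compact objects (objects $C$ for which $\coprod_i\operatorname{Hom}_{\mathsf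 T}(C,X_i)\to\operatorname{Hom}_{\mathsf T}(C,\coprod_iX_i)$ is always an isomorphism) such that, for all $X\in\mathsf{T}$, $\operatorname{Hom}_{\mathsf T}(G,X)=0$ for all $G\in\mathcal{G}$ implies $X\cong0$. A sequence $Y$ of modules is pure exact if $\operatorname{Hom}_R(N,Y)$ is exact for every finitely presented module $N$. A module $P$ is pure projective if $\operatorname{Hom}_R(P,-)$ preserves exactness of pure exact sequences. The pure global dimension of $R$ is the least $d$ (or $\infty$) such that every module $N$ has a pure exact sequence $0\to P_d\to\cdots\to P_0\to N\to0$ with all $P_i$ pure projective. *)

(* Defs.v *)
From HB Require Import structures.
From mathcomp Require Import all_boot all_order all_algebra.
From mathcomp Require Import generic_quotient ring_quotient.
From mathcomp Require Import boolp.

Set Implicit Arguments.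
Unset Strict Implicit.
Unset Printing Implicit Defensive.

Import Order.TTheory GRing.Theory Num.Theory.

Local Open Scope ring_scope.
Local Open Scope quotient_scope.

(* A module carries a [choiceType] structure, which classically is no
   restriction. "Sets" (index sets, objects and arrows of small categories,
   generating sets) are [choiceType]s too: the carriers of [choiceType] and
   [lmodType] share one universe, so that, unlike with [Type], a family indexed
   by such a set is small relative to the category of modules. *)

Lemma linear_map_eq (R : pzRingType) (M N : lmodType R)
  (f g : {linear M -> N}) : f =1 g -> f = g.
Proof.
case: f g => [f [[fD] [fZ]]] [g [[gD] [gZ]]] /= /funext efg.
move: efg fD fZ => /= -> fD fZ.
by rewrite (Prop_irrelevance fD gD) (Prop_irrelevance fZ gZ).
Qed.

Definition hom (R : comPzRingType) (M N : lmodType R) := {linear M -> N}.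

Section HomModule.
Variables (R : comPzRingType) (M N : lmodType R).
Implicit Types (f g h : hom M N) (a b : R).

HB.instance Definition _ := gen_eqMixin (hom M N).
HB.instance Definition _ := gen_choiceMixin (hom M N).

Definition hom_zero : hom M N := (\0 : {linear M -> N}).
Definition hom_opp f : hom M N := (\- f : {linear M -> N}).
Definition hom_add f g : hom M N := (f \+ g : {linear M -> N}).
Definition hom_scale a f : hom M N := (a \*: f : {linear M -> N}).

Fact hom_addA : associative hom_add.
Proof. by move=> f g h; apply: linear_map_eq => x /=; rewrite addrA. Qed.
Fact hom_addC : commutative hom_add.
Proof. by move=> f g; apply: linear_map_eq => x /=; rewrite addrC. Qed.
Fact hom_add0 : left_id hom_zero hom_add.
Proof. by move=> f; apply: linear_map_eq => x /=; rewrite add0r. Qed.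
Fact hom_addN : left_inverse hom_zero hom_opp hom_add.
Proof. by move=> f; apply: linear_map_eq => x /=; rewrite addNr. Qed.

HB.instance Definition _ :=
  GRing.isZmodule.Build (hom M N) hom_addA hom_addC hom_add0 hom_addN.

Fact hom_scaleA a b f : hom_scale a (hom_scale b f) = hom_scale (a * b) f.
Proof. by apply: linear_map_eq => x /=; rewrite scalerA. Qed.
Fact hom_scale1 : left_id 1 hom_scale.
Proof. by move=> f; apply: linear_map_eq => x /=; rewrite scale1r. Qed.
Fact hom_scaleDr : right_distributive hom_scale +%R.
Proof. by move=> a f g; apply: linear_map_eq => x /=; rewrite scalerDr. Qed.
Fact hom_scaleDl f : {morph hom_scale^~ f : a b / a + b}.
Proof. by move=> a b; apply: linear_map_eq => x /=; rewrite scalerDl. Qed.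

HB.instance Definition _ := GRing.Zmodule_isLmodule.Build R (hom M N)
  hom_scaleA hom_scale1 hom_scaleDr hom_scaleDl.

End HomModule.

Record preadditive := Preadditive {
  obj :> Type;
  Hom : obj -> obj -> zmodType;
  idm : forall X, Hom X X;
  comp : forall X Y Z, Hom Y Z -> Hom X Y -> Hom X Z;
  comp1m : forall X Y (f : Hom X Y), comp (idm Y) f = f;
  compm1 : forall X Y (f : Hom X Y), comp f (idm X) = f;
  compA : forall X Y Z W (h : Hom Z W) (g : Hom Y Z) (f : Hom X Y),
    comp h (comp g f) = comp (comp h g) f;
  compDl : forall X Y Z (g g' : Hom Y Z) (f : Hom X Y),
    comp (g + g') f = comp g f + comp g' f;
  compDr : forall X Y Z (g : Hom Y Z) (f f' : Hom X Y),
    comp g (f + f') = comp g f + comp g f'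
}.
Arguments Hom {p} X Y.
Arguments idm {p} X.
Arguments comp {p X Y Z} g f.

Section Preadditive.
Variable T : preadditive.

Definition is_zero_object (X : T) : Prop :=
  forall Y : T, (forall f : Hom X Y, f = 0) /\ (forall f : Hom Y X, f = 0).

Definition is_coproduct (I : choiceType) (X : I -> T) (C : T)
    (inj : forall i, Hom (X i) C) : Prop :=
  forall (Y : T) (f : forall i, Hom (X i) Y),
    exists! u : Hom C Y, forall i, comp u (inj i) = f i.

Definition has_coproducts : Prop :=
  forall (I : choiceType) (X : I -> T),
    exists (C : T) (inj : forall i, Hom (X i) C), is_coproduct inj.

(* The two clauses are surjectivity and injectivity of the canonical map
   \coprod_i Hom (C, X_i) -> Hom (C, \coprod_i X_i); an element of its source
   is a family (g i) of morphisms that vanishes outside the finite set [s]. *)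
Definition compact (C : T) : Prop :=
  forall (I : choiceType) (X : I -> T) (Y : T) (inj : forall i, Hom (X i) Y),
    is_coproduct inj ->
    (forall f : Hom C Y, exists (s : seq I) (g : forall i, Hom C (X i)),
       uniq s /\ f = \sum_(i <- s) comp (inj i) (g i)) /\
    (forall (s : seq I) (g : forall i, Hom C (X i)), uniq s ->
       \sum_(i <- s) comp (inj i) (g i) = 0 -> forall i, i \in s -> g i = 0).

(* For a triangulated category, this only involves the underlying additive
   category. *)
Definition compactly_generated : Prop :=
  has_coproducts /\
  exists (I : choiceType) (G : I -> T),
    (forall i, compact (G i)) /\
    forall X : T,
      (forall i (f : Hom (G i) X), f = 0) -> is_zero_object X.

End Preadditive.

Record small_category := SmallCategory {
  sobj :> choiceType;
  sarr : sobj -> sobj -> choiceType;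
  sid : forall i, sarr i i;
  scomp : forall i j k, sarr j k -> sarr i j -> sarr i k;
  scomp1a : forall i j (a : sarr i j), scomp (sid j) a = a;
  scompa1 : forall i j (a : sarr i j), scomp a (sid i) = a;
  scompA : forall i j k l (c : sarr k l) (b : sarr j k) (a : sarr i j),
    scomp c (scomp b a) = scomp (scomp c b) a
}.

Record functor (I : small_category) (T : preadditive) := Functor {
  fobj :> I -> T;
  fmap : forall i j, sarr i j -> Hom (fobj i) (fobj j);
  fmap1 : forall i, fmap (sid i) = idm (fobj i);
  fmapM : forall i j k (b : sarr j k) (a : sarr i j),
    fmap (scomp b a) = comp (fmap b) (fmap a)
}.

Definition filtering (I : small_category) : Prop :=
  [/\ exists i : I, True,
      forall i j : I, exists (k : I) (a : sarr i k) (b : sarr j k), True &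
      forall (i j : I) (a b : sarr i j),
        exists (k : I) (c : sarr j k), scomp c a = scomp c b].

Section Colimit.
Variables (I : small_category) (T : preadditive) (F : functor I T).

Definition is_cocone (C : T) (c : forall i, Hom (F i) C) : Prop :=
  forall (i j : I) (a : sarr i j), comp (c j) (fmap F a) = c i.

Definition is_colimit (C : T) (c : forall i, Hom (F i) C) : Prop :=
  is_cocone c /\
  forall (Y : T) (f : forall i, Hom (F i) Y), is_cocone f ->
    exists! u : Hom C Y, forall i, comp u (c i) = f i.

End Colimit.

Section ModCategory.
Variable R : comPzRingType.

Definition hom_id (M : lmodType R) : hom M M := (idfun : {linear M -> M}).
Definition hom_comp (M N P : lmodType R) (g : hom N P) (f : hom M N) :
  hom M P := (g \o f : {linear M -> P}).

Fact hom_comp1m (M N : lmodType R) (f : hom M N) : hom_comp (hom_id N) f = f.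
Proof. exact: linear_map_eq. Qed.
Fact hom_compm1 (M N : lmodType R) (f : hom M N) : hom_comp f (hom_id M) = f.
Proof. exact: linear_map_eq. Qed.
Fact hom_compA (M N P Q : lmodType R)
    (h : hom P Q) (g : hom N P) (f : hom M N) :
  hom_comp h (hom_comp g f) = hom_comp (hom_comp h g) f.
Proof. exact: linear_map_eq. Qed.
Fact hom_compDl (M N P : lmodType R) (g g' : hom N P) (f : hom M N) :
  hom_comp (g + g') f = hom_comp g f + hom_comp g' f.
Proof. exact: linear_map_eq. Qed.
Fact hom_compDr (M N P : lmodType R) (g : hom N P) (f f' : hom M N) :
  hom_comp g (f + f') = hom_comp g f + hom_comp g f'.
Proof. by apply: linear_map_eq => x /=; rewrite linearD. Qed.

Definition Mod : preadditive :=
  Preadditive hom_comp1m hom_compm1 hom_compA hom_compDl hom_compDr.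

End ModCategory.

Notation mod_class R := (lmodType R -> Prop).

Section Classes.
Variable R : comPzRingType.
Implicit Types (A : mod_class R) (M N : lmodType R).

Definition isomorphic M N : Prop := exists f : {linear M -> N}, bijective f.

Definition zero_module M : Prop := forall x : M, x = 0.

Definition Add A : mod_class R := fun M =>
  exists (I : choiceType) (F : I -> lmodType R) (C : lmodType R)
    (inj : forall i, {linear F i -> C}),
    [/\ forall i, A (F i),
        @is_coproduct (Mod R) I F C inj &
        exists (s : {linear M -> C}) (r : {linear C -> M}), cancel s r].

Definition filtered_colimits A : mod_class R := fun M =>
  exists (I : small_category) (F : functor I (Mod R))
    (c : forall i, {linear F i -> M}),
    [/\ filtering I, forall i, A (F i) & @is_colimit I (Mod R) F M c].

Definition fin_gen M : Prop :=
  exists (n : nat) (p : {linear 'rV[R]_n -> M}), forall x, exists v, p v = x.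

Definition fin_pres M : Prop :=
  exists (n m : nat) (p : {linear 'rV[R]_n -> M})
    (q : {linear 'rV[R]_m -> 'rV[R]_n}),
    (forall x, exists v, p v = x) /\
    (forall v, p v = 0 <-> exists w, q w = v).

Definition projective M : Prop :=
  forall (A B : lmodType R) (p : {linear A -> B}) (f : {linear M -> B}),
    (forall b, exists a, p a = b) ->
    exists g : {linear M -> A}, forall x, p (g x) = f x.

Definition injective_module M : Prop :=
  forall (A B : lmodType R) (i : {linear A -> B}) (f : {linear A -> M}),
    injective i -> exists g : {linear B -> M}, forall x, g (i x) = f x.

Definition is_bilinear M N (P : lmodType R) (b : M -> N -> P) : Prop :=
  (forall x, linear (b x)) /\ (forall y, linear (b^~ y)).

(* [b] exhibits [T] as the tensor product of [M] and [N]. *)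
Definition is_tensor M N (T : lmodType R) (b : M -> N -> T) : Prop :=
  is_bilinear b /\
  forall (P : lmodType R) (c : M -> N -> P), is_bilinear c ->
    exists! u : {linear T -> P}, forall x y, u (b x y) = c x y.

(* [u] is id_M (x) f; tensor products exist and are unique up to a unique
   isomorphism, so it does not matter which ones are taken. *)
Definition flat M : Prop :=
  forall (A B : lmodType R) (f : {linear A -> B}), injective f ->
  forall (TA TB : lmodType R) (bA : M -> A -> TA) (bB : M -> B -> TB),
    is_tensor bA -> is_tensor bB ->
  forall u : {linear TA -> TB},
    (forall x y, u (bA x y) = bB x (f y)) -> injective u.

End Classes.

Section Ring.
Variable R : comPzRingType.

Definition is_ideal (J : R -> Prop) : Prop :=
  [/\ J 0, forall x y, J x -> J y -> J (x + y) &
      forall a x, J x -> J (a * x)].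

Definition noetherian : Prop :=
  forall J : R -> Prop, is_ideal J ->
    exists (n : nat) (g : 'I_n -> R),
      forall x, J x <-> exists c : 'I_n -> R, x = \sum_(i < n) c i * g i.

End Ring.

(* Cohomological indexing. The differential is given for all pairs of degrees,
   and vanishes unless the second is the successor of the first: this avoids
   transports along equalities between degrees. *)
Record complex (R : comPzRingType) := Complex {
  cobj :> int -> lmodType R;
  d : forall i j, {linear cobj i -> cobj j};
  d_shape : forall i j, j != i + 1 -> forall x, d i j x = 0;
  d_comp : forall i j k x, d j k (d i j x) = 0
}.
Arguments d {R} c i j.

Record chain_map (R : comPzRingType) (X Y : complex R) := ChainMap {
  cmap :> forall i, {linear X i -> Y i};
  cmapP : forall i j x, cmap j (d X i j x) = d Y i j (cmap i x)
}.

Section ChainMaps.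
Variables (R : comPzRingType) (X Y : complex R).
Implicit Types f g h : chain_map X Y.

Lemma chain_map_eq f g : (forall i x, f i x = g i x) -> f = g.
Proof.
case: f g => [f fP] [g gP] /= efg.
have e : f = g.
  apply: functional_extensionality_dep => i.
  by apply: linear_map_eq => x; exact: efg.
by move: e fP {efg} => -> fP; rewrite (Prop_irrelevance fP gP).
Qed.

HB.instance Definition _ := gen_eqMixin (chain_map X Y).
HB.instance Definition _ := gen_choiceMixin (chain_map X Y).

Definition chain_zero : chain_map X Y.
Proof.
by exists (fun i => (\0 : {linear X i -> Y i})) => i j x /=; rewrite linear0.
Defined.

Definition chain_opp f : chain_map X Y.
Proof.
exists (fun i => (\- f i : {linear X i -> Y i})) => i j x /=.
by rewrite linearN cmapP.
Defined.

Definition chain_add f g : chain_map X Y.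
Proof.
exists (fun i => (f i \+ g i : {linear X i -> Y i})) => i j x /=.
by rewrite linearD !cmapP.
Defined.

Fact chain_addA : associative chain_add.
Proof. by move=> f g h; apply: chain_map_eq => i x /=; rewrite addrA. Qed.
Fact chain_addC : commutative chain_add.
Proof. by move=> f g; apply: chain_map_eq => i x /=; rewrite addrC. Qed.
Fact chain_add0 : left_id chain_zero chain_add.
Proof. by move=> f; apply: chain_map_eq => i x /=; rewrite add0r. Qed.
Fact chain_addN : left_inverse chain_zero chain_opp chain_add.
Proof. by move=> f; apply: chain_map_eq => i x /=; rewrite addNr. Qed.

HB.instance Definition _ := GRing.isZmodule.Build (chain_map X Y)
  chain_addA chain_addC chain_add0 chain_addN.

(* Only the components [s i j] with i = j + 1 of the homotopy matter. *)
Definition null_homotopic f : Prop :=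
  exists s : forall i j, {linear X i -> Y j}, forall i x,
    f i x = d Y (i - 1) i (s i (i - 1) x) + s (i + 1) i (d X i (i + 1) x).

Definition null_homotopicb f : bool := `[< null_homotopic f >].

Fact null_homotopic_zmod_closed : zmod_closed null_homotopicb.
Proof.
split=> [|f g]; rewrite !unfold_in.
  apply/asboolP; exists (fun i j => (\0 : {linear X i -> Y j})) => i x /=.
  by rewrite linear0 addr0.
move=> /asboolP[s sP] /asboolP[t tP]; apply/asboolP.
exists (fun i j => (s i j \+ (\- t i j) : {linear X i -> Y j})) => i x.
transitivity (f i x - g i x); first by [].
rewrite sP tP opprD addrACA; congr (_ + _).
by rewrite -[RHS]/(d Y (i - 1) i (s i (i - 1) x - t i (i - 1) x)) linearB.
Qed.

HB.instance Definition _ := GRing.isZmodClosed.Build (chain_map X Y)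
  null_homotopicb null_homotopic_zmod_closed.

Definition htp_class :=
  Quotient.quot (GRing.ZmodClosed.clone _ null_homotopicb _).
HB.instance Definition _ := ZmodQuotient.on htp_class.

End ChainMaps.

Section Homotopy.
Variable R : comPzRingType.
Implicit Types X Y Z W : complex R.

Definition chain_id X : chain_map X X.
Proof. by exists (fun i => (idfun : {linear X i -> X i})). Defined.

Definition chain_comp X Y Z (g : chain_map Y Z) (f : chain_map X Y) :
  chain_map X Z.
Proof.
exists (fun i => (g i \o f i : {linear X i -> Z i})) => i j x /=.
by rewrite !cmapP.
Defined.

Definition htp_id X : htp_class X X := \pi_(htp_class X X) (chain_id X).

Definition htp_comp X Y Z (g : htp_class Y Z) (f : htp_class X Y) :
  htp_class X Z := \pi_(htp_class X Z) (chain_comp (repr g) (repr f)).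

Lemma htp_piP X Y (f g : chain_map X Y) :
  reflect (null_homotopic (f - g))
    (\pi_(htp_class X Y) f == \pi_(htp_class X Y) g).
Proof. by rewrite -Quotient.idealrBE; exact: asboolP. Qed.

Lemma htp_comp_pi X Y Z (g : chain_map Y Z) (f : chain_map X Y) :
  htp_comp (\pi_(htp_class Y Z) g) (\pi_(htp_class X Y) f) =
  \pi_(htp_class X Z) (chain_comp g f).
Proof.
rewrite /htp_comp; apply/eqP/htp_piP.
have /eqP/htp_piP[s sP] := reprK (\pi_(htp_class Y Z) g).
have /eqP/htp_piP[t tP] := reprK (\pi_(htp_class X Y) f).
set g' := repr _ in sP *; set f' := repr _ in tP *.
exists (fun i j => ((s i j \o f' i) \+ (g j \o t i j) : {linear X i -> Z j})).
move=> i x /=.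
have {}sP y : g' i y - g i y = _ := sP i y.
have {}tP y : f' i y - f i y = _ := tP i y.
transitivity ((g' i (f' i x) - g i (f' i x)) + g i (f' i x - f i x)).
  by rewrite [in RHS]linearB addrA subrK.
by rewrite sP tP !linearD -!cmapP /= addrACA.
Qed.

Fact htp_comp1m X Y (f : htp_class X Y) : htp_comp (htp_id Y) f = f.
Proof.
rewrite -[f]reprK /htp_id htp_comp_pi.
by congr (\pi_(htp_class _ _) _); exact: chain_map_eq.
Qed.

Fact htp_compm1 X Y (f : htp_class X Y) : htp_comp f (htp_id X) = f.
Proof.
rewrite -[f]reprK /htp_id htp_comp_pi.
by congr (\pi_(htp_class _ _) _); exact: chain_map_eq.
Qed.

Fact htp_compA X Y Z W
    (h : htp_class Z W) (g : htp_class Y Z) (f : htp_class X Y) :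
  htp_comp h (htp_comp g f) = htp_comp (htp_comp h g) f.
Proof.
rewrite -[f]reprK -[g]reprK -[h]reprK.
move: (repr f) (repr g) (repr h) => {}f {}g {}h.
rewrite (htp_comp_pi g f) (htp_comp_pi h g) (htp_comp_pi h (chain_comp g f)).
rewrite (htp_comp_pi (chain_comp h g) f); congr (\pi_(htp_class _ _) _).
by apply: chain_map_eq => i x.
Qed.

Fact htp_compDl X Y Z (g g' : htp_class Y Z) (f : htp_class X Y) :
  htp_comp (g + g') f = htp_comp g f + htp_comp g' f.
Proof.
rewrite -[f]reprK -[g]reprK -[g']reprK -raddfD !htp_comp_pi -raddfD.
by congr (\pi_(htp_class _ _) _); exact: chain_map_eq.
Qed.

Fact htp_compDr X Y Z (g : htp_class Y Z) (f f' : htp_class X Y) :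
  htp_comp g (f + f') = htp_comp g f + htp_comp g f'.
Proof.
rewrite -[f]reprK -[g]reprK -[f']reprK -raddfD !htp_comp_pi -raddfD.
congr (\pi_(htp_class _ _) _).
by apply: chain_map_eq => i x /=; rewrite linearD.
Qed.

Variable A : mod_class R.

Definition complex_in := {X : complex R | forall i, A (X i)}.

Definition K : preadditive :=
  @Preadditive complex_in
    (fun X Y : complex_in => htp_class (sval X) (sval Y))
    (fun X : complex_in => htp_id (sval X))
    (fun X Y Z : complex_in => @htp_comp (sval X) (sval Y) (sval Z))
    (fun X Y : complex_in => @htp_comp1m (sval X) (sval Y))
    (fun X Y : complex_in => @htp_compm1 (sval X) (sval Y))
    (fun X Y Z W : complex_in => @htp_compA (sval X) (sval Y) (sval Z) (sval W))
    (fun X Y Z : complex_in => @htp_compDl (sval X) (sval Y) (sval Z))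
    (fun X Y Z : complex_in => @htp_compDr (sval X) (sval Y) (sval Z)).

End Homotopy.

Section Exactness.
Variable R : comPzRingType.
Implicit Types (A : mod_class R) (X Y F : complex R) (M N P : lmodType R).

Definition exact X : Prop :=
  forall i (x : X i), d X i (i + 1) x = 0 -> exists y, d X (i - 1) i y = x.

Definition hom_exact N X : Prop :=
  forall i (f : {linear N -> X i}), (forall x, d X i (i + 1) (f x) = 0) ->
    exists g : {linear N -> X (i - 1)}, forall x, d X (i - 1) i (g x) = f x.

(* Exactness of the complex M (x) X, presented as the complex [T] with
   differentials id_M (x) d. *)
Definition tensor_exact M X : Prop :=
  forall (T : complex R) (b : forall i, M -> X i -> T i),
    (forall i, is_tensor (b i)) ->
    (forall i j x y, d T i j (b i x y) = b j x (d X i j y)) ->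
    exact T.

(* [Y] is ... -> Y (-1) -> Y 0 -> N -> 0 with N, up to isomorphism, in degree 1
   and modules from [A] in degrees at most 0. *)
Definition left_augmented A N Y : Prop :=
  [/\ isomorphic (Y 1) N, forall i, 1 < i -> zero_module (Y i) &
      forall i, i <= 0 -> A (Y i)].

(* Ext^i(M, N) = 0 for i >= 1, computed as the cohomology of Hom(P, N) for a
   projective resolution P of M; P_i is [Y (- i)]. *)
Definition Ext_vanishes (i : nat) M N : Prop :=
  forall Y, left_augmented (@projective R) M Y -> exact Y ->
  forall f : {linear Y (- i%:Z) -> N},
    (forall x, f (d Y (- i%:Z - 1) (- i%:Z) x) = 0) ->
    exists g : {linear Y (- i%:Z + 1) -> N},
      forall x, f x = g (d Y (- i%:Z) (- i%:Z + 1) x).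

Definition finite_injective_dimension N : Prop :=
  exists (n : nat) (Y : complex R),
    [/\ exact Y, isomorphic (Y (-1)) N,
        forall i, i < -1 -> zero_module (Y i),
        forall i, 0 <= i -> injective_module (Y i) &
        forall i, n%:Z < i -> zero_module (Y i)].

Definition pure_exact Y : Prop := forall N, fin_pres N -> hom_exact N Y.

Definition pure_projective P : Prop := forall Y, pure_exact Y -> hom_exact P Y.

End Exactness.

Definition finite_pure_global_dimension (R : comPzRingType) : Prop :=
  exists n : nat, forall N : lmodType R, exists Y : complex R,
    [/\ left_augmented (@pure_projective R) N Y, pure_exact Y &
        forall i, i < - n%:Z -> zero_module (Y i)].

Section Gorenstein.
Variable R : comPzRingType.

Definition dual (M : lmodType R) : lmodType R := hom M R^o.

Section Evaluation.
Variables (M : lmodType R) (x : M).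
Definition eval_at (f : dual M) : R^o := (f : {linear M -> R^o}) x.
Fact eval_at_linear : linear eval_at. Proof. by []. Qed.
HB.instance Definition _ :=
  GRing.isLinear.Build R (dual M) R^o _ eval_at eval_at_linear.
End Evaluation.

Definition biduality (M : lmodType R) (x : M) : dual (dual M) :=
  (eval_at x : {linear dual M -> R^o}).

Definition Gproj : mod_class R := fun M =>
  [/\ fin_gen M, bijective (@biduality M),
      forall i, (0 < i)%N -> Ext_vanishes i M R^o &
      forall i, (0 < i)%N -> Ext_vanishes i (dual M) R^o].

Definition GFlat : mod_class R := fun M =>
  exists F : complex R,
    [/\ exact F, forall i, flat (F i),
        forall J : lmodType R, injective_module J -> tensor_exact J F &
        exists (i : int) (k : {linear M -> F i}), injective k /\
          forall y, d F i (i + 1) y = 0 <-> exists x, k x = y].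

End Gorenstein.

Section Dualizing.
Variable R : comPzRingType.
Implicit Types X D : complex R.

Section Shift.
Variables (n : int) (X : complex R).
Let dn (i j : int) : {linear X (i + n) -> X (j + n)} :=
  ((-1) ^+ `|n|%N \*: d X (i + n) (j + n) :
    {linear X (i + n) -> X (j + n)}).

Fact shift_shape i j : j != i + 1 -> forall x, dn i j x = 0.
Proof.
move=> ij x /=; rewrite d_shape ?scaler0 //.
by rewrite addrAC (inj_eq (addIr _)).
Qed.

Fact shift_comp i j k x : dn j k (dn i j x) = 0.
Proof. by rewrite /= linearZ /= d_comp !scaler0. Qed.

Definition shift : complex R := Complex shift_shape shift_comp.
End Shift.

Definition homothety X (r : R) : chain_map X X.
Proof.
exists (fun i => (r \*: (idfun : {linear X i -> X i}) : {linear X i -> X i})).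
by move=> i j x /=; rewrite linearZ.
Defined.

Definition bounded X : Prop :=
  exists n : nat, forall i, (n < `|i|)%N -> zero_module (X i).

Definition fin_gen_cohomology X (i : int) : Prop :=
  exists (n : nat) (z : 'I_n -> X i),
    (forall k, d X i (i + 1) (z k) = 0) /\
    forall x, d X i (i + 1) x = 0 ->
      exists (c : 'I_n -> R) (y : X (i - 1)),
        x = \sum_(k < n) c k *: z k + d X (i - 1) i y.

(* The last two clauses say that the homothety morphism R -> Hom(D, D) is a
   quasi-isomorphism: a cocycle of degree n of the complex Hom(D, D) is a chain
   map D -> D[n], and it is a coboundary if and only if it is null-homotopic. *)
Definition dualizing D : Prop :=
  [/\ bounded D, forall i, injective_module (D i),
      forall i, fin_gen_cohomology D i,
      bijective (fun r => \pi_(htp_class D D) (homothety D r)) &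
      forall n, n != 0 -> forall f : chain_map D (shift n D), null_homotopic f].

Definition has_dualizing_complex : Prop := exists D, dualizing D.

End Dualizing.

(* Main.v *)
From HB Require Import structures.
From mathcomp Require Import all_boot all_order all_algebra.
From mathcomp Require Import generic_quotient ring_quotient.
From mathcomp Require Import boolp classical_sets.
From mathcomp Require Import zify.
Require Import Defs.

(** Write G for the class of finitely generated Gorenstein projective modules.

For a ring R of finite self-injective dimension n, both inclusions between
the filtered colimits of G and the Gorenstein flat modules come from complexes
of flat modules. A Gorenstein flat M is a cycle module of an exact complex of
flats; since a map from a finitely presented module to a flat module factors
through a finitely generated free one, every map from a finitely generated
module to M factors through a finitely generated n-th syzygy
([cyc_factor_Syz]). Over R such syzygies belong to G ([Syz_Gproj]), and a module
is a filtered colimit of G as soon as enough maps to it factor through G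
([filtered_colimits_of]). Conversely, if M is the filtered colimit of G_i, then
G_i is the dual of K_i, the dual of G_i. The functorial free resolutions of
the K_i have exact duals, and the colimits of these duals form a coresolution
of M by flats ([colim_dual_step]), which a free resolution completes to an
exact complex T of flats ([coresolved_exact]). For injective E the complex
E (x) T is exact: E is Hom (R, E), the module R is obtained from injectives by
finitely many steps of the two-out-of-three kind in short exact sequences,
exactness of the tensor product with T satisfies two-out-of-three, and
Hom (V, E) is flat for injective V ([bal_thick_inj]).

Suppose now that R has a dualizing complex D and that the filtered colimits of
G are the Gorenstein flat modules. The key point is that the Gorenstein flat
modules are closed under products ([GFlat_prod]). A bounded complex P of
finitely generated modules, all of them projective but one, C, is
quasi-isomorphic to D up to a shift, so that R is quasi-isomorphic to the
complex Hom (P, D), again up to a shift. Hence R is obtained by two-out-of-three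
from injectives and from modules Hom (C, V) with V injective ([thick_R]), and
C itself from injectives and projectives. For an exact complex T of flats it
follows that E (x) T is exact for all injective E once C (x) T is exact; and
since C is finitely presented, exactness of C (x) T passes to products of
complexes ([bal_prod]).

Consequently all the arrows from a finitely generated M to finitely generated
Gorenstein flat modules, up to isomorphism, have a product whose target is again
Gorenstein flat, and so is a filtered colimit of G. The arrow from M to the
product then factors through a module of G, and this factorization yields a
G-preenvelope of M ([Gproj_preenvelope]). Taking preenvelopes
of successive cokernels gives a complex C_M in degrees at least k whose maps to
a complex X over Add G, up to homotopy, are the cohomology classes of Hom (M, X)
in degree k ([coresolution_map], [coresolution_null]). As M is finitely
generated, C_M is compact ([coresolution_compact]). If X receives no nonzero
map from these complexes, then X is pure exact. Its terms are pure projective,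
and finite pure global dimension makes such an X contractible: its comparison
with a finite pure projective resolution of a cycle module splits the cycles
further down ([cycles_split]). *)

Set Implicit Arguments.
Unset Strict Implicit.
Unset Printing Implicit Defensive.

Import Order.TTheory GRing.Theory Num.Theory.
Local Open Scope ring_scope.

(** * Modules, products, submodules and quotients *)

Section Toolkit.
Variable R : comPzRingType.
Implicit Types (M N A B C E : lmodType R).

(** Linear maps are built from plain functions this way, so that their type is
    never inferred over a weaker structure than that of a module. *)
Definition mklin M N (f : M -> N) (fL : linear f) : {linear M -> N} :=
  HB.pack f (GRing.isLinear.Build R M N _ f fL).

Lemma mklinE M N (f : M -> N) (fL : linear f) x : mklin fL x = f x.
Proof. by []. Qed.

Definition injm M N (f : {linear M -> N}) := forall x, f x = 0 -> x = 0.
Definition surjm M N (f : {linear M -> N}) := forall y, exists x, f x = y.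

Lemma injmP M N (f : {linear M -> N}) : injm f <-> injective f.
Proof.
split=> [fI x y /eqP|fI x fx0]; last by apply: fI; rewrite fx0 linear0.
by rewrite -subr_eq0 -linearB => /eqP/fI/eqP; rewrite subr_eq0 => /eqP.
Qed.

Definition ses A B C (i : {linear A -> B}) (p : {linear B -> C}) :=
  [/\ injm i, (forall x, p x = 0 <-> exists y, i y = x) & surjm p].

Lemma factor_surj A B C (p : {linear A -> B}) (f : {linear A -> C}) :
  surjm p -> (forall x, p x = 0 -> f x = 0) ->
  exists g : {linear B -> C}, forall x, g (p x) = f x.
Proof.
move=> /choice[s sP] pf.
have fs x : f (s (p x)) = f x.
  by apply/subr0_eq; rewrite -linearB pf // linearB sP subrr.
have gL : linear (f \o s).
  move=> a x y /=; rewrite -{1}(sP x) -{1}(sP y) -linearP fs linearP //.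
by exists (mklin gL) => x /=; rewrite fs.
Qed.

Lemma factor_inj A B C (i : {linear B -> C}) (f : {linear A -> C}) :
  injm i -> (forall x, exists y, i y = f x) ->
  exists g : {linear A -> B}, forall x, i (g x) = f x.
Proof.
move=> /injmP iI /choice[s sP].
have gL : linear s by move=> a x y; apply: iI; rewrite linearP !sP linearP.
by exists (mklin gL).
Qed.

Lemma bij_inv A B (f : {linear A -> B}) : injm f -> surjm f ->
  exists g : {linear B -> A}, cancel f g /\ cancel g f.
Proof.
move=> fI fS; have [g gP] := @factor_inj B A B f idfun fI fS.
by exists g; split=> [x|//]; apply/(injmP f).1.
Qed.

End Toolkit.

Section ProdM.
Variables (R : comPzRingType) (I : Type) (F : I -> lmodType R).
Definition prodM := forall i, F i.
HB.instance Definition _ := gen_eqMixin prodM.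
HB.instance Definition _ := gen_choiceMixin prodM.
Implicit Types x y z : prodM.
Definition prod_add x y : prodM := fun i => x i + y i.
Definition prod_opp x : prodM := fun i => - x i.
Definition prod_scale (a : R) x : prodM := fun i => a *: x i.
Fact prod_addA : associative prod_add.
Proof. by move=> x y z; apply/functional_extensionality_dep => i; exact: addrA. Qed.
Fact prod_addC : commutative prod_add.
Proof. by move=> x y; apply/functional_extensionality_dep => i; exact: addrC. Qed.
Fact prod_add0 : left_id ((fun=> 0) : prodM) prod_add.
Proof. by move=> x; apply/functional_extensionality_dep => i; exact: add0r. Qed.
Fact prod_addN : left_inverse ((fun=> 0) : prodM) prod_opp prod_add.
Proof. by move=> x; apply/functional_extensionality_dep => i; exact: addNr. Qed.
HB.instance Definition _ :=
  GRing.isZmodule.Build prodM prod_addA prod_addC prod_add0 prod_addN.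
Fact prod_scaleA a b x : prod_scale a (prod_scale b x) = prod_scale (a * b) x.
Proof. by apply/functional_extensionality_dep => i; exact: scalerA. Qed.
Fact prod_scale1 : left_id 1 prod_scale.
Proof. by move=> x; apply/functional_extensionality_dep => i; exact: scale1r. Qed.
Fact prod_scaleDr : right_distributive prod_scale +%R.
Proof. by move=> a x y; apply/functional_extensionality_dep => i; exact: scalerDr. Qed.
Fact prod_scaleDl x : {morph prod_scale^~ x : a b / a + b}.
Proof. by move=> a b; apply/functional_extensionality_dep => i; exact: scalerDl. Qed.
HB.instance Definition _ := GRing.Zmodule_isLmodule.Build R prodM
  prod_scaleA prod_scale1 prod_scaleDr prod_scaleDl.

Lemma prodP x y : (forall i, x i = y i) -> x = y.
Proof. exact: functional_extensionality_dep. Qed.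
Lemma prod0E i : (0 : prodM) i = 0. Proof. by []. Qed.
Lemma prodDE x y i : (x + y) i = x i + y i. Proof. by []. Qed.
Lemma prodBE x y i : (x - y) i = x i - y i. Proof. by []. Qed.
Lemma prodZE a x i : (a *: x) i = a *: x i. Proof. by []. Qed.
Lemma prod_sumE (J : Type) (r : seq J) (P : pred J) (G : J -> prodM) i :
  (\sum_(j <- r | P j) G j) i = \sum_(j <- r | P j) G j i.
Proof. by elim/big_rec2: _ => //= j y1 y2 _ <-. Qed.

Fact prod_projL i : linear (fun x : prodM => x i). Proof. by []. Qed.
Definition prod_proj i : {linear prodM -> F i} := mklin (prod_projL i).

Lemma prod_mapL (M : lmodType R) (f : forall i, {linear M -> F i}) :
  linear ((fun m => (fun i => f i m)) : M -> prodM).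
Proof. by move=> a x y; apply: prodP => i; rewrite linearP. Qed.
Definition prod_map (M : lmodType R) (f : forall i, {linear M -> F i}) : {linear M -> prodM} :=
  mklin (prod_mapL f).
End ProdM.

Section SubM.
Variables (R : comPzRingType) (M : lmodType R).
(** Submodules are predicates; [subM] and [quotM] below turn them into modules. *)
Record submod := Submod {
  sm_set :> M -> Prop;
  sm0 : sm_set 0;
  smP : forall a x y, sm_set x -> sm_set y -> sm_set (a *: x + y) }.
Variable S : submod.
Lemma smD x y : S x -> S y -> S (x + y).
Proof. by move=> Sx Sy; rewrite -[x]scale1r; exact: smP. Qed.
Lemma smZ a x : S x -> S (a *: x).
Proof. by move=> Sx; rewrite -[_ *: _]addr0; apply: smP => //; exact: sm0. Qed.
Lemma smN x : S x -> S (- x).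
Proof. by move=> Sx; rewrite -scaleN1r; exact: smZ. Qed.
Lemma smB x y : S x -> S y -> S (x - y).
Proof. by move=> Sx Sy; apply: smD => //; exact: smN. Qed.
Lemma sm_sum (J : Type) (r : seq J) (P : pred J) (G : J -> M) :
  (forall j, P j -> S (G j)) -> S (\sum_(j <- r | P j) G j).
Proof.
move=> SG; elim/big_rec: _ => [|j x Pj Sx]; first exact: sm0.
by apply: smD => //; exact: SG.
Qed.

Definition subM := {x : M | S x}.
HB.instance Definition _ := gen_eqMixin subM.
HB.instance Definition _ := gen_choiceMixin subM.
Implicit Types x y z : subM.
Lemma subP x y : sval x = sval y -> x = y.
Proof. by case: x y => [x Sx] [y Sy] /= e; apply: eq_exist. Qed.
Definition sub_zero : subM := exist _ 0 (sm0 S).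
Definition sub_add x y : subM := exist _ (sval x + sval y) (smD (svalP x) (svalP y)).
Definition sub_opp x : subM := exist _ (- sval x) (smN (svalP x)).
Definition sub_scale (a : R) x : subM := exist _ (a *: sval x) (smZ a (svalP x)).
Fact sub_addA : associative sub_add.
Proof. by move=> x y z; apply: subP; exact: addrA. Qed.
Fact sub_addC : commutative sub_add.
Proof. by move=> x y; apply: subP; exact: addrC. Qed.
Fact sub_add0 : left_id sub_zero sub_add.
Proof. by move=> x; apply: subP; exact: add0r. Qed.
Fact sub_addN : left_inverse sub_zero sub_opp sub_add.
Proof. by move=> x; apply: subP; exact: addNr. Qed.
HB.instance Definition _ :=
  GRing.isZmodule.Build subM sub_addA sub_addC sub_add0 sub_addN.
Fact sub_scaleA a b x : sub_scale a (sub_scale b x) = sub_scale (a * b) x.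
Proof. by apply: subP; exact: scalerA. Qed.
Fact sub_scale1 : left_id 1 sub_scale.
Proof. by move=> x; apply: subP; exact: scale1r. Qed.
Fact sub_scaleDr : right_distributive sub_scale +%R.
Proof. by move=> a x y; apply: subP; exact: scalerDr. Qed.
Fact sub_scaleDl x : {morph sub_scale^~ x : a b / a + b}.
Proof. by move=> a b; apply: subP; exact: scalerDl. Qed.
HB.instance Definition _ := GRing.Zmodule_isLmodule.Build R subM
  sub_scaleA sub_scale1 sub_scaleDr sub_scaleDl.
Fact inclL : linear (fun x : subM => sval x). Proof. by []. Qed.
Definition incl : {linear subM -> M} := mklin inclL.
#[global] Arguments incl : simpl never.
Lemma inclE x : incl x = sval x. Proof. by []. Qed.
Lemma incl_inj : injm incl. Proof. by move=> x x0; apply: subP. Qed.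
Lemma inclP x : S (incl x). Proof. exact: svalP. Qed.
Lemma incl_lift (x : M) : S x -> exists y, incl y = x.
Proof. by move=> Sx; exists (exist _ x Sx). Qed.
Lemma incl_factor (N : lmodType R) (f : {linear N -> M}) : (forall n, S (f n)) ->
  exists g : {linear N -> subM}, forall n, incl (g n) = f n.
Proof. by move=> Sf; apply: factor_inj incl_inj _ => x; exact: incl_lift. Qed.
End SubM.

Section QuotM.
Variables (R : comPzRingType) (M : lmodType R) (S : submod M).
Lemma qrep_ex x : exists y, `[< S (y - x) >].
Proof. by exists x; apply/asboolP; rewrite subrr; exact: sm0. Qed.
(** A canonical representative: it depends on the coset only, so that the
    quotient can be carried by the canonical representatives. *)
Definition qrep x : M := xchoose (qrep_ex x).
Lemma qrepP x : S (qrep x - x).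
Proof. exact/asboolP/(xchooseP (qrep_ex x)). Qed.
Lemma qrep_eq x y : S (x - y) -> qrep x = qrep y.
Proof.
move=> Sxy; apply: eq_xchoose => z; apply/asbool_equiv_eq; split=> Sz.
  by rewrite -[z](subrK x) -addrA; apply: smD.
by rewrite -[z](subrK y) -addrA; apply: smD => //; rewrite -opprB; exact: smN.
Qed.
Lemma qrepK x : qrep (qrep x) = qrep x.
Proof. by apply: qrep_eq; exact: qrepP. Qed.
Lemma qrep_eqE x y : qrep x = qrep y -> S (x - y).
Proof.
move=> e; rewrite -[x](subrK (qrep x)) -addrA; apply: smD.
  by rewrite -opprB; apply/smN/qrepP.
by rewrite e; exact: qrepP.
Qed.
Definition quotM := {x : M | qrep x = x}.
HB.instance Definition _ := gen_eqMixin quotM.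
HB.instance Definition _ := gen_choiceMixin quotM.
Implicit Types x y z : quotM.
Definition qpi0 (x : M) : quotM := exist _ (qrep x) (qrepK x).
Lemma qpi0_eq (x y : M) : S (x - y) -> qpi0 x = qpi0 y.
Proof. by move=> /qrep_eq e; apply: eq_exist. Qed.
Lemma qpi0K x : qpi0 (sval x) = x.
Proof. by case: x => [x e]; apply: eq_exist. Qed.
Definition q_add x y : quotM := qpi0 (sval x + sval y).
Definition q_opp x : quotM := qpi0 (- sval x).
Definition q_scale (a : R) x : quotM := qpi0 (a *: sval x).
Lemma q_addE (x y : M) : q_add (qpi0 x) (qpi0 y) = qpi0 (x + y).
Proof. by apply: qpi0_eq; rewrite /= opprD addrACA; apply: smD; exact: qrepP. Qed.
Lemma q_oppE (x : M) : q_opp (qpi0 x) = qpi0 (- x).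
Proof. by apply: qpi0_eq; rewrite /= -opprD; apply/smN/qrepP. Qed.
Lemma q_scaleE a (x : M) : q_scale a (qpi0 x) = qpi0 (a *: x).
Proof. by apply: qpi0_eq; rewrite /= -scalerBr; apply/smZ/qrepP. Qed.
Fact q_addA : associative q_add.
Proof. by move=> x y z; rewrite -(qpi0K x) -(qpi0K y) -(qpi0K z) !q_addE addrA. Qed.
Fact q_addC : commutative q_add.
Proof. by move=> x y; rewrite -(qpi0K x) -(qpi0K y) !q_addE addrC. Qed.
Fact q_add0 : left_id (qpi0 0) q_add.
Proof. by move=> x; rewrite -(qpi0K x) !q_addE add0r. Qed.
Fact q_addN : left_inverse (qpi0 0) q_opp q_add.
Proof. by move=> x; rewrite -(qpi0K x) q_oppE q_addE addNr. Qed.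
HB.instance Definition _ :=
  GRing.isZmodule.Build quotM q_addA q_addC q_add0 q_addN.
Fact q_scaleA a b x : q_scale a (q_scale b x) = q_scale (a * b) x.
Proof. by rewrite -(qpi0K x) !q_scaleE scalerA. Qed.
Fact q_scale1 : left_id 1 q_scale.
Proof. by move=> x; rewrite -(qpi0K x) !q_scaleE scale1r. Qed.
Fact q_scaleDr : right_distributive q_scale +%R.
Proof.
move=> a x y; rewrite -(qpi0K x) -(qpi0K y).
by rewrite -[_ + _]/(q_add _ _) -[RHS]/(q_add _ _) !(q_addE, q_scaleE) scalerDr.
Qed.
Fact q_scaleDl x : {morph q_scale^~ x : a b / a + b}.
Proof.
move=> a b; rewrite -(qpi0K x).
by rewrite -[RHS]/(q_add _ _) !(q_addE, q_scaleE) scalerDl.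
Qed.
HB.instance Definition _ := GRing.Zmodule_isLmodule.Build R quotM
  q_scaleA q_scale1 q_scaleDr q_scaleDl.
Fact qpiL : linear qpi0.
Proof.
move=> a x y; rewrite -[RHS]/(q_add (q_scale _ _) _).
by rewrite q_scaleE q_addE.
Qed.
Definition qpi : {linear M -> quotM} := mklin qpiL.
#[global] Arguments qpi : simpl never.
Lemma qpi_surj : surjm qpi. Proof. by move=> x; exists (sval x); exact: qpi0K. Qed.
Lemma qpi_ker (x : M) : qpi x = 0 <-> S x.
Proof.
split=> [e|Sx]; last first.
  by rewrite -[RHS](linear0 qpi); apply: qpi0_eq; rewrite subr0.
rewrite -[x]subr0; apply: qrep_eqE.
exact: (congr1 (fun q : quotM => sval q) (etrans e (esym (linear0 qpi)))).
Qed.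
Lemma quot_factor (N : lmodType R) (f : {linear M -> N}) : (forall m, S m -> f m = 0) ->
  exists g : {linear quotM -> N}, forall m, g (qpi m) = f m.
Proof. by move=> Sf; apply: factor_surj qpi_surj _ => x /qpi_ker/Sf. Qed.
End QuotM.

Section KerIm.
Variables (R : comPzRingType).
Implicit Types (M N A B C E : lmodType R).
Definition kerS M N (f : {linear M -> N}) : submod M.
Proof.
exists (fun x => f x = 0); first exact: linear0.
by move=> a x y fx fy; rewrite linearP fx fy scaler0 addr0.
Defined.
Definition imS M N (f : {linear M -> N}) : submod N.
Proof.
exists (fun y => exists x, f x = y); first by exists 0; exact: linear0.
by move=> a _ _ [x <-] [y <-]; exists (a *: x + y); rewrite linearP.
Defined.
Definition kerM M N (f : {linear M -> N}) : lmodType R := subM (kerS f).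
Definition imM M N (f : {linear M -> N}) : lmodType R := subM (imS f).
Definition cokM M N (f : {linear M -> N}) : lmodType R := quotM (imS f).

Lemma inj_ext A B E (p : {linear A -> B}) (f : {linear A -> E}) :
  injective_module E -> (forall x, p x = 0 -> f x = 0) ->
  exists g : {linear B -> E}, forall x, g (p x) = f x.
Proof.
move=> EI pf.
have [p' p'P] := @incl_factor _ _ (imS p) _ p (fun x => ex_intro _ x erefl).
have p'S : surjm p'.
  move=> y; have [x xy] := inclP y; exists x; apply/(injmP _).1; first exact: incl_inj.
  by rewrite p'P.
have [|h hP] := @factor_surj _ _ _ _ p' f p'S.
  by move=> x px; apply: pf; rewrite -p'P px linear0.
have [g gP] := EI _ _ (incl (imS p)) h ((injmP _).1 (@incl_inj _ _ _)).
by exists g => x; rewrite -p'P gP hP.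
Qed.

Lemma ses_ker M N (p : {linear M -> N}) : surjm p -> ses (incl (kerS p)) p.
Proof.
move=> pS; split=> // [|x]; first exact: incl_inj.
by split=> [|[y <-]]; [exact: (@incl_lift _ _ (kerS p)) | exact: (inclP y)].
Qed.
Lemma ses_cok M N (i : {linear M -> N}) : injm i -> ses i (qpi (imS i)).
Proof. by move=> iI; split=> // [x|]; [exact: qpi_ker|exact: qpi_surj]. Qed.
End KerIm.

Section HomTools.
Variables (R : comPzRingType).
Implicit Types (M N A B C E : lmodType R).

Lemma homP M N (f g : hom M N) : (forall x, f x = g x) -> f = g.
Proof. exact: linear_map_eq. Qed.
Lemma hcompE M N A (g : hom N A) (f : hom M N) x : hom_comp g f x = g (f x).
Proof. by []. Qed.
Lemma hom0E M N x : (0 : hom M N) x = 0. Proof. by []. Qed.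
Lemma homDE M N (f g : hom M N) x : (f + g) x = f x + g x. Proof. by []. Qed.
Lemma homBE M N (f g : hom M N) x : (f - g) x = f x - g x. Proof. by []. Qed.
Lemma homZE M N a (f : hom M N) x : (a *: f) x = a *: f x. Proof. by []. Qed.
Lemma hom_sumE M N (J : Type) (r : seq J) (P : pred J) (G : J -> hom M N) x :
  (\sum_(j <- r | P j) G j) x = \sum_(j <- r | P j) G j x.
Proof. by elim/big_rec2: _ => //= j y1 y2 _ <-. Qed.

(** Addition on [hom], with the module structures fixed once and for all: sums
    of linear maps are formed with this name. *)
Definition hadd M N (f g : hom M N) : hom M N := f + g.
Definition hsub M N (f g : hom M N) : hom M N := f - g.
Lemma haddE M N (f g : hom M N) x : hadd f g x = f x + g x. Proof. by []. Qed.
Lemma hsubE M N (f g : hom M N) x : hsub f g x = f x - g x. Proof. by []. Qed.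

Fact precompL M N E (f : {linear M -> N}) :
  linear ((fun g : hom N E => hom_comp g f) : hom N E -> hom M E).
Proof. by move=> a g h; apply: homP. Qed.
Definition precomp M N E (f : {linear M -> N}) : {linear hom N E -> hom M E} :=
  mklin (@precompL M N E f).
Fact postcompL M N E (f : {linear M -> N}) :
  linear ((fun g : hom E M => hom_comp f g) : hom E M -> hom E N).
Proof. by move=> a g h; apply: homP => x /=; rewrite linearP. Qed.
Definition postcomp M N E (f : {linear M -> N}) : {linear hom E M -> hom E N} :=
  mklin (@postcompL M N E f).

Fact evL M N (x : M) : linear (fun f : hom M N => f x).
Proof. by []. Qed.
Definition ev M N (x : M) : {linear hom M N -> N} := mklin (@evL M N x).

Lemma mkbil A B C (b : A -> B -> C) : (forall x, linear (b x)) ->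
  (forall y, linear (b^~ y)) ->
  exists f : {linear A -> hom B C}, forall x y, f x y = b x y.
Proof.
move=> bl br; have L : linear ((fun x => mklin (bl x)) : A -> hom B C).
  by move=> a x y; apply: homP => z; exact: br.
by exists (mklin L).
Qed.

Lemma swapex A B C (f : {linear A -> hom B C}) :
  exists g : {linear B -> hom A C}, forall x y, g y x = f x y.
Proof.
have [||g gP] := @mkbil B A C (fun y x => f x y).
- by move=> y a x x'; rewrite linearP.
- by move=> x a y y'; rewrite linearP.
by exists g.
Qed.

Fact pin1L M N : linear ((fun x => (x, 0)) : M -> (M * N)%type).
Proof. by move=> a x y; congr (_, _); rewrite /= scaler0 addr0. Qed.
Definition pin1 M N : {linear M -> (M * N)%type} := mklin (@pin1L M N).
Fact pin2L M N : linear ((fun x => (0, x)) : N -> (M * N)%type).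
Proof. by move=> a x y; congr (_, _); rewrite /= scaler0 addr0. Qed.
Definition pin2 M N : {linear N -> (M * N)%type} := mklin (@pin2L M N).
Fact pfstL M N : linear (fst : (M * N)%type -> M). Proof. by []. Qed.
Definition pfst M N : {linear (M * N)%type -> M} := mklin (@pfstL M N).
Fact psndL M N : linear (snd : (M * N)%type -> N). Proof. by []. Qed.
Definition psnd M N : {linear (M * N)%type -> N} := mklin (@psndL M N).
Lemma pinE M N (x : M) (y : N) : (x, y) = pin1 M N x + pin2 M N y.
Proof. by congr (_, _); rewrite /= ?addr0 ?add0r. Qed.
Lemma ses_pair M N : ses (pin1 M N) (psnd M N).
Proof.
split=> [x [//]|[x y]|y]; last by exists (0, y).
by split=> [/= ->|[z [_ <-]]//]; exists x.
Qed.
End HomTools.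

(** * Coproducts, free modules and noetherian rings *)

Section Coprod.
Variables (R : comPzRingType) (I : choiceType) (F : I -> lmodType R).

Definition fin_supp : submod (prodM F).
Proof.
exists (fun x : prodM F => exists s : seq I, forall i, i \notin s -> x i = 0).
  by exists [::].
move=> a x y [s sx] [t ty]; exists (s ++ t) => i.
rewrite mem_cat negb_or => /andP[/sx xi /ty yi].
by rewrite prodDE prodZE xi yi scaler0 addr0.
Defined.
Definition coprod : lmodType R := subM fin_supp.

Definition coin_fun i (x : F i) : prodM F := fun j =>
  if pselect (i = j) is left e then ecast k (F k) e x else 0.
Lemma coin_same i (x : F i) : coin_fun x i = x.
Proof. by rewrite /coin_fun; case: pselect => // e; rewrite (Prop_irrelevance e erefl). Qed.
Lemma coin_diff i j (x : F i) : i <> j -> coin_fun x j = 0.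
Proof. by rewrite /coin_fun; case: pselect. Qed.
Lemma coin_supp i (x : F i) : fin_supp (coin_fun x).
Proof. by exists [:: i] => j; rewrite inE => /eqP ij; rewrite coin_diff // => /esym. Qed.
Lemma coinL i : linear ((fun x : F i => exist _ _ (coin_supp x)) : F i -> coprod).
Proof.
move=> a x y; apply: subP; apply: prodP => j /=.
rewrite /= prodDE prodZE; have [<-|ij] := pselect (i = j); first by rewrite !coin_same.
by rewrite !coin_diff // scaler0 addr0.
Qed.
Definition coin i : {linear F i -> coprod} := mklin (@coinL i).
#[global] Arguments coin : simpl never.
Lemma coinE i x j : sval (coin i x) j = coin_fun x j. Proof. by []. Qed.

(** Summing over any list that contains the support gives the same result; this
    makes the linear map of [coprod_univ] well defined. *)
Lemma eq_sum_supp (V : nmodType) (s t : seq I) (g : I -> V) :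
  uniq s -> uniq t -> (forall i, i \notin s -> g i = 0) ->
  (forall i, i \notin t -> g i = 0) -> \sum_(i <- s) g i = \sum_(i <- t) g i.
Proof.
move=> us ut gs gt.
have H (r q : seq I) : (forall i, i \notin q -> g i = 0) ->
    \sum_(i <- r) g i = \sum_(i <- [seq j <- r | j \in q]) g i.
  move=> gq; rewrite big_filter [RHS]big_mkcond; apply: eq_bigr => i _.
  by case: ifPn => // /gq.
rewrite (H s t gt) (H t s gs); apply: perm_big; apply: uniq_perm.
- exact: filter_uniq.
- exact: filter_uniq.
by move=> i; rewrite !mem_filter andbC.
Qed.

Lemma coprod_supp (x : coprod) : exists s : seq I,
  uniq s /\ forall i, i \notin s -> sval x i = 0.
Proof.
case: x => x [s xs]; exists (undup s); split=> [|i]; first exact: undup_uniq.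
by rewrite mem_undup; exact: xs.
Qed.

Lemma coprod_sval_sum (J : Type) (r : seq J) (G : J -> coprod) i :
  sval (\sum_(j <- r) G j) i = \sum_(j <- r) sval (G j) i.
Proof. by elim/big_rec2: _ => //= j y1 y2 _ <-. Qed.

Lemma coprod_sum (x : coprod) (s : seq I) :
  uniq s -> (forall i, i \notin s -> sval x i = 0) ->
  x = \sum_(i <- s) coin i (sval x i).
Proof.
move=> us xs; apply: subP; apply: prodP => i; rewrite coprod_sval_sum.
have [si|/[dup] si /xs ->] := boolP (i \in s); last first.
  rewrite big_seq big1 // => j js; rewrite coinE coin_diff // => ji.
  by rewrite -ji js in si.
rewrite (bigD1_seq i) //= coin_same big1 ?addr0 // => j ji.
by rewrite coin_diff //; exact/eqP.
Qed.

Lemma coprod_univ (N : lmodType R) (f : forall i, {linear F i -> N}) :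
  exists u : {linear coprod -> N}, forall i x, u (coin i x) = f i x.
Proof.
have [s sP] := choice coprod_supp.
pose g (x : coprod) := \sum_(i <- s x) f i (sval x i).
have gE x t : uniq t -> (forall i, i \notin t -> sval x i = 0) ->
    g x = \sum_(i <- t) f i (sval x i).
  move=> ut xt; have [us xs] := sP x; apply: eq_sum_supp => // i.
    by move=> /xs ->; rewrite linear0.
  by move=> /xt ->; rewrite linear0.
have gL : linear g.
  move=> a x y; pose t := undup (s x ++ s y ++ s (a *: x + y)).
  have ut : uniq t by exact: undup_uniq.
  have T z : (forall i, i \in s z -> i \in t) -> g z = \sum_(i <- t) f i (sval z i).
    move=> zt; apply: gE => // i it; apply: (sP z).2.
    by apply: contra it; exact: zt.
  rewrite !T; first last.
  - by move=> i; rewrite mem_undup !mem_cat => ->; rewrite ?orbT.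
  - by move=> i; rewrite mem_undup !mem_cat => ->; rewrite ?orbT.
  - by move=> i; rewrite mem_undup !mem_cat => ->; rewrite ?orbT.
  rewrite scaler_sumr -big_split; apply: eq_bigr => i _ /=.
  by rewrite prodDE prodZE linearP.
exists (mklin gL) => i x; rewrite mklinE (gE _ [:: i]) // ?big_seq1 ?coinE ?coin_same //.
by move=> j; rewrite inE => /eqP ji; rewrite coinE coin_diff // => /esym.
Qed.

Lemma coprod_ext (N : lmodType R) (u v : {linear coprod -> N}) :
  (forall i x, u (coin i x) = v (coin i x)) -> forall x, u x = v x.
Proof.
move=> uv x; have [s [us xs]] := coprod_supp x.
by rewrite (coprod_sum us xs) !linear_sum; apply: eq_bigr => i _; exact: uv.
Qed.

End Coprod.

Section Free.
Variables (R : comPzRingType).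
Implicit Types (M N A B C E : lmodType R).

Definition Free (X : choiceType) : lmodType R := coprod (fun _ : X => R^o : lmodType R).
Definition fbase (X : choiceType) (x : X) : Free X :=
  coin (fun _ : X => R^o : lmodType R) x (1 : R^o).

Fact scalarL M (m : M) : linear ((fun a : R^o => a *: m) : R^o -> M).
Proof. by move=> a x y; rewrite scalerDl scalerA. Qed.
Definition scalar_map M (m : M) : {linear (R^o : lmodType R) -> M} :=
  mklin (@scalarL M m).

Lemma free_univ (X : choiceType) M (f : X -> M) :
  exists u : {linear Free X -> M}, forall x, u (fbase x) = f x.
Proof.
have [u uP] := coprod_univ (fun x : X => scalar_map (f x)).
by exists u => x; rewrite uP /= scale1r.
Qed.

Lemma free_ext (X : choiceType) M (u v : {linear Free X -> M}) :
  (forall x, u (fbase x) = v (fbase x)) -> forall x, u x = v x.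
Proof.
move=> uv; apply: coprod_ext => i a.
by rewrite -[a]mulr1 -[a * 1]/(a *: (1 : R^o)) !linearZ; congr (_ *: _); exact: uv.
Qed.

Lemma free_projective X : projective (Free X).
Proof.
move=> A B p f pS; have [s sP] := choice pS.
have [g gP] := free_univ (fun x => s (f (fbase x))).
exists g => x.
by apply: (free_ext (u := (p \o g : {linear _ -> _})) (v := f)) => {}x /=; rewrite gP sP.
Qed.

Lemma freecov_ex M : exists u : {linear Free M -> M}, forall x, u (fbase x) = x.
Proof. exact: free_univ. Qed.
Definition freecov M : {linear Free M -> M} := sval (cid (freecov_ex M)).
Lemma freecovE M x : freecov M (fbase x) = x.
Proof. exact: svalP (cid (freecov_ex M)) x. Qed.
Lemma freecov_surj M : surjm (freecov M).
Proof. by move=> x; exists (fbase x); exact: freecovE. Qed.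
End Free.
Arguments Free R X : clear implicits.

Section Rows.
Variables (R : comPzRingType).
Implicit Types (M N A B C E : lmodType R).

Fact rowmapL M n (g : 'I_n -> M) :
  linear (fun v : 'rV[R]_n => \sum_k v 0 k *: g k).
Proof.
move=> a x y; rewrite scaler_sumr -big_split; apply: eq_bigr => k _ /=.
by rewrite !mxE scalerDl scalerA.
Qed.
Definition rowmap M n (g : 'I_n -> M) : {linear 'rV[R]_n -> M} := mklin (rowmapL g).
#[global] Arguments rowmap : simpl never.
Lemma rowmapE M n (g : 'I_n -> M) v : rowmap g v = \sum_k v 0 k *: g k.
Proof. by []. Qed.
Lemma rowmap_delta M n (g : 'I_n -> M) k : rowmap g (delta_mx 0 k) = g k.
Proof.
rewrite rowmapE (bigD1 k) //= mxE !eqxx scale1r big1 ?addr0 // => j jk.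
by rewrite mxE (negbTE jk) andbF scale0r.
Qed.
Lemma row_mapE M n (f : {linear 'rV[R]_n -> M}) v :
  f v = \sum_k v 0 k *: f (delta_mx 0 k).
Proof. by rewrite {1}(row_sum_delta v) linear_sum; apply: eq_bigr => k _; rewrite linearZ. Qed.
Lemma row_ext M n (f g : {linear 'rV[R]_n -> M}) :
  (forall k, f (delta_mx 0 k) = g (delta_mx 0 k)) -> forall v, f v = g v.
Proof. by move=> fg v; rewrite !row_mapE; apply: eq_bigr => k _; rewrite fg. Qed.

Lemma row_projective n : projective ('rV[R]_n).
Proof.
move=> A B p f pS; have [s sP] := choice pS.
exists (rowmap (fun k => s (f (delta_mx 0 k)))) => x.
by apply: (row_ext (f := (p \o rowmap _ : {linear _ -> _}))) => k; rewrite -[LHS]/(p (rowmap _ _)) rowmap_delta sP.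
Qed.

Definition gen M (S : submod M) n (g : 'I_n -> M) :=
  (forall k, S (g k)) /\ forall x, S x -> exists v, rowmap g v = x.
Definition fgS M (S : submod M) := exists n (g : 'I_n -> M), gen S g.
Definition noeth M := forall S : submod M, fgS S.

Definition preS M N (f : {linear M -> N}) (S : submod N) : submod M.
Proof.
exists (fun x => S (f x)); first by rewrite linear0; exact: sm0.
by move=> a x y Sx Sy; rewrite linearP; exact: smP.
Defined.
Definition imgS M N (f : {linear M -> N}) (S : submod M) : submod N.
Proof.
exists (fun y => exists2 x, S x & f x = y); first by exists 0; [exact: sm0|exact: linear0].
by move=> a _ _ [x Sx <-] [y Sy <-]; exists (a *: x + y); [exact: smP|rewrite linearP].
Defined.

Lemma noeth_surj M N (p : {linear M -> N}) : surjm p -> noeth M -> noeth N.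
Proof.
move=> pS nM S; have [n [g [gS gG]]] := nM (preS p S).
exists n, (fun k => p (g k)); split=> // y Sy.
have [x xy] := pS y; have [|v vx] := gG x; first by rewrite /= xy.
by exists v; rewrite -xy -vx !rowmapE linear_sum; apply: eq_bigr => k _; rewrite linearZ.
Qed.

(** Generators of S are generators of its intersection with the kernel of f
    together with lifts of generators of its image. *)
Lemma noeth_ext M N (f : {linear M -> N}) :
  noeth (kerM f) -> noeth N -> noeth M.
Proof.
move=> nK nN S.
have [n [g [gS gG]]] := nN (imgS f S).
have [m [h [hS hG]]] := nK (preS (incl (kerS f)) S).
have [t tP] := choice (fun k => let: ex_intro2 x Sx fx := gS k in ex_intro (fun x => S x /\ f x = g k) x (conj Sx fx)).
exists (m + n)%N, (fun k => match split k with inl i => incl _ (h i) | inr j => t j end).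
split=> [k|x Sx]; first by case: (split k) => [i|j]; [exact: hS|exact: (tP j).1].
have [|v vx] := gG (f x); first by exists x.
have Kx : kerS f (x - rowmap t v).
  rewrite /= linearB -vx !rowmapE linear_sum; apply/eqP; rewrite subr_eq0; apply/eqP.
  by apply: eq_bigr => k _; rewrite linearZ /= (tP k).2.
have [z zx] := incl_lift Kx.
have [|w wx] := hG z.
  rewrite -[preS _ _ _]/(S (incl _ z)) zx; apply: smB => //; apply: sm_sum => k _.
  by apply: smZ; exact: (tP k).1.
exists (row_mx w v); rewrite rowmapE big_split_ord /=.
rewrite -[RHS](subrK (rowmap t v)) -zx -wx !rowmapE linear_sum; congr (_ + _).
  by apply: eq_bigr => k _; rewrite row_mxEl linearZ (unsplitK (inl _ k)).
by apply: eq_bigr => k _; rewrite row_mxEr (unsplitK (inr _ k)).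
Qed.

Hypothesis noethR : noetherian R.

Lemma noeth_R : noeth (R^o : lmodType R).
Proof.
move=> S; have [|n [g gP]] := noethR (J := S).
  by split; [exact: (sm0 S)|exact: (@smD _ _ S)|exact: (@smZ _ _ S)].
exists n, g; split=> [k|x /gP[c ->]].
  apply/gP; exists (fun i => (i == k)%:R); rewrite (bigD1 k) //= eqxx mul1r big1 ?addr0 //.
  by move=> i /negbTE ->; rewrite mul0r.
by exists (\row_k c k); rewrite rowmapE; apply: eq_bigr => k _; rewrite mxE.
Qed.

Lemma noeth_row n : noeth 'rV[R]_n.
Proof.
elim: n => [S|n IH].
  exists 0%N, (fun=> 0); split=> [[]//|x _]; exists 0.
  by rewrite linear0; apply/rowP => -[].
have L : linear ((fun v => v 0 0) : 'rV[R]_n.+1 -> R^o) by move=> a x y; rewrite !mxE.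
have := @noeth_ext _ _ (mklin L); apply; last exact: noeth_R.
pose h (v : 'rV[R]_n) : 'rV[R]_n.+1 := \row_j (if unlift ord0 j is Some k then v 0 k else 0).
have hL : linear h.
  by move=> a x y; apply/rowP => j; rewrite !mxE; case: unlift => [k|]; rewrite ?mxE ?mulr0 ?addr0.
have [|g gP] := @incl_factor _ _ (kerS (mklin L)) _ (mklin hL).
  by move=> v; rewrite /= mxE unlift_none.
apply: (noeth_surj (p := g)) IH.
move=> v; exists (\row_k incl _ v 0 (lift ord0 k)).
apply/(injmP _).1; first exact: incl_inj.
rewrite gP /=; apply/rowP => j; rewrite mxE; case: unliftP => [k ->|->]; first by rewrite mxE.
by have /= -> := inclP v.
Qed.

Lemma fin_genP M : fin_gen M <-> exists n (g : 'I_n -> M), forall x, exists v, rowmap g v = x.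
Proof.
split=> [[n [p pS]]|[n [g gS]]]; last by exists n, (rowmap g).
exists n, (fun k => p (delta_mx 0 k)) => x; have [v <-] := pS x.
by exists v; rewrite (row_mapE p).
Qed.

Lemma fin_gen_surj M N (p : {linear M -> N}) : surjm p -> fin_gen M -> fin_gen N.
Proof.
move=> pS [n [q qS]]; exists n, (p \o q : {linear _ -> _}) => y.
by have [x <-] := pS y; have [v <-] := qS x; exists v.
Qed.

Lemma fin_gen_noeth M : fin_gen M -> noeth M.
Proof. move=> [n [p pS]]; apply: (noeth_surj (p := p) pS); exact: noeth_row. Qed.

Lemma fgS_fin_gen M (S : submod M) : fgS S -> fin_gen (subM S).
Proof.
move=> [n [g [gS gG]]]; apply/fin_genP.
exists n, (fun k => exist _ _ (gS k)) => x; have [v vx] := gG _ (svalP x).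
exists v; apply: subP; rewrite -vx -[sval _]/(incl S _) !rowmapE linear_sum.
by apply: eq_bigr => k _; rewrite linearZ.
Qed.

Lemma fin_gen_sub M (S : submod M) : fin_gen M -> fin_gen (subM S).
Proof. by move=> /fin_gen_noeth nM; apply: fgS_fin_gen. Qed.

Lemma fin_gen_row n : fin_gen 'rV[R]_n.
Proof. by exists n, idfun => v; exists v. Qed.

Lemma fin_gen_pair M N : fin_gen M -> fin_gen N -> fin_gen (M * N)%type.
Proof.
move=> [n [p pS]] [m [q qS]].
pose f (v : 'rV[R]_(n + m)) : (M * N)%type := (p (lsubmx v), q (rsubmx v)).
have fL : linear f by move=> a x y; rewrite /f !linearP.
exists (n + m)%N, (mklin fL) => -[x y].
have [v vx] := pS x; have [w wy] := qS y; exists (row_mx v w).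
by rewrite /= /f row_mxKl row_mxKr vx wy.
Qed.

Lemma fin_gen_pres M : fin_gen M -> fin_pres M.
Proof.
move=> [n [p pS]]; have [m [q qS]] := fin_gen_sub (kerS p) (fin_gen_row n).
exists n, m, p, (incl _ \o q : {linear _ -> _}); split=> // v; split=> [pv|[w <-]].
  have [u uv] := incl_lift (S := kerS p) pv; have [w wu] := qS u.
  by exists w; rewrite /= wu.
exact: (inclP (q w)).
Qed.

(** The module of the relations between the rows of A is a submodule of R^n; the
    rows of K generate it. *)
Lemma ker_mx_fg n m (A : 'M[R]_(n, m)) : exists p (K : 'M[R]_(p, n)),
  K *m A = 0 /\ forall v : 'rV_n, v *m A = 0 -> exists w, v = w *m K.
Proof.
have L : linear (fun v : 'rV[R]_n => v *m A) by move=> a x y; rewrite mulmxDl scalemxAl.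
have [p [g [gS gG]]] := noeth_row (kerS (mklin L)).
exists p, (\matrix_i g i); split.
  by apply/row_matrixP => i; rewrite row_mul rowK row0; exact: gS.
move=> v /gG[w <-]; exists w; rewrite mulmx_sum_row rowmapE.
by apply: eq_bigr => k _; rewrite rowK.
Qed.
End Rows.

(** * Injective modules *)

Section Baer.
Variables (R : comPzRingType) (M : lmodType R).
Hypothesis ext : forall (J : submod (R^o : lmodType R)) (h : {linear subM J -> M}),
  exists m : M, forall x, h x = (incl J x : R) *: m.

Section Ext.
Variables (A B : lmodType R) (i : {linear A -> B}) (f : {linear A -> M}).
Hypothesis iI : injective i.

Let good (G : B * M -> Prop) :=
  [/\ forall a, G (i a, f a), forall r x y, G x -> G y -> G (r *: x + y) &
      forall m, G (0, m) -> m = 0].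

(** Partial extensions of f are encoded by their graphs, which avoids
    subtypes in the application of the Zorn lemma. *)
Lemma good_graph : good (fun z => exists a, z = (i a, f a)).
Proof.
split=> [a|r _ _ [a ->] [b ->]|m [a [ia ->]]]; first by exists a.
  by exists (r *: a + b); rewrite !linearP.
by have -> : a = 0; [apply: iI; rewrite linear0|rewrite linear0].
Qed.

(** A maximal partial extension is total: if b is not in its domain, the ideal
    of the r with r b in the domain, and [ext] for that ideal, extend it to b. *)
Lemma baer_partial : exists G, good G /\ forall b, exists m, G (b, m).
Proof.
pose T := {G : B * M -> Prop | good G}.
pose le (s t : T) := `[< forall z, sval s z -> sval t z >].
have [||tot|G Gmax] := @ZL_preorder T (exist _ _ good_graph) le.
- by move=> t; apply/asboolP.
- by move=> r s t /asboolP rs /asboolP st; apply/asboolP => z /rs/st.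
- move=> totA; have [[t0 At0]|nA] := pselect (exists t, tot t); last first.
    by exists (exist _ _ good_graph) => s As; case: nA; exists s.
  have gU : good (fun z => exists2 t, tot t & sval t z).
    split=> [a|r x y [s As sx] [t At ty]|m [t At tm]].
    - by exists t0 => //; case: (svalP t0).
    - have [/asboolP st|/asboolP ts] := totA _ _ As At.
        by exists t => //; case: (svalP t) => _ c _; apply: c => //; exact: st.
      by exists s => //; case: (svalP s) => _ c _; apply: c => //; exact: ts.
    by case: (svalP t) => _ _; exact.
  by exists (exist _ _ gU) => s As; apply/asboolP => z sz; exists s.
exists (sval G); split; first exact: svalP.
move=> b; have [Gg Gl G0] := svalP G.
have Gz : sval G (0, 0) by have := Gg 0; rewrite !linear0.
have Gs r x y : sval G (x, y) -> sval G (r *: x, r *: y).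
  by move=> Gx; have := Gl r _ _ Gx Gz; rewrite addr0.
have Gu x y y' : sval G (x, y) -> sval G (x, y') -> y = y'.
  move=> Gy Gy'; have := Gl (-1) _ _ Gy Gy'; rewrite scaleN1r.
  rewrite -[_ + _]/(- x + x, - y + y') addNr => /G0/eqP.
  by rewrite addrC subr_eq0 => /eqP.
pose JS (r : (R^o : lmodType R)) := exists m, sval G (r *: b, m).
have J0 : JS 0 by exists 0; rewrite scale0r.
have JP (a : R) (x y : (R^o : lmodType R)) : JS x -> JS y -> JS (a *: x + y).
  move=> [m Gm] [n Gn]; exists (a *: m + n).
  by have := Gl a _ _ Gm Gn; rewrite -[_ + _]/(_ + _, _ + _) /= scalerA -scalerDl.
pose J := Submod J0 JP.
have hex (x : subM J) : exists m, sval G ((incl J x : R) *: b, m) := svalP x.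
have [h hP] := choice hex.
have hL : linear h.
  move=> a x y; apply: Gu (hP _) _.
  by have := Gl a _ _ (hP x) (hP y); rewrite -[_ + _]/(_ + _, _ + _) /= scalerA -scalerDl.
have [m0 m0P] := ext (mklin hL).
exists m0; pose G' z := exists r x, sval G x /\ z = x + r *: (b, m0).
have gG' : good G'.
  split=> [a|r _ _ [s [x [Gx ->]]] [t [y [Gy ->]]]|m [r [[x y] [Gx [ex ->]]]]].
  - by exists 0, (i a, f a); split; [exact: Gg|rewrite scale0r addr0].
  - exists (r * s + t), (r *: x + y); split; first exact: Gl.
    by rewrite scalerDr scalerA scalerDl addrACA.
  have Jr : J r.
    exists (- y); have := Gs (-1) _ _ Gx; rewrite !scaleN1r.
    by have -> : - x = r *: b by apply/eqP; rewrite eq_sym -addr_eq0 addrC; exact/eqP.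
  have := m0P (exist _ r Jr); rewrite mklinE inclE /= => hr.
  have : sval G (r *: b, r *: m0) by rewrite -hr; exact: (hP (exist _ r Jr)).
  move=> /(Gl 1 _ _ Gx); rewrite scale1r -[_ + _]/(_ + _, _ + _) /=.
  by rewrite -ex => /G0.
have : le (exist _ _ gG') G.
  by apply: Gmax; apply/asboolP => z Gz'; exists 0, z; rewrite scale0r addr0.
by move=> /asboolP; apply; exists 1, (0, 0); split=> //; rewrite scale1r add0r.
Qed.

Lemma baer_ext : exists g : {linear B -> M}, forall x, g (i x) = f x.
Proof.
have [G [[Gg Gl G0] /choice[g gP]]] := baer_partial.
have Gu x y y' : G (x, y) -> G (x, y') -> y = y'.
  move=> Gy Gy'; have := Gl (-1) _ _ Gy Gy'; rewrite scaleN1r.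
  rewrite -[_ + _]/(- x + x, - y + y') addNr => /G0/eqP.
  by rewrite addrC subr_eq0 => /eqP.
have gL : linear g.
  move=> a x y; apply: Gu (gP _) _.
  by have := Gl a _ _ (gP x) (gP y).
by exists (mklin gL) => x; apply: Gu (gP _) (Gg x).
Qed.
End Ext.

(** The Baer criterion. *)
Lemma baer : injective_module M.
Proof. by move=> A B i f iI; exact: baer_ext. Qed.
End Baer.

Section QZ.
Local Notation "M ^z" := (zmodule M : lmodType int) (at level 2, format "M ^z") : type_scope.

Lemma int_principal (J : submod (int^o : lmodType int)) :
  exists2 g : int, J g & forall x, J x -> exists k, x = k * g.
Proof.
have [[n nP]|nJ] := pselect (exists n : nat, `[< (0 < n)%N /\ J n%:Z >]); last first.
  exists 0; first exact: sm0.
  move=> x Jx; exists 0; rewrite mul0r; apply/eqP; apply: contrapT => x0.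
  case: nJ; exists `|x|%N; apply/asboolP; split; first by rewrite absz_gt0; exact/negP.
  rewrite abszEsign -[_ * _]/(((-1) ^+ (x < 0)%R : int) *: (x : int^o)).
  exact: smZ.
case: (ex_minnP (P := fun n : nat => `[< (0 < n)%N /\ J n%:Z >]) (ex_intro _ n nP)) => g /asboolP[g0 Jg] gmin.
exists g%:Z => // x Jx; exists (x %/ g)%Z.
rewrite {1}(divz_eq x g); apply/eqP; rewrite -subr_eq0 addrC addKr; apply/eqP.
have g0' : g%:Z != 0 by move: g0; case: (g).
have Jr : J (x %% g)%Z.
  rewrite /modz; apply: (@smB _ _ J) => //.
  exact: (@smZ _ _ J (x %/ g)%Z g%:Z).
have r0 := modz_ge0 x g0'.
have rg : (x %% g < g)%Z by apply: ltz_pmod; rewrite ltz_nat.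
move: Jr r0 rg; case: (x %% g)%Z => // r Jr _ rg.
case: r Jr rg => // r Jr rg.
have : (g <= r.+1)%N by apply: gmin; apply/asboolP; split.
by rewrite leqNgt -ltz_nat rg.
Qed.

Definition Zsub : submod (rat^z).
Proof.
exists (fun q : rat => exists k : int, q = k%:~R); first by exists 0.
by move=> a _ _ [k ->] [l ->]; exists (k * a + l); rewrite intrD intrM mulrzr.
Defined.
Definition QZ : lmodType int := quotM Zsub.
Definition qz (q : rat) : QZ := qpi Zsub (q : rat^z).
Lemma qz0 q : qz q = 0 <-> exists k : int, q = k%:~R.
Proof. exact: qpi_ker. Qed.
Lemma qzZ (a : int) q : a *: qz q = qz (a%:~R * q).
Proof. by rewrite /qz -linearZ; congr (qpi _ _); rewrite mulrzl. Qed.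
Lemma qz_surj x : exists q, qz q = x.
Proof. exact: (qpi_surj x). Qed.

(** Q/Z is divisible, and the ideals of the integers are principal. *)
Lemma QZ_injective : injective_module QZ.
Proof.
apply: baer => J h; have [g Jg gP] := int_principal J.
have [q hq] := qz_surj (h (exist _ g Jg)).
have H (k : int) (Jk : J (k * g)) : h (exist _ (k * g) Jk) = k *: qz q.
  rewrite hq -linearZ; congr (h _); exact: subP.
have [g0|g0] := eqVneq g 0.
  exists 0 => -[x Jx]; have [k e] := gP x Jx; rewrite scaler0.
  rewrite -(linear0 h); congr (h _); apply: subP => /=.
  by rewrite e g0 mulr0.
exists (qz (q / g%:~R)) => -[x Jx]; rewrite inclE /=; have [k e] := gP x Jx.
move: Jx; rewrite e => Jx; rewrite H !qzZ; congr qz.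
by rewrite intrM -mulrA [g%:~R * _]mulrC divfK ?intr_eq0.
Qed.

Section Cogen.
Variable R : comPzRingType.
(** The injective cogenerator Hom_Z (R, Q/Z) of R. *)
Definition cogen : Type := hom (R^z) QZ.
HB.instance Definition _ := GRing.Zmodule.on cogen.
Implicit Types f g : cogen.
Fact cog_scaleL (a : R) (f : cogen) :
  linear ((fun r : R => f (r * a)) : R^z -> QZ).
Proof.
move=> k x y; rewrite -(linearP f); congr (f _).
by rewrite mulrDl scalezrE mulrzAl.
Qed.
Definition cog_scale (a : R) (f : cogen) : cogen := mklin (cog_scaleL a f).
Fact cog_scaleA a b f : cog_scale a (cog_scale b f) = cog_scale (a * b) f.
Proof. by apply: homP => r /=; rewrite mulrA. Qed.
Fact cog_scale1 : left_id 1 cog_scale.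
Proof. by move=> f; apply: homP => r /=; rewrite mulr1. Qed.
Fact cog_scaleDr : right_distributive cog_scale +%R.
Proof. by move=> a f g; apply: homP. Qed.
Fact cog_scaleDl f : {morph cog_scale^~ f : a b / a + b}.
Proof. by move=> a b; apply: homP => r /=; rewrite mulrDr linearD. Qed.
HB.instance Definition _ := GRing.Zmodule_isLmodule.Build R cogen
  cog_scaleA cog_scale1 cog_scaleDr cog_scaleDl.

Fact zlinL (M N : lmodType R) (f : {linear M -> N}) : linear (f : M^z -> N^z).
Proof. by move=> k x y; rewrite linearD !scalezrE raddfMz. Qed.

(** By adjunction, R-linear maps to [cogen] are additive maps to Q/Z. *)
Lemma cogen_injective : injective_module (cogen : lmodType R).
Proof.
move=> A B i f iI.
have fL : linear ((fun a => (f a : hom _ _) (1 : R)) : A^z -> QZ).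
  move=> k x y; rewrite linearD scalezrE raddfMz.
  rewrite -[((f x *~ k) + _ : hom _ _) _]/(_ + _); congr (_ + _).
  by rewrite -[k in RHS]intz scaler_int; exact: (raddfMz (@ev int (R^z) QZ (1 : R)) k (f x)).
have [g gP] := QZ_injective (i := mklin (zlinL i)) (mklin fL) iI.
have gL b : linear ((fun r : R => g (r *: b)) : R^z -> QZ).
  move=> k x y; rewrite -(linearP g); congr (g _).
  by rewrite scalerDl !scalezrE scalerMzl.
have hL : linear ((fun b => mklin (gL b)) : B -> cogen).
  move=> a x y; apply: homP => r.
  by rewrite -[RHS]/(g (r * a *: x) + g (r *: y)) /= scalerDr scalerA linearD.
exists (mklin hL) => a; apply: homP => r.
rewrite /= -linearZ gP /= linearZ -[LHS]/((f a : hom _ _) (1 * r)).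
by rewrite mul1r.
Qed.

(** It suffices to find an additive map to Q/Z that does not kill x. The one
    defined on the multiples of x, with value at x a nonzero element of Q/Z
    killed by the annihilator of x, extends because Q/Z is injective. *)
Lemma cogen_sep (M : lmodType R) (x : M) : x != 0 ->
  exists f : {linear M -> (cogen : lmodType R)}, f x <> 0.
Proof.
move=> x0.
have pL : linear ((fun k : int => x *~ k) : (int^o : lmodType int) -> M^z).
  by move=> a k l; rewrite -scalezrE scalerDl -scalerA.
(* the annihilator of x in the integers is generated by g: take q = 1 / g, or
   q = 1 / 2 if g = 0 *)
have [q qP] : exists q : rat, (forall k : int, x *~ k = 0 -> qz (k%:~R * q) = 0) /\ qz q <> 0.
  have [g Jg gP] := int_principal (kerS (mklin pL)).
  have [g0|g0] := eqVneq g 0.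
    exists (1 / 2%:R); split=> [k /gP[l ->]|/qz0[k]].
      by rewrite g0 mulr0 mul0r; apply/qz0; exists 0.
    move=> e; have {}e : 1 = k * 2.
      by apply: (@intr_inj rat); rewrite intrM -e divfK.
    by have := congr1 (fun n => (n %% 2)%Z) e; rewrite modzMl.
  exists (g%:~R^-1); split=> [k /gP[l ->]|/qz0[k]].
    by apply/qz0; exists l; rewrite intrM mulfK ?intr_eq0.
  move=> e; have {}e : 1 = k * g.
    by apply: (@intr_inj rat); rewrite intrM -e mulVf ?intr_eq0.
  have gu : g \is a GRing.unit by apply/unitrPr; exists k; rewrite mulrC -e.
  move: Jg => /=; have [->|->] : g = 1 \/ g = -1.
  - by move: gu; rewrite -[_ \is a _]/((g == 1) || (g == -1)) => /orP[]/eqP; [left|right].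
  - by rewrite mulr1z => x0'; rewrite x0' eqxx in x0.
  - by rewrite mulrN1z => /eqP; rewrite oppr_eq0 (negbTE x0).
have qL : linear ((fun k : int => qz (k%:~R * q)) : (int^o : lmodType int) -> QZ).
  move=> a k l; rewrite !qzZ /qz -linearD; congr (qpi _ _).
  by rewrite intrD intrM mulrDl mulrA.
have [|g gP] := inj_ext (p := mklin pL) (f := mklin qL) QZ_injective.
  exact: qP.1.
have fL m : linear ((fun r : R => g (r *: m)) : R^z -> QZ).
  move=> k a b; rewrite -(linearP g); congr (g _).
  by rewrite scalerDl !scalezrE scalerMzl.
have hL : linear ((fun b => mklin (fL b)) : M -> cogen).
  move=> a m m'; apply: homP => r.
  by rewrite -[RHS]/(g (r * a *: m) + g (r *: m')) /= scalerDr scalerA linearD.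
exists (mklin hL) => e; apply: qP.2.
have := gP (1 : int); rewrite /= mulr1z mul1r => <-.
have := congr1 (fun h : hom (R^z) QZ => h (1 : R)) e.
by rewrite /= scale1r.
Qed.
End Cogen.
End QZ.

(** Every submodule is the intersection of the kernels of the maps to E that
    vanish on it. In this form, injectivity of E reduces exactness of a complex
    to statements on maps to E. *)
Lemma cogenerator (R : comPzRingType) : exists E : lmodType R,
  injective_module E /\
  forall (M : lmodType R) (S : submod M) x, ~ S x ->
    exists f : {linear M -> E}, (forall y, S y -> f y = 0) /\ f x <> 0.
Proof.
exists (cogen R); split; first exact: cogen_injective.
move=> M S x Sx.
have [|f fx] := @cogen_sep R (quotM S) (qpi S x).
  by apply/eqP => /qpi_ker.
exists (hom_comp f (qpi S)); split=> // y Sy.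
by rewrite hcompE ((qpi_ker S y).2 Sy) linear0.
Qed.

(** * Tensor products and flat modules *)

Section Tensor.
Variables (R : comPzRingType) (W M : lmodType R).

(** The tensor product is realized as the submodule spanned by the evaluations
    f |-> f x y in the dual, with respect to E, of the module of bilinear maps
    to E; the cogenerator E detects all relations. *)
Lemma tensor_ex : exists (T : lmodType R) (b : W -> M -> T), is_tensor b.
Proof.
have [E [EI Esep]] := cogenerator R.
have evb x y : linear (fun f : hom W (hom M E) => (f x : hom M E) y) by [].
have [p pP] := free_univ (fun z : W * M => mklin (evb z.1 z.2) : hom (hom W (hom M E)) E).
have [q qP] := incl_factor (S := imS p) (f := p) (fun x => ex_intro _ x erefl).
have qS : surjm q.
  move=> y; have [x xy] := inclP y; exists x.
  by apply/(injmP _).1; [exact: incl_inj|rewrite qP].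
pose b (x : W) (y : M) : imM p := q (fbase R (x, y)).
have bE x y (f : hom W (hom M E)) : incl _ (b x y) f = (f x : hom M E) y by rewrite qP pP.
have bB : is_bilinear b.
  split=> [x a y y'|y a x x']; apply/(injmP _).1; try exact: incl_inj.
    by apply: homP => f; rewrite linearP homDE homZE !bE linearP.
  by apply: homP => f; rewrite linearP homDE homZE !bE linearP.
exists (imM p), b; split=> // P c [cl cr].
have [f fP] := free_univ (fun z : W * M => c z.1 z.2).
have [C CP] := mkbil cl cr.
have [|u uP] := factor_surj (p := q) (f := f) qS.
  move=> z qz0; apply: contrapT => fz.
  have S0 (a : R) (x y : P) : x = 0 -> y = 0 -> a *: x + y = 0.
    by move=> -> ->; rewrite scaler0 addr0.
  have [g [_ gf]] := Esep P (Submod erefl S0) (f z) fz.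
  apply: gf; pose psi : hom W (hom M E) := hom_comp (postcomp M g) C.
  have H : forall z, hom_comp g f z = hom_comp (ev E psi) p z.
    by apply: free_ext => -[x y]; rewrite !hcompE fP pP /= CP.
  have := H z; rewrite !hcompE => ->.
  by rewrite -qP qz0 linear0.
exists u; split=> [x y|v vP]; first by rewrite uP fP.
apply: homP => t; have [z <-] := qS t.
have H : forall z, hom_comp u q z = hom_comp v q z.
  by apply: free_ext => -[x y]; rewrite !hcompE -/(b x y) vP uP fP.
by have := H z; rewrite !hcompE.
Qed.
End Tensor.

Section Flat.
Variable R : comPzRingType.
Implicit Types (M N A B C E F : lmodType R).

(** The character module criterion of flatness, for all injective modules at
    once. *)
Definition flatI F := forall E, injective_module E -> injective_module (hom F E).

Lemma tensor_ext F A (T P : lmodType R) (b : F -> A -> T) (u v : {linear T -> P}) :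
  is_tensor b -> (forall x y, u (b x y) = v (b x y)) -> forall t, u t = v t.
Proof.
move=> [[bl br] bu] uv.
have cB : is_bilinear (fun x y => u (b x y)).
  by split=> [x a y y'|y a x x']; rewrite ?bl ?br linearP.
have [w [_ wP]] := bu _ _ cB.
by move=> t; rewrite -(wP u (fun x y => erefl)) -(wP v (fun x y => esym (uv x y))).
Qed.

(** Maps A -> Hom (F, E) are maps F (x) A -> E, and flatness makes F (x) A a
    submodule of F (x) B. *)
Lemma flat_flatI F : flat F -> flatI F.
Proof.
move=> Ff E EI A B i h iI.
have [TA [bA tA]] := tensor_ex F A; have [TB [bB tB]] := tensor_ex F B.
have [[blB brB] _] := tB.
have [|u [uP _]] := tA.2 TB (fun x y => bB x (i y)).
  by split=> [x a y y'|y]; [rewrite linearP blB|exact: brB].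
have [|phi [phiP _]] := tA.2 E (fun x y => h y x).
  by split=> [x a y y'|y]; [rewrite linearP|move=> a x x'; rewrite linearP].
have uI := Ff _ _ _ iI _ _ _ _ tA tB u uP.
have [psi psiP] := EI _ _ u phi uI.
have [||g gP] := @mkbil R B F E (fun b x => psi (bB x b)).
- by move=> b a x x'; rewrite (brB b) linearP.
- by move=> x a b b'; rewrite (blB x) linearP.
by exists g => a; apply: homP => x; rewrite gP -uP psiP phiP.
Qed.

(** An element of the kernel of F (x) A -> F (x) B that is not zero is detected
    by a map to the cogenerator, and that map extends to F (x) B. *)
Lemma flatI_flat F : flatI F -> flat F.
Proof.
move=> Ff A B i iI TA TB bA bB tA tB u uP.
have [E [EI Esep]] := cogenerator R.
apply/injmP => t ut; apply: contrapT => t0.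
have S0 (a : R) (x y : TA) : x = 0 -> y = 0 -> a *: x + y = 0.
  by move=> -> ->; rewrite scaler0 addr0.
have [f [_ ft]] := Esep TA (Submod erefl S0) t t0.
have [[bl br] _] := tA; have [[bl' br'] bu'] := tB.
have [||h hP] := @mkbil R A F E (fun a x => f (bA x a)).
- by move=> b a x x'; rewrite (br b) linearP.
- by move=> x a b b'; rewrite (bl x) linearP.
have [g gP] := Ff E EI _ _ i h iI.
have [|psi [psiP _]] := bu' E (fun x y => g y x).
  by split=> [x a y y'|y a x x']; rewrite linearP.
apply: ft; have -> : f t = hom_comp psi u t; last by rewrite hcompE ut linear0.
apply: (tensor_ext tA) => x y; rewrite hcompE uP psiP gP hP //.
Qed.

Lemma projective_flatI F : projective F -> flatI F.
Proof.
move=> Fp E EI A B i h iI.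
have [h' h'P] := swapex h.
have pS : surjm (precomp E i).
  move=> f; have [g gP] := EI _ _ i f iI; exists g.
  by apply: homP => a; rewrite /= gP.
have [g gP] := Fp _ _ (precomp E i) h' pS.
have [g' g'P] := swapex g.
by exists g' => a; apply: homP => x; rewrite g'P -h'P -gP.
Qed.

Definition vec F n : lmodType R := prodM (fun _ : 'I_n => F).
Definition single F n (i : 'I_n) (y : F) : vec F n := fun j => (j == i)%:R *: y.
Lemma vec_sum F n (x : vec F n) : x = \sum_i single i (x i).
Proof.
apply: prodP => j; rewrite prod_sumE (bigD1 j) //= /single eqxx scale1r.
by rewrite big1 ?addr0 // => i /negbTE ij; rewrite eq_sym ij scale0r.
Qed.
Fact singleL F n (i : 'I_n) : linear (@single F n i).
Proof. by move=> a x y; apply: prodP => j; rewrite /single prodDE prodZE linearP. Qed.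
Definition singleM F n i : {linear F -> vec F n} := mklin (@singleL F n i).
Lemma vec_mapE F n N (f : {linear vec F n -> N}) x :
  f x = \sum_i f (singleM F i (x i)).
Proof. by rewrite {1}(vec_sum x) linear_sum. Qed.
Fact mxactL F n p (K : 'M[R]_(p, n)) :
  linear ((fun y i => \sum_l K l i *: y l) : vec F p -> vec F n).
Proof.
move=> a x y; apply: prodP => i; rewrite prodDE prodZE scaler_sumr -big_split.
apply: eq_bigr => l _.
by rewrite prodDE prodZE scalerDr !scalerA [_ * a]mulrC.
Qed.
Definition mxact F n p (K : 'M[R]_(p, n)) : {linear vec F p -> vec F n} :=
  mklin (@mxactL F n p K).
Lemma mxactE F n p (K : 'M[R]_(p, n)) (y : vec F p) i :
  mxact F K y i = \sum_l K l i *: y l.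
Proof. by []. Qed.
Lemma mxact_mul F n p q (K : 'M[R]_(p, n)) (L : 'M[R]_(q, p)) (y : vec F q) :
  mxact F K (mxact F L y) = mxact F (L *m K) y.
Proof.
apply: prodP => i; rewrite !mxactE.
under eq_bigr => l _ do rewrite mxactE scaler_sumr.
rewrite exchange_big; apply: eq_bigr => k _; rewrite mxE scaler_suml.
by apply: eq_bigr => l _; rewrite scalerA mulrC.
Qed.

(** The equational criterion of flatness: relations in F are consequences of
    relations in R. *)
Definition eqflat F := forall n m (A : 'M[R]_(n, m)) (x : vec F n),
  mxact F A x = 0 ->
  exists p (K : 'M[R]_(p, n)) (y : vec F p), K *m A = 0 /\ x = mxact F K y.

Hypothesis noethR : noetherian R.

(** If x were not of the required form, a map to the cogenerator would separate
    it from the tuples that are; by injectivity of Hom (F, E) that map factors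
    through the matrix A, which kills x. *)
Lemma flatI_eqflat F : flatI F -> eqflat F.
Proof.
move=> Ff n m A x Ax0; have [p [K [KA Kgen]]] := ker_mx_fg noethR A.
have [E [EI Esep]] := cogenerator R.
suff [y xy] : imS (mxact F K) x by exists p, K, y.
apply: contrapT => /(Esep _)[f [fS]]; apply.
pose phi i : hom F E := hom_comp f (singleM F i).
have mulL : linear (fun v : 'rV[R]_n => v *m A).
  by move=> a u v; rewrite mulmxDl scalemxAl.
have [|g gP] := inj_ext (p := mklin mulL) (f := rowmap phi) (Ff E EI).
  move=> v /Kgen[w ->]; apply: homP => y.
  rewrite rowmapE hom_sumE hom0E.
  have -> : \sum_k ((w *m K) 0 k *: phi k) y = f (mxact F K (fun l => w 0 l *: y)).
    rewrite [RHS]vec_mapE; apply: eq_bigr => k _.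
    rewrite homZE /phi hcompE -linearZ mxE mxactE -linearZ; congr (f (singleM F k _)).
    by rewrite scaler_suml; apply: eq_bigr => l _; rewrite scalerA mulrC.
  by apply: fS; exists (fun l => w 0 l *: y).
have phiE i y : phi i y = \sum_j A i j *: g (delta_mx 0 j) y.
  have -> : phi i = rowmap phi (delta_mx 0 i) by rewrite rowmap_delta.
  rewrite -gP mklinE -rowE (row_mapE g) hom_sumE.
  by apply: eq_bigr => j _; rewrite homZE mxE.
rewrite vec_mapE (eq_bigr (fun i => \sum_j A i j *: g (delta_mx 0 j) (x i))); last first.
  by move=> i _; rewrite -phiE.
rewrite exchange_big big1 // => j _.
under eq_bigr => i _ do rewrite -linearZ.
rewrite -linear_sum; have := congr1 (fun z : vec F m => z j) Ax0.
by rewrite mxactE prod0E => ->; rewrite linear0.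
Qed.

(** By the Baer criterion only ideals matter, and they are finitely generated:
    the equational criterion, for a column of generators, says that the
    extension exists. *)
Lemma eqflat_flatI F : eqflat F -> flatI F.
Proof.
move=> Ff E EI; apply: baer => J h.
have [n [a [aJ aG]]] := noeth_R noethR J.
pose hh i : hom F E := h (exist _ (a i) (aJ i)).
pose A : 'M[R]_(n, 1) := \matrix_(i, j) a i.
have fL : linear ((fun x => \sum_i hh i (x i)) : vec F n -> E).
  move=> c x y; rewrite scaler_sumr -big_split; apply: eq_bigr => i _ /=.
  by rewrite prodDE prodZE linearP.
have [|g gP] := inj_ext (p := mxact F A) (f := mklin fL) EI.
  move=> x /Ff[p [K [y [KA ->]]]]; rewrite mklinE.
  under eq_bigr => i _ do rewrite mxactE linear_sum.
  rewrite exchange_big big1 // => l _ /=.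
  transitivity ((\sum_i K l i *: hh i : hom F E) (y l)).
    by rewrite hom_sumE; apply: eq_bigr => i _; rewrite linearZ.
  have -> : \sum_i K l i *: hh i = h (\sum_i K l i *: (exist _ (a i) (aJ i) : subM J)).
    by rewrite linear_sum; apply: eq_bigr => i _; rewrite linearZ.
  rewrite [X in h X](_ : _ = 0) ?linear0 //.
  apply: incl_inj; rewrite linear_sum.
  have := congr1 (fun B : 'M_(_, _) => B l 0) KA; rewrite !mxE => e.
  rewrite -[RHS]e; apply: eq_bigr => i _.
  by rewrite mxE linearZ.
pose g1 : hom F E := hom_comp g (singleM F 0).
exists g1 => -[x Jx]; rewrite inclE /=; have [v vx] := aG x Jx.
have -> : exist _ x Jx = \sum_i v 0 i *: (exist _ (a i) (aJ i) : subM J).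
  apply/(injmP (incl J)).1; first exact: incl_inj.
  by rewrite linear_sum -[LHS]/x -vx rowmapE; apply: eq_bigr => i _; rewrite linearZ.
apply: homP => y; rewrite linear_sum hom_sumE homZE -linearZ /g1 hcompE.
have -> : singleM F 0 (x *: y) = mxact F A (fun i => v 0 i *: y).
  apply: prodP => j; rewrite mxactE [j]ord1 -[LHS]/((0 == 0)%:R *: _) eqxx scale1r.
  rewrite -vx rowmapE scaler_suml; apply: eq_bigr => i _.
  by rewrite mxE scalerA mulrC.
by rewrite gP mklinE; apply: eq_bigr => i _; rewrite linearZ [RHS]linearZ.
Qed.

(** The matrix K of the equational criterion can be prescribed. For noetherian R
    it can then be chosen independently of x, and of F, which gives flatness of
    products. *)
Lemma eqflat_ker F n m (A : 'M[R]_(n, m)) p (K : 'M[R]_(p, n)) :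
  (forall v : 'rV_n, v *m A = 0 -> exists w, v = w *m K) -> eqflat F ->
  forall x : vec F n, mxact F A x = 0 -> exists y, x = mxact F K y.
Proof.
move=> Kgen Ff x /Ff[q [L [y [LA ->]]]].
have /choice[w wP] i : exists w, row i L = w *m K.
  by apply: Kgen; rewrite -row_mul LA row0.
exists (mxact F (\matrix_i w i) y); rewrite mxact_mul; congr (mxact F _ y).
by apply/row_matrixP => i; rewrite row_mul rowK.
Qed.

Lemma eqflat_prod (I : Type) (F : I -> lmodType R) :
  (forall i, eqflat (F i)) -> eqflat (prodM F).
Proof.
move=> Ff n m A x Ax; have [p [K [KA Kgen]]] := ker_mx_fg noethR A.
have H i : exists y : vec (F i) p, (fun k => x k i) = mxact (F i) K y.
  apply: (eqflat_ker Kgen (Ff i)); apply: prodP => j.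
  have e : mxact _ A x j i = 0 by rewrite Ax.
  by rewrite mxactE -[RHS]e mxactE prod_sumE.
have [y yP] : exists y : forall i, vec (F i) p, forall i, (fun k => x k i) = mxact (F i) K (y i).
  by exists (fun i => sval (cid (H i))) => i; exact: svalP (cid (H i)).
exists p, K, (fun l i => y i l); split=> //; apply: prodP => k; apply: prodP => i.
rewrite mxactE prod_sumE; have -> : x k i = mxact (F i) K (y i) k by rewrite -yP.
by [].
Qed.

(** Hom (Free X, R) is a product of copies of R. *)
Lemma eqflat_dual_free (X : choiceType) : eqflat (hom (Free R X) R^o).
Proof.
move=> n m A x Ax; have [p [K [KA Kgen]]] := ker_mx_fg noethR A.
have /choice[w wP] t : exists w, \row_k (x k (fbase R t) : R) = w *m K.
  apply: Kgen; apply/rowP => j; rewrite mxE mxE.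
  have e : mxact _ A x j (fbase R t) = 0 by rewrite Ax.
  rewrite -[RHS]e mxactE hom_sumE.
  by apply: eq_bigr => i _; rewrite mxE mulrC.
have yex l : exists y : {linear Free R X -> (R^o : lmodType R)}, forall t, y (fbase R t) = w t 0 l.
  exact: (free_univ (fun t => w t 0 l : (R^o : lmodType R))).
exists p, K, (fun l => sval (cid (yex l))); split=> //.
apply: prodP => k; apply: homP; apply: free_ext => t.
rewrite mxactE hom_sumE.
have := congr1 (fun v : 'rV[R]_n => v 0 k) (wP t); rewrite !mxE => ->.
by apply: eq_bigr => l _; rewrite homZE (svalP (cid (yex l))) mulrC.
Qed.

(** For the exact sequence R^p -> R^n -> R^m given by K and A, the functors
    Hom (-, V) and Hom (-, I) are exact; a relation x between maps V -> I
    therefore factors as required. *)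
Lemma eqflat_hom_inj V I : injective_module V -> injective_module I -> eqflat (hom V I).
Proof.
move=> VI II n m A x Ax; have [p [K [KA Kgen]]] := ker_mx_fg noethR A.
pose xx : hom (vec V n) I := \sum_i hom_comp (x i) (prod_proj _ i).
have xxE v : xx v = \sum_i x i (v i) by rewrite hom_sumE.
have KerIm (v : vec V n) : mxact V K^T v = 0 -> exists u, mxact V A^T u = v.
  (* injectivity of V applied to the exact sequence R^p -> R^n -> R^m *)
  move=> Kv; have mulL : linear (fun u : 'rV[R]_n => u *m A).
    by move=> a u u'; rewrite mulmxDl scalemxAl.
  have [|g gP] := inj_ext (p := mklin mulL) (f := rowmap v) VI.
    move=> u /Kgen[w ->]; rewrite rowmapE.
    transitivity (\sum_l w 0 l *: mxact V K^T v l).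
      under [RHS]eq_bigr => l _ do rewrite mxactE scaler_sumr.
      rewrite exchange_big; apply: eq_bigr => k _; rewrite mxE scaler_suml.
      by apply: eq_bigr => l _; rewrite mxE scalerA.
    by rewrite Kv big1 // => l _; rewrite prod0E scaler0.
  exists (fun j => g (delta_mx 0 j)); apply: prodP => i; rewrite mxactE.
  have := gP (delta_mx 0 i); rewrite rowmap_delta mklinE -rowE (row_mapE g) => <-.
  by apply: eq_bigr => j _; rewrite !mxE.
have [|y yP] := inj_ext (p := mxact V K^T) (f := xx) II.
  move=> v /KerIm[u <-]; rewrite xxE.
  under eq_bigr => i _ do rewrite mxactE linear_sum.
  rewrite exchange_big big1 // => j _ /=.
  have e : mxact _ A x j (u j) = 0 by rewrite Ax.
  by rewrite -[RHS]e mxactE hom_sumE; apply: eq_bigr => i _; rewrite linearZ mxE.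
exists p, K, (fun l => hom_comp y (singleM V l)); split=> //.
apply: prodP => i; apply: homP => v.
have -> : x i v = y (mxact V K^T (singleM V i v)).
  rewrite yP xxE (bigD1 i) // big1; last first.
    by move=> j /negbTE ji; rewrite -[singleM V i v j]/((j == i)%:R *: v) ji scale0r linear0.
  by rewrite -[singleM V i v i]/((i == i)%:R *: v) eqxx scale1r [RHS]addr0.
rewrite vec_mapE mxactE hom_sumE; apply: eq_bigr => l _.
rewrite homZE hcompE -linearZ -linearZ; congr (y (singleM V l _)).
rewrite mxactE (bigD1 i) // big1 => [|j /negbTE ji].
  by rewrite -[singleM V i v i]/((i == i)%:R *: v) eqxx scale1r mxE [LHS]addr0.
by rewrite -[singleM V i v j]/((j == i)%:R *: v) ji scale0r scaler0.
Qed.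
End Flat.

(** * Complexes and tensor exactness *)

Section IntSeq.
Variables (S : Type) (s0 : S) (next prev : S -> S).
Definition zseq (i : int) : S :=
  match i with Posz n => iter n next s0 | Negz n => iter n.+1 prev s0 end.
Lemma zseqP (P : int -> S -> S -> Prop) :
  (forall n : nat, P n%:Z (iter n next s0) (iter n.+1 next s0)) ->
  (forall n : nat, P (Negz n) (iter n.+1 prev s0) (iter n prev s0)) ->
  forall i, P i (zseq i) (zseq (i + 1)).
Proof.
move=> Pn Pp [n|[|n]].
- by have -> : Posz n + 1 = Posz n.+1 by rewrite -addn1.
- exact: (Pp 0%N).
have -> : Negz n.+1 + 1 = Negz n by rewrite !NegzE -[n.+2]addn1 PoszD opprD addrNK.
exact: (Pp n.+1).
Qed.
End IntSeq.

Section IntRec.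
Variables (P : int -> Type) (nx : int -> int) (k : int) (rk : int -> nat).
Hypothesis rkP : forall n, rk (iter n nx k) = n.
Variables (dflt : forall i, P i) (Inv : forall i, P i -> Prop).
Variables (Rel : forall i, P i -> P (nx i) -> Prop) (p0 : P k).
Arguments Inv : clear implicits.
Arguments Rel : clear implicits.
Hypothesis inv0 : Inv k p0.
Hypothesis step : forall i p, Inv i p -> exists p', Rel i p p' /\ Inv (nx i) p'.

(** Dependent recursion along the iterates of nx. The values have types P i that
    depend on the integer i, and rk recovers the number of iterations from i;
    it serves to go up and to go down. *)
Lemma int_rec_dep : exists h : forall i, P i, h k = p0 /\
  forall n, Inv (iter n nx k) (h (iter n nx k)) /\
            Rel (iter n nx k) (h (iter n nx k)) (h (nx (iter n nx k))).
Proof.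
have fex (t : {i : int & P i}) : exists p' : P (nx (projT1 t)),
    Inv _ (projT2 t) -> Rel _ (projT2 t) p' /\ Inv _ p'.
  have [/step[p' p'P]|ni] := pselect (Inv _ (projT2 t)); first by exists p'.
  by exists (dflt _).
pose f t := sval (cid (fex t)).
have fP t : Inv _ (projT2 t) -> Rel _ (projT2 t) (f t) /\ Inv _ (f t) := svalP (cid (fex t)).
pose next (t : {i : int & P i}) : {i : int & P i} := existT P _ (f t).
pose z n := iter n next (existT P k p0).
have zi n : projT1 (z n) = iter n nx k by elim: n => //= n <-.
pose h i : P i := if pselect (exists p, z (rk i) = existT P i p) is left e
  then sval (cid e) else dflt i.
have hP n : z n = existT P (iter n nx k) (h (iter n nx k)).
  rewrite /h rkP; case: pselect => [e|ne]; first exact: svalP (cid e).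
  case: ne; rewrite -zi; exists (projT2 (z n)).
  by case: (z n).
have zinv n : Inv _ (projT2 (z n)).
  by elim: n => [//|n IH]; exact: (fP _ IH).2.
exists h; split; first by apply: (@existT_inj2 _ P); rewrite -(hP 0%N).
move=> n; have e0 : next (z n) = existT P _ (h (nx (iter n nx k))) := hP n.+1.
move: (fP _ (zinv n)) (zinv n) e0; rewrite (hP n) /= => -[H1 H2] I e.
have e2 := @existT_inj2 _ P _ _ _ e.
by split=> //; rewrite -e2; exact: H1.
Qed.
End IntRec.

Lemma int_rec_up (P : int -> Type) (k : int) (dflt : forall i, P i)
    (Inv : forall i, P i -> Prop) (Rel : forall i, P i -> P (i + 1) -> Prop) (p0 : P k) :
  Inv k p0 ->
  (forall i p, k <= i -> Inv i p -> exists p', Rel i p p' /\ Inv (i + 1) p') ->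
  exists h : forall i, P i, h k = p0 /\
    forall i, k <= i -> Inv i (h i) /\ Rel i (h i) (h (i + 1)).
Proof.
move=> I0 st; pose nx (i : int) := i + 1.
have itE m : iter m nx k = k + m%:Z by elim: m => [|m /= ->]; rewrite ?/nx /=; lia.
pose rk (i : int) := `|(i - k)%R|%N.
have rkP m : rk (iter m nx k) = m by rewrite itE /rk; lia.
have [||h [h0 hP]] := @int_rec_dep P nx k rk rkP dflt (fun i p => k <= i /\ Inv i p) Rel p0.
- by [].
- move=> i p [ki /(st _ _ ki)[p' [r J]]]; exists p'; split=> //; split=> //.
  by rewrite /nx; lia.
exists h; split=> // i ki; have e : i = iter `|(i - k)%R|%N nx k by rewrite itE; lia.
by have := hP `|(i - k)%R|%N; rewrite -e => -[[_ ? ?]].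
Qed.

Lemma int_rec_down (P : int -> Type) (k : int) (dflt : forall i, P i)
    (Inv : forall i, P i -> Prop) (Rel : forall i, P i -> P (i - 1) -> Prop) (p0 : P k) :
  Inv k p0 ->
  (forall i p, i <= k -> Inv i p -> exists p', Rel i p p' /\ Inv (i - 1) p') ->
  exists h : forall i, P i, h k = p0 /\
    forall i, i <= k -> Inv i (h i) /\ Rel i (h i) (h (i - 1)).
Proof.
move=> I0 st; pose nx (i : int) := i - 1.
have itE m : iter m nx k = k - m%:Z by elim: m => [|m /= ->]; rewrite ?/nx /=; lia.
pose rk (i : int) := `|(k - i)%R|%N.
have rkP m : rk (iter m nx k) = m by rewrite itE /rk; lia.
have [||h [h0 hP]] := @int_rec_dep P nx k rk rkP dflt (fun i p => i <= k /\ Inv i p) Rel p0.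
- by [].
- move=> i p [ki /(st _ _ ki)[p' [r J]]]; exists p'; split=> //; split=> //.
  by rewrite /nx; lia.
exists h; split=> // i ki; have e : i = iter `|(k - i)%R|%N nx k by rewrite itE; lia.
by have := hP `|(k - i)%R|%N; rewrite -e => -[[_ ? ?]].
Qed.

Section MkComplex.
Variables (R : comPzRingType) (A : int -> lmodType R).
Variable delta : forall i, {linear A i -> A (i + 1)}.
Hypothesis delta2 : forall i x, delta (i + 1) (delta i x) = 0.

(** The differential is given only from i to i + 1; the other components vanish. *)
Definition mkd i j : hom (A i) (A j) :=
  if pselect (i + 1 = j) is left e then ecast k (hom (A i) (A k)) e (delta i) else 0.
Lemma mkd_next i : mkd i (i + 1) = delta i.
Proof. by rewrite /mkd; case: pselect => // e; rewrite (Prop_irrelevance e erefl). Qed.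
Lemma mkd_shape i j : j != i + 1 -> forall x, mkd i j x = 0.
Proof. by rewrite /mkd; case: pselect => // e; rewrite -{1}e eqxx. Qed.
Lemma mkd_comp i j k x : mkd j k (mkd i j x) = 0.
Proof.
have [ij|ij] := eqVneq j (i + 1); last by rewrite (mkd_shape ij) linear0.
have [jk|jk] := eqVneq k (j + 1); last by rewrite (mkd_shape jk).
by subst j k; rewrite !mkd_next delta2.
Qed.
Definition mkc : complex R := @Complex R A mkd mkd_shape mkd_comp.
Lemma mkcE i : d mkc i (i + 1) = delta i. Proof. exact: mkd_next. Qed.
End MkComplex.

Section Exact.
Variable R : comPzRingType.
Implicit Types (M N P B C E F W : lmodType R) (A : mod_class R) (X Y T : complex R).

Lemma exactP X : exact X <-> forall i j k, j = i + 1 -> k = j + 1 ->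
  forall x : X j, d X j k x = 0 -> exists y : X i, d X i j y = x.
Proof.
split=> [eX i j k -> -> x /eX|eX i x /(eX (i - 1) i _ _ erefl)]; first by rewrite addrK.
by rewrite subrK; apply.
Qed.

Lemma hom_exactP N X : hom_exact N X <-> forall i j k, j = i + 1 -> k = j + 1 ->
  forall f : {linear N -> X j}, (forall x, d X j k (f x) = 0) ->
  exists g : {linear N -> X i}, forall x, d X i j (g x) = f x.
Proof.
split=> [eX i j k -> -> f /eX|eX i f /(eX (i - 1) i _ _ erefl)]; first by rewrite addrK.
by rewrite subrK; apply.
Qed.

(** Exactness of Hom (T, Hom (W, E)), that is of Hom (W (x) T, E), for all
    injective E: this amounts to exactness of W (x) T ([bal_tensor_exact],
    [tensor_exact_bal]) and needs no tensor product. *)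
Definition bal W T := forall E, injective_module E ->
  forall i j k, j = i + 1 -> k = j + 1 -> forall f : {linear W -> hom (T j) E},
  (forall w t, f w (d T i j t) = 0) ->
  exists g : {linear W -> hom (T k) E}, forall w t, f w t = g w (d T j k t).

Lemma bal_zero W T : zero_module W -> bal W T.
Proof.
move=> W0 E EI i j k _ _ f _; exists (0 : hom W (hom (T k) E)) => w t.
by rewrite (W0 w) linear0.
Qed.

Lemma bal_flat W T : flatI W -> exact T -> bal W T.
Proof.
move=> Wf /exactP eT E EI i j k ij jk f fd.
have [f' f'P] := swapex f.
have [|g gP] := inj_ext (p := d T j k) (f := f') (Wf E EI).
  by move=> t /(eT i j k ij jk)[s <-]; apply: homP => w; rewrite f'P fd.
have [g' g'P] := swapex g.
by exists g' => w t; rewrite g'P gP f'P.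
Qed.

Section TwoOfThree.
Variable T : complex R.
Hypothesis Tf : forall i, flatI (T i).
Variables (W' W W'' : lmodType R) (s : {linear W' -> W}) (p : {linear W -> W''}).
Hypothesis sesW : ses s p.

Let dual_ext E (EI : injective_module E) j (f : {linear W' -> hom (T j) E}) :
  exists g : {linear W -> hom (T j) E}, forall w, g (s w) = f w.
Proof. by case: sesW => /injmP sI _ _; have := Tf EI f sI. Qed.

Let dual_fac E j (f : {linear W -> hom (T j) E}) : (forall w, f (s w) = 0) ->
  exists g : {linear W'' -> hom (T j) E}, forall w, g (p w) = f w.
Proof.
case: sesW => _ sp pS fs; apply: factor_surj => // w /sp[w' <-]; exact: fs.
Qed.

Let ps w : p (s w) = 0.
Proof. by case: sesW => _ sp _; apply/sp; exists w. Qed.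

(** Together with [bal_r] and [bal_l], this is two-out-of-three for exactness of
    W (x) T in W. A short exact sequence in W induces a short exact sequence of
    complexes, as T consists of flats; the proofs are diagram chases. *)
Lemma bal_m : bal W' T -> bal W'' T -> bal W T.
Proof.
move=> b' b'' E EI i j k ij jk f fd.
have [|g0 g0P] := b' E EI i j k ij jk (hom_comp f s); first by move=> w t; exact: fd.
have [g gP] := dual_ext EI g0.
have [|h hP] := @dual_fac E j (hsub f (hom_comp (precomp E (d T j k)) g)).
  move=> w; apply: homP => t; rewrite hsubE ?homBE hcompE /= gP -g0P subrr //.
have pS : surjm p by case: sesW.
have [|m mP] := b'' E EI i j k ij jk h.
  move=> w; have [v <-] := pS w => t; rewrite hP hsubE ?homBE fd hcompE /=.
  by rewrite d_comp linear0 subr0.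
exists (hadd g (hom_comp m p)) => w t.
rewrite haddE ?homDE hcompE -mP hP hsubE ?homBE hcompE /=.
by rewrite addrC subrK.
Qed.

Lemma bal_r : bal W' T -> bal W T -> bal W'' T.
Proof.
move=> b' b E EI i j k ij jk f fd.
have [|g gP] := b E EI i j k ij jk (hom_comp f p); first by move=> w t; exact: fd.
have [|k0 k0P] := b' E EI j k (k + 1) jk erefl (hom_comp g s).
  by move=> w t; rewrite hcompE -gP hcompE ps linear0.
have [K KP] := dual_ext EI k0.
have [|m mP] := @dual_fac E k (hsub g (hom_comp (precomp E (d T k (k + 1))) K)).
  move=> w; apply: homP => t; rewrite hsubE ?homBE [X in _ - X]/= KP -k0P hcompE subrr //.
have pS : surjm p by case: sesW.
exists m => w t; have [v <-] := pS w; rewrite mP hsubE ?homBE -gP hcompE /=.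
by rewrite d_comp linear0 subr0.
Qed.

Lemma bal_l : bal W T -> bal W'' T -> bal W' T.
Proof.
move=> b b'' E EI i j k ij jk f fd.
have [F FP] := dual_ext EI f.
have [|h hP] := @dual_fac E i (hom_comp (precomp E (d T i j)) F).
  by move=> w; apply: homP => t; rewrite /= FP fd.
have pS : surjm p by case: sesW.
have [||m mP] := b'' E EI (i - 1) i j _ ij h.
- by rewrite subrK.
- by move=> w t; have [v <-] := pS w; rewrite hP /= d_comp linear0.
have [|g gP] := b E EI i j k ij jk (hsub F (hom_comp m p)).
  by move=> w t; rewrite hsubE ?homBE hcompE -mP hP /= subrr.
exists (hom_comp g s) => w t.
by rewrite hcompE -gP hsubE ?homBE hcompE ps linear0 hom0E subr0 FP.
Qed.
End TwoOfThree.

(** The modules obtained from A by two-out-of-three in short exact sequences. *)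
Inductive thick (A : mod_class R) : mod_class R :=
| thick_base M of A M : thick A M
| thick_zero M of zero_module M : thick A M
| thick_l M N P (i : {linear M -> N}) (p : {linear N -> P}) of
    ses i p & thick A N & thick A P : thick A M
| thick_m M N P (i : {linear M -> N}) (p : {linear N -> P}) of
    ses i p & thick A M & thick A P : thick A N
| thick_r M N P (i : {linear M -> N}) (p : {linear N -> P}) of
    ses i p & thick A M & thick A N : thick A P.

Lemma thick_bal T (A : mod_class R) : (forall i, flatI (T i)) ->
  (forall M, A M -> bal M T) -> forall M, thick A M -> bal M T.
Proof.
move=> Tf AT M; elim=> {M}[M /AT//|M /bal_zero//|M N P i p s _ bN _ bP|
  M N P i p s _ bM _ bP|M N P i p s _ bM _ bN].
- exact: (bal_l Tf s bN bP).
- exact: (bal_m Tf s bM bP).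
- exact: (bal_r Tf s bM bN).
Qed.

(** Hom (-, E) is exact on a short exact sequence as soon as maps to E extend
    along its first map. *)
Lemma ses_hom_ext M N P E (i : {linear M -> N}) (p : {linear N -> P}) :
  (forall f : {linear M -> E}, exists g : {linear N -> E}, forall x, g (i x) = f x) ->
  ses i p -> ses (precomp E p) (precomp E i).
Proof.
move=> ext [iI ip pS]; split=> [f fp|f|f].
- apply: homP => y; have [x <-] := pS y.
  exact: (congr1 (fun h : hom N E => h x) fp).
- split=> [fi|[g <-]]; last first.
    apply: homP => x; rewrite /= (_ : p (i x) = 0) ?linear0 //.
    by apply/ip; exists x.
  have [|g gP] := factor_surj (p := p) (f := f) pS.
    move=> y /ip[x <-]; exact: (congr1 (fun h : hom M E => h x) fi).
  by exists g; apply: homP => x; rewrite /= gP.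
have [g gP] := ext f.
by exists g; apply: homP => x; rewrite /= gP.
Qed.

Lemma ses_hom M N P E (i : {linear M -> N}) (p : {linear N -> P}) :
  injective_module E -> ses i p -> ses (precomp E p) (precomp E i).
Proof.
move=> EI s; apply: (ses_hom_ext _ s) => f; have [iI _ _] := s.
exact: (EI _ _ i f ((injmP i).1 iI)).
Qed.

(** Hom (-, E) turns short exact sequences into short exact sequences. *)
Lemma thick_bal_hom T (A : mod_class R) : (forall i, flatI (T i)) ->
  (forall M, A M -> forall E, injective_module E -> bal (hom M E) T) ->
  forall M, thick A M -> forall E, injective_module E -> bal (hom M E) T.
Proof.
move=> Tf AT M; elim=> {M}[M /AT//|M M0 E _|M N P i p s _ bN _ bP E EI|
  M N P i p s _ bM _ bP E EI|M N P i p s _ bM _ bN E EI].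
- by apply: bal_zero => f; apply: homP => x; rewrite (M0 x) linear0.
- exact: (bal_r Tf (ses_hom EI s) (bP E EI) (bN E EI)).
- exact: (bal_m Tf (ses_hom EI s) (bP E EI) (bM E EI)).
- exact: (bal_l Tf (ses_hom EI s) (bN E EI) (bM E EI)).
Qed.

Lemma zero_row0 : zero_module 'rV[R]_0.
Proof. by move=> v; apply/rowP => -[]. Qed.

Lemma thick_iso A M N : isomorphic M N -> thick A M -> thick A N.
Proof.
move=> [f fB] tM.
apply: (@thick_r A 'rV[R]_0 M N (0 : hom _ _) f) => //; last first.
  exact/thick_zero/zero_row0.
have [g fK gK] := fB.
split=> [v _|x|y]; first exact: zero_row0.
  split=> [fx|[v <-]]; last by rewrite hom0E linear0.
  by exists 0; rewrite hom0E -(fK x) fx -(fK 0) linear0.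
by exists (g y).
Qed.

Lemma isom_sym M N : isomorphic M N -> isomorphic N M.
Proof.
move=> [f [g fK gK]]; have gL : linear g.
  by move=> a x y; apply: (can_inj fK); rewrite linearP !gK.
by exists (mklin gL), f.
Qed.

Lemma bal_iso M N T : isomorphic M N -> bal M T -> bal N T.
Proof.
move=> /isom_sym[g [f gK fK]] bM E EI i j k ij jk h hd.
have fL : linear f by move=> a x y; apply: (can_inj gK); rewrite linearP !fK.
have [|u uP] := bM E EI i j k ij jk (hom_comp h (mklin fL)).
  by move=> w t; exact: hd.
by exists (hom_comp u g) => w t; rewrite hcompE -uP hcompE mklinE gK.
Qed.

Lemma hom_R_iso M : isomorphic (hom R^o M) M.
Proof.
exists (ev M (1 : R^o)), (fun m => scalar_map m) => [f|m]; last exact: scale1r.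
apply: homP => a; rewrite -[LHS]/(a *: f 1) -linearZ; congr (f _).
exact: mulr1.
Qed.

Definition cyc X i : lmodType R := kerM (d X i (i + 1)).
Definition cyc_in X i : {linear cyc X i -> X i} := incl (kerS (d X i (i + 1))).
Lemma cyc_inI X i : injm (@cyc_in X i).
Proof. exact: incl_inj. Qed.
Lemma cycP X i z : d X i (i + 1) (@cyc_in X i z) = 0.
Proof. exact: (inclP z). Qed.
Lemma cyc_lift X i x : d X i (i + 1) x = 0 -> exists z, @cyc_in X i z = x.
Proof. exact: (@incl_lift _ _ (kerS (d X i (i + 1)))). Qed.
Lemma cyc_factor X i N (f : {linear N -> X i}) : (forall x, d X i (i + 1) (f x) = 0) ->
  exists g : {linear N -> cyc X i}, forall x, cyc_in X i (g x) = f x.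
Proof. exact: (@incl_factor _ _ (kerS (d X i (i + 1)))). Qed.

(** The sequence of cycles 0 -> Z^i -> X^i -> Z^j -> 0 at one place. *)
Lemma cyc_ses_at X i j : j = i + 1 ->
  (forall x : X j, d X j (j + 1) x = 0 -> exists y, d X i j y = x) ->
  exists p : {linear X i -> cyc X j}, ses (cyc_in X i) p /\
    forall x, cyc_in X j (p x) = d X i j x.
Proof.
move=> ij eX.
have [|p pP] := @cyc_factor X j _ (d X i j); first by move=> x; rewrite d_comp.
exists p; split=> //; split=> [||z].
- exact: cyc_inI.
- move=> x; split=> [px|[z <-]].
    by apply: cyc_lift; rewrite -ij -pP px linear0.
  by apply: (@cyc_inI X j); rewrite pP ij cycP.
have [x xz] := eX _ (cycP z).
by exists x; apply: (injmP _).1 (@cyc_inI X j) _ _ _; rewrite pP.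
Qed.

Lemma cyc_ses X : exact X -> forall i j, j = i + 1 ->
  exists p : {linear X i -> cyc X j}, ses (cyc_in X i) p /\
    forall x, cyc_in X j (p x) = d X i j x.
Proof.
move=> /exactP eX i j ij; apply: cyc_ses_at => // x.
exact: (eX i j (j + 1) ij erefl).
Qed.

Section Bounded.
Variables (A : mod_class R) (X : complex R) (n : nat) (k : int).
Hypothesis X0 : forall i, n%:Z < `|i| -> zero_module (X i).

Let Z0 i : n%:Z < `|i| -> thick A (cyc X i).
Proof. by move=> /X0 Xi; apply: thick_zero => z; apply: (@cyc_inI X i); exact: Xi. Qed.

Lemma thick_right :
  (forall i j, k < j -> j = i + 1 ->
     forall x : X j, d X j (j + 1) x = 0 -> exists y, d X i j y = x) ->
  (forall i, k <= i -> thick A (X i)) -> thick A (cyc X k).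
Proof.
move=> eX XA.
have H m i : k <= i -> n%:Z < i + m%:Z -> thick A (cyc X i).
  elim: m i => [|m IH] i ki ni; first by apply: Z0; lia.
  have [|p [s _]] := @cyc_ses_at X _ _ (erefl (i + 1)); first by apply: eX; lia.
  by apply: (thick_l s); [exact: XA|apply: IH; lia].
by apply: (H (`|k|%N + n).+1); lia.
Qed.

Lemma thick_left :
  (forall i j, j <= k -> j = i + 1 ->
     forall x : X j, d X j (j + 1) x = 0 -> exists y, d X i j y = x) ->
  (forall i, i < k -> thick A (X i)) -> thick A (cyc X k).
Proof.
move=> eX XA.
have H m i : i <= k -> i < m%:Z - n%:Z -> thick A (cyc X i).
  elim: m i => [|m IH] i ki ni; first by apply: Z0; lia.
  have e : i = (i - 1) + 1 by rewrite subrK.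
  have [|p [s _]] := @cyc_ses_at X _ _ e; first exact: eX.
  by apply: (thick_r s); [apply: IH; lia|apply: XA; lia].
by apply: (H (`|k|%N + n).+1); lia.
Qed.
End Bounded.

Lemma thick_bounded A X (n : nat) k : exact X ->
  (forall i, n%:Z < `|i| -> zero_module (X i)) ->
  (forall i, i != k -> thick A (X i)) -> thick A (X k).
Proof.
move=> eX X0 XA; have [p [s _]] := cyc_ses eX (erefl (k + 1)).
have eX' i j : j = i + 1 -> forall x : X j, d X j (j + 1) x = 0 -> exists y, d X i j y = x.
  by move=> ij x; exact: ((exactP X).1 eX i j (j + 1) ij erefl).
apply: (thick_m s).
  by apply: (thick_left X0) => [i j _|i ik]; [exact: eX'|apply: XA; lia].
by apply: (thick_right X0) => [i j _|i ik]; [exact: eX'|apply: XA; lia].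
Qed.

(** If the cohomology of X is concentrated in degree k, where it is M, then M is
    the quotient of the cycles in degree k, which are built from the terms to
    the right, by the boundaries, which are built from the terms to the left. *)
Lemma thick_homology A X (n : nat) (k k1 : int) M (rho : {linear M -> cyc X k}) :
  k = k1 + 1 -> (forall i, n%:Z < `|i| -> zero_module (X i)) ->
  (forall i j, j != k -> j = i + 1 ->
     forall x : X j, d X j (j + 1) x = 0 -> exists y, d X i j y = x) ->
  (forall i, thick A (X i)) ->
  (forall z, exists m y, cyc_in X k z = cyc_in X k (rho m) + d X k1 k y) ->
  (forall m y, cyc_in X k (rho m) = d X k1 k y -> m = 0) ->
  thick A M.
Proof.
move=> kk1 X0 eX XA gen inj.
have [|b bP] := @cyc_factor X k _ (d X k1 k); first by move=> x; rewrite d_comp.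
have cI := (injmP _).1 (@cyc_inI X k).
have tcyc : thick A (cyc X k).
  by apply: (thick_right X0) => [i j kj|i _]; [apply: eX; lia|exact: XA].
have tcyc1 : thick A (cyc X k1).
  by apply: (thick_left X0) => [i j kj|i _]; [apply: eX; lia|exact: XA].
have [b' b'P] := incl_factor (S := imS b) (f := b) (fun x => ex_intro _ x erefl).
have sb : ses (cyc_in X k1) b'.
  split=> [|x|y]; first exact: cyc_inI.
    have E : b' x = 0 <-> d X k1 (k1 + 1) x = 0.
      rewrite -kk1 -bP -b'P; split=> [->|e]; first by rewrite !linear0.
      by apply: incl_inj; apply: (@cyc_inI X k).
    by rewrite E; split=> [/cyc_lift//|[z <-]]; exact: cycP.
  have [x xy] := inclP y; exists x.
  by apply: (injmP _).1 (@incl_inj _ _ _) _ _ _; rewrite b'P.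
have tim := thick_r sb tcyc1 (XA k1).
have tcok := thick_r (ses_cok (@incl_inj _ _ (imS b))) tim tcyc.
pose q := qpi (imS (incl (imS b))); pose f := hom_comp q rho.
apply: (thick_iso _ tcok); apply: isom_sym.
have qb x : q (b x) = 0 by apply/qpi_ker; exists (b' x); rewrite b'P.
have fI : injm f.
  move=> m /qpi_ker[y ym]; have [x xy] := inclP y; apply: (inj m x).
  by rewrite -ym -xy bP.
have fS : surjm f.
  move=> y; have [z <-] := qpi_surj y; have [m [x zx]] := gen z.
  exists m; rewrite -[LHS]/(q (rho m)); have -> : z = rho m + b x.
    by apply: cI; rewrite linearD bP.
  by rewrite linearD qb addr0.
have [g [fK gK]] := bij_inv fI fS.
by exists f, g.
Qed.

(** A cycle that is not a boundary is detected by a map to the cogenerator. *)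
Lemma bal_tensor_exact W T : bal W T -> tensor_exact W T.
Proof.
move=> bWT Y b tb bd; apply/exactP => i j k ij jk y yk.
have [E [EI Esep]] := cogenerator R.
suff [x xy] : imS (d Y i j) y by exists x.
apply: contrapT => /(Esep _)[f [fS]]; apply.
have [[bl br] bu] := tb j.
have [||h hP] := @mkbil R W (T j) E (fun w t => f (b j w t)).
- by move=> w a t t'; rewrite bl linearP.
- by move=> t a w w'; rewrite br linearP.
have [|g gP] := bWT E EI i j k ij jk h.
  by move=> w t; rewrite hP -bd; apply: fS; eexists.
have [|psi [psiP _]] := (tb k).2 E (fun w t => g w t).
  by split=> [w a t t'|t a w w']; rewrite linearP.
have -> : f y = hom_comp psi (d Y j k) y; last by rewrite hcompE yk linear0.
by apply: (tensor_ext (tb j)) => w t; rewrite hcompE bd psiP -gP hP.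
Qed.

Lemma tensor_exact_bal W T : tensor_exact W T -> bal W T.
Proof.
move=> teWT E EI i j k ij jk f fd.
pose S i := sval (cid (tensor_ex W (T i))).
pose b i : W -> T i -> S i := sval (cid (svalP (cid (tensor_ex W (T i))))).
have tb i' : is_tensor (b i') := svalP (cid (svalP (cid (tensor_ex W (T i'))))).
have dex i' j' : exists u : {linear S i' -> S j'}, forall x y, u (b i' x y) = b j' x (d T i' j' y).
  have [[bl br] _] := tb j'.
  have [|u [uP _]] := (tb i').2 (S j') (fun x y => b j' x (d T i' j' y)).
    by split=> [w a t t'|t]; [rewrite linearP bl|exact: br].
  by exists u.
pose dS i' j' := sval (cid (dex i' j')).
have dSE i' j' x y : dS i' j' (b i' x y) = b j' x (d T i' j' y) := svalP (cid (dex i' j')) x y.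
have b0 i' x : b i' x 0 = 0 by have [[bl br] _] := tb i'; have := linear0 (mklin (bl x)).
have shS i' j' : j' != i' + 1 -> forall x, dS i' j' x = 0.
  move=> h x; rewrite -[RHS]/((0 : hom (S i') (S j')) x).
  apply: (tensor_ext (tb i')) => w t; rewrite dSE d_shape // b0 //.
have cS i' j' k' x : dS j' k' (dS i' j' x) = 0.
  rewrite -[LHS]/(hom_comp (dS j' k') (dS i' j') x) -[RHS]/((0 : hom (S i') (S k')) x).
  by apply: (tensor_ext (tb i')) => w t; rewrite hcompE !dSE d_comp b0.
have /exactP eS := teWT (Complex shS cS) b tb (fun i' j' x y => dSE i' j' x y).
have [|phi [phiP _]] := (tb j).2 E (fun w t => f w t).
  by split=> [w a t t'|t a w w']; rewrite linearP.
have [|psi psiP] := inj_ext (p := dS j k) (f := phi) EI.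
  move=> y /(eS i j k ij jk)[x <-].
  rewrite -[LHS]/(hom_comp phi (dS i j) x) -[RHS]/((0 : hom (S i) E) x).
  by apply: (tensor_ext (tb i)) => w t; rewrite hcompE dSE phiP fd.
have [[bl br] _] := tb k.
have [||g gP] := @mkbil R W (T k) E (fun w t => psi (b k w t)).
- by move=> w a t t'; rewrite bl linearP.
- by move=> t a w w'; rewrite br linearP.
by exists g => w t; rewrite gP -dSE psiP phiP.
Qed.

Hypothesis noethR : noetherian R.

(** E is Hom (R, E), R is built from injectives V, and Hom (V, E) is flat. *)
Lemma bal_thick_inj T : exact T -> (forall i, flatI (T i)) ->
  thick (@injective_module R) R^o -> forall E, injective_module E -> bal E T.
Proof.
move=> eT Tf tR E EI; apply: bal_iso (hom_R_iso E) _.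
apply: (thick_bal_hom Tf _ tR) => // V VI {}E {}EI.
by apply: bal_flat => //; apply: eqflat_flatI => //; exact: eqflat_hom_inj.
Qed.

Lemma fin_inj_dim_thick : finite_injective_dimension (R^o : lmodType R) ->
  thick (@injective_module R) R^o.
Proof.
move=> [n [Y [eY iso Yneg Yinj Ypos]]]; apply: thick_iso iso _.
apply: (thick_bounded (n := n.+1) eY) => [i|i im1].
  case: i => i; rewrite ?abszE.
    by move=> ni; apply: Ypos; apply: lt_trans ni; rewrite ltz_nat.
  rewrite NegzE normrN => ni; apply: Yneg; rewrite ltrN2.
  by apply: le_lt_trans ni; rewrite lez_nat.
have [i0|i0] := leP 0 i; first exact/thick_base/Yinj.
apply/thick_zero/Yneg; case: i i0 im1 => // -[|m] // _ _.
Qed.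
End Exact.

(** * Filtered colimits of modules *)

Section Colim.
Variables (R : comPzRingType) (I : small_category).
Hypothesis fI : filtering I.

Section Concrete.
Variable (F : functor I (Mod R)).
Definition fm i j (a : sarr i j) : {linear F i -> F j} := fmap F a.
Lemma fm1 i x : fm (sid i) x = x. Proof. by rewrite /fm fmap1. Qed.
Lemma fmM i j k (b : sarr j k) (a : sarr i j) x : fm (scomp b a) x = fm b (fm a x).
Proof. by rewrite /fm fmapM. Qed.

(** The elementwise description of a filtered colimit, equivalent to the
    universal property ([fcolim_colim], [colim_fcolim]). *)
Definition fcolim (M : lmodType R) (c : forall i, {linear F i -> M}) :=
  [/\ forall i j (a : sarr i j) x, c j (fm a x) = c i x,
      forall m, exists i x, c i x = m &
      forall i x, c i x = 0 -> exists j (a : sarr i j), fm a x = 0].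

Section Universal.
Variables (M : lmodType R) (c : forall i, {linear F i -> M}).
Hypothesis cP : fcolim c.
Variables (Y : lmodType R) (f : forall i, {linear F i -> Y}).
Hypothesis fC : forall i j (a : sarr i j) x, f j (fm a x) = f i x.

Lemma fcolim_eq i j x y : c i x = c j y -> f i x = f j y.
Proof.
case: cP => cC _ c0 e; case: fI => _ ub _.
have [k [a [b _]]] := ub i j.
have [|l [u uP]] := c0 k (fm a x - fm b y); first by rewrite linearB !cC e subrr.
rewrite -(fC a) -(fC b) -(fC u) -(fC u (fm b y)).
by apply/eqP; rewrite -subr_eq0 -!linearB uP linear0.
Qed.

Lemma fcolim_map : exists u : {linear M -> Y}, forall i x, u (c i x) = f i x.
Proof.
case: (cP) => cC cS _; case: fI => _ ub _.
have [u uP] : exists u : M -> Y, forall i x, u (c i x) = f i x.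
  have H m : exists y : Y, forall i x, c i x = m -> f i x = y.
    have [i [x xm]] := cS m; exists (f i x) => j z zm.
    by apply: fcolim_eq; rewrite zm.
  by have [u uP] := choice H; exists u => i x; rewrite (uP _ i x erefl).
have uL : linear u.
  move=> r m m'; have [i [x <-]] := cS m; have [j [y <-]] := cS m'.
  have [k [a [b _]]] := ub i j.
  by rewrite -(cC _ _ a) -(cC _ _ b) -linearP !uP linearP.
by exists (mklin uL).
Qed.
End Universal.

Lemma fcolim_colim (M : lmodType R) (c : forall i, {linear F i -> M}) :
  fcolim c -> @is_colimit I (Mod R) F M c.
Proof.
move=> cP; case: (cP) => cC cS _; split=> [i j a|Y f fC]; first exact/homP/cC.
have [|u uP] := fcolim_map cP (f := f).
  by move=> i j a x; exact: (congr1 (fun h : hom (F i) Y => h x) (fC i j a)).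
exists u; split=> [i|v vP]; first exact/homP/uP.
apply: homP => m; have [i [x <-]] := cS m; rewrite uP.
by rewrite -[RHS]/((comp v (c i) : hom (F i) Y) x) (vP i).
Qed.

(* A partial cone: a vertex k with arrows to it from some of the objects. It is
   compatible with an arrow a : i -> j if it is defined at i and j and commutes
   with a. *)
Let cone := {k : I & forall j : I, option (sarr j k)}.
Let arr := {i : I & {j : I & sarr i j}}.
Let compat (t : cone) (al : arr) :=
  exists2 b, projT2 t (projT1 (projT2 al)) = Some b &
             projT2 t (projT1 al) = Some (scomp b (projT2 (projT2 al))).
Fixpoint compats (t : cone) (l : seq arr) :=
  if l is al :: l' then compat t al /\ compats t l' else True.
Lemma compats_cat t l l' : compats t (l ++ l') <-> compats t l /\ compats t l'.
Proof. by elim: l => /= [|al l ->]; tauto. Qed.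
Lemma compats_sub t t' l : (forall al, compat t al -> compat t' al) ->
  compats t l -> compats t' l.
Proof. by move=> h; elim: l => //= al l IH [/h ? /IH]. Qed.

Let push (k k' : I) (a : sarr k k') (w : forall j : I, option (sarr j k)) j :=
  omap (scomp a) (w j).
Lemma push_compat k k' (a : sarr k k') w al :
  compat (existT _ k w) al -> compat (existT _ k' (push a w)) al.
Proof.
move=> [b /= eb ec]; exists (scomp a b); rewrite /= /push ?eb ?ec //=.
by rewrite scompA.
Qed.

(** A cone on finitely many objects of the index category, and on arrows between
    them, can be enlarged by one more object, keeping compatibility. *)
Lemma cone_defined (t : cone) j : exists2 t' : cone,
  forall al, compat t al -> compat t' al & exists b, projT2 t' j = Some b.
Proof.
case: t => k w; case e: (w j) => [b|]; first by exists (existT _ k w) => //; exists b.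
case: fI => _ ub _; have [k' [a [b _]]] := ub k j.
pose w' j' : option (sarr j' k') :=
  if pselect (j = j') is left h then ecast z (option (sarr z k')) h (Some b)
  else push a w j'.
have w'j : w' j = Some b.
  by rewrite /w'; case: pselect => // h; rewrite (Prop_irrelevance h erefl).
have w'E j' : j <> j' -> w' j' = push a w j' by rewrite /w'; case: pselect.
have wN q (u : sarr q k) : w q = Some u -> j <> q.
  by move=> h jq; subst q; rewrite e in h.
exists (existT _ k' w'); last by exists b.
move=> al /[dup] [[c /= ec ed]] /(push_compat a)[c' /= ec' ed'].
by exists c' => /=; rewrite w'E //; apply: wN; [exact: ec|exact: ed].
Qed.

Lemma compats_ex l : exists t, compats t l.
Proof.
elim: l => [|[i [j a]] l [t tl]].
  case: fI => -[k _] _ _.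
  by exists (existT _ k (fun j => None)).
have [t1 tt1 [u1 e1]] := cone_defined t i.
have [[k w] t12 [v /= e2]] := cone_defined t1 j.
have [u eu] : exists u, w i = Some u.
  have [|b /= eb ec] := t12 (existT _ i (existT _ i (sid i))).
    by exists u1; rewrite //= scompa1.
  by exists b.
case: fI => _ _ coeq; have [k' [c cP]] := coeq _ _ u (scomp v a).
exists (existT _ k' (push c w)) => /=; split.
  exists (scomp c v); first by rewrite /= /push e2.
  by rewrite /= /push eu /= cP scompA.
by apply: compats_sub tl => al /tt1/t12/(push_compat c).
Qed.

(** The colimit is modelled on functions on the set of partial cones t, with
    values in F at the vertex of t. The germ of x in F j is the function that
    moves x to the vertex along the component of t at j; two functions are
    identified when they agree on all cones compatible with a finite list of
    arrows. Filteredness provides such cones, so that this quotient does not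
    collapse ([colimP]), and no direct sum over the objects is needed. *)
Definition germs : submod (prodM (fun t : cone => F (projT1 t))).
Proof.
exists (fun g : prodM (fun t : cone => F (projT1 t)) =>
  exists l, forall t, compats t l -> g t = 0); first by exists [::].
move=> a x y [l xl] [l' yl]; exists (l ++ l') => t /compats_cat[/xl xt /yl yt].
by rewrite prodDE prodZE xt yt scaler0 addr0.
Defined.
Definition germ0 j (x : F j) : prodM (fun t : cone => F (projT1 t)) := fun t =>
  if projT2 t j is Some b then fm b x else 0.
Lemma germ0L j : linear (@germ0 j).
Proof.
move=> a x y; apply: prodP => t; rewrite prodDE prodZE /germ0.
by case: (projT2 t j) => [b|]; rewrite ?linearP ?scaler0 ?addr0.
Qed.
Definition germ j := hom_comp (qpi germs) (mklin (@germ0L j)).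
Lemma germC i j (a : sarr i j) x : germ j (fm a x) = germ i x.
Proof.
apply/eqP; rewrite -subr_eq0; apply/eqP.
rewrite -[LHS]/(qpi germs (germ0 _) - qpi germs (germ0 _)) -linearB; apply/qpi_ker.
exists [:: existT _ i (existT _ j a)] => t [[b /= eb ec] _].
by rewrite prodBE /germ0 eb ec fmM subrr.
Qed.
Definition colimS : submod (quotM germs).
Proof.
exists (fun z => exists i x, germ i x = z).
  by case: fI => -[i _] _ _; exists i, 0; rewrite linear0.
move=> a _ _ [i [x <-]] [j [y <-]]; case: fI => _ ub _.
have [k [u [v _]]] := ub i j; exists k, (a *: fm u x + fm v y).
by rewrite linearP !germC.
Defined.
Definition colim : lmodType R := subM colimS.
Lemma colim_in_ex i : exists c : {linear F i -> colim}, forall x, incl colimS (c x) = germ i x.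
Proof. by apply: incl_factor => x; exists i, x. Qed.
Definition colim_in i := sval (cid (colim_in_ex i)).
Lemma colim_inE i x : incl colimS (colim_in i x) = germ i x.
Proof. exact: (svalP (cid (colim_in_ex i)) x). Qed.

(** An element of F i with zero germ dies at the vertex of any cone that is
    compatible with a suitable finite list of arrows; [compats_ex] gives such a
    cone. *)
Lemma colimP : fcolim colim_in.
Proof.
have cI := (injmP _).1 (@incl_inj _ _ colimS).
split=> [i j a x|m|i x].
- by apply: cI; rewrite !colim_inE germC.
- have [i [x e]] := inclP m; exists i, x.
  by apply: cI; rewrite colim_inE e.
move=> /(congr1 (incl colimS)); rewrite colim_inE linear0 => /qpi_ker[l lP].
have [t [[b /= eb _] tl]] := compats_ex (existT _ i (existT _ i (sid i)) :: l).
by exists (projT1 t), b; have := lP t tl; rewrite mklinE /germ0 eb.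
Qed.

(** The concrete colimit has the universal property, so it is isomorphic to
    any other colimit. *)
Lemma colim_fcolim (M : lmodType R) (c : forall i, {linear F i -> M}) :
  @is_colimit I (Mod R) F M c -> fcolim c.
Proof.
move=> [cC cU].
have cCx i j (a : sarr i j) x : c j (fm a x) = c i x.
  exact: (congr1 (fun h : hom (F i) M => h x) (cC i j a)).
have [gC gS g0] := colimP.
have [|v [vP _]] := cU colim colim_in.
  by move=> i j a; apply: homP => x; exact: gC.
have {}vP i x : v (c i x) = colim_in i x.
  exact: (congr1 (fun h : hom (F i) colim => h x) (vP i)).
have [u uP] := fcolim_map colimP cCx.
have [w [_ wU]] := cU M c cC.
have uv : hom_comp u v = hom_id M.
  have <- : w = hom_comp u v.
    by apply: wU => i; apply: homP => x; rewrite -[LHS]/(u (v (c i x))) vP uP.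
  by apply: wU => i; exact: homP.
split=> // [m|i x cx].
  have [i [x e]] := gS (v m); exists i, x.
  by rewrite -uP e -[LHS]/(hom_comp u v m) uv.
by apply: g0; rewrite -vP cx linear0.
Qed.

Lemma dir_bound n (f : 'I_n -> I) : exists k, forall i, exists a : sarr (f i) k, True.
Proof.
case: (fI) => ne ub _.
elim: n f => [|n IH] f; first by have [k _] := ne; exists k => -[].
have [k kP] := IH (fun i => f (lift ord0 i)).
have [l [a [b _]]] := ub k (f ord0); exists l => i.
case: (unliftP ord0 i) => [j ->|->]; last by exists b.
by have [c _] := kP j; exists (scomp a c).
Qed.

Lemma fcolim_lift (M : lmodType R) (c : forall i, {linear F i -> M}) : fcolim c ->
  forall n (x : 'I_n -> M), exists i (y : 'I_n -> F i), forall k, c i (y k) = x k.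
Proof.
move=> [cC cS _] n x.
have [f fP] := choice (fun k => cS (x k)).
have [i iP] := dir_bound f.
have H k : exists y : F i, c i y = x k.
  by have [y <-] := fP k; have [a _] := iP k; exists (fm a y).
by have [y yP] := choice H; exists i, y.
Qed.

Lemma fcolim_kill (M : lmodType R) (c : forall i, {linear F i -> M}) : fcolim c ->
  forall n i (y : 'I_n -> F i), (forall k, c i (y k) = 0) ->
  exists j (a : sarr i j), forall k, fm a (y k) = 0.
Proof.
move=> [cC _ c0]; elim=> [|n IH] i y y0; first by exists i, (sid i) => -[].
have [j [a aP]] := IH i (fun k => y (lift ord0 k)) (fun k => y0 _).
have [|l [b bP]] := c0 j (fm a (y ord0)); first by rewrite cC.
exists l, (scomp b a) => k; rewrite fmM.
by case: (unliftP ord0 k) => [k' ->|->//]; rewrite aP linear0.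
Qed.

(** Finitely many generators lift to one index, and finitely many relations
    between them hold at a later one. *)
Lemma fcolim_fp (M : lmodType R) (c : forall i, {linear F i -> M}) : fcolim c ->
  forall (N : lmodType R) (f : {linear N -> M}), fin_pres N ->
  exists i (g : {linear N -> F i}), forall x, c i (g x) = f x.
Proof.
move=> cP N f [n [m [p [q [pS pq]]]]]; have [cC _ _] := cP.
have [i [y yP]] := fcolim_lift cP (fun k => f (p (delta_mx 0 k))).
have cy v : c i (rowmap y v) = f (p v).
  rewrite -[LHS]/(hom_comp (c i) (rowmap y) v) -[RHS]/(hom_comp f p v).
  by apply: row_ext => k; rewrite !hcompE rowmap_delta yP.
have [|j [a aP]] := fcolim_kill cP (y := fun k => rowmap y (q (delta_mx 0 k))).
  move=> k; rewrite cy (pq _).2 ?linear0 //.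
  by exists (delta_mx 0 k).
have [|g gP] := factor_surj (p := p) (f := hom_comp (fm a) (rowmap y)) pS.
  move=> v /pq[w <-]; rewrite -[LHS]/(hom_comp (hom_comp (fm a) (rowmap y)) q w).
  rewrite -[RHS]/((0 : hom 'rV_m (F j)) w).
  by apply: row_ext => k; rewrite !hcompE aP.
by exists j, g => x; have [v <-] := pS x; rewrite gP hcompE cC cy.
Qed.
End Concrete.

(** The relations in the equational criterion are finite in number, so they hold
    at some index. *)
Lemma eqflat_fcolim (F : functor I (Mod R)) (M : lmodType R)
  (c : forall i, {linear F i -> M}) : fcolim c -> (forall i, eqflat (F i)) -> eqflat M.
Proof.
move=> cP Ff n m A x Ax; have [i [y yP]] := fcolim_lift cP x.
have cE k (j : 'I_k) p (B : 'M_(p, k)) (z : vec (F i) p) :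
    c i (mxact _ B z j) = mxact _ B (fun l => c i (z l) : M) j.
  by rewrite !mxactE linear_sum; apply: eq_bigr => l _; rewrite linearZ.
have [|j [a aP]] := fcolim_kill cP (y := mxact _ A y : vec (F i) m).
  move=> k; rewrite cE -[RHS](prod0E (fun _ : 'I_m => M) k) -Ax.
  by congr (mxact _ A _ k); apply: prodP => l; rewrite yP.
have [|p [K [z [KA zP]]]] := Ff j n m A (fun l => fm F a (y l)).
  apply: prodP => k; rewrite prod0E -(aP k) !mxactE linear_sum.
  by apply: eq_bigr => l _; rewrite linearZ.
exists p, K, (fun l => c j (z l)); split=> //; apply: prodP => k.
have [cC _ _] := cP.
rewrite -yP -(cC _ _ a) (_ : fm F a (y k) = mxact _ K z k); last by rewrite -zP.
by rewrite !mxactE linear_sum; apply: eq_bigr => l _; rewrite linearZ.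
Qed.
End Colim.

(** * Gorenstein flat modules as filtered colimits *)

Section Criterion.
Variables (R : comPzRingType) (S : mod_class R) (M : lmodType R).
Implicit Types (N G H : lmodType R).
Hypothesis Sfg : forall G, S G -> fin_gen G.
Hypothesis Siso : forall G H, isomorphic G H -> S G -> S H.
Hypothesis fac : forall N (f : {linear N -> M}), fin_gen N ->
  exists G (a : {linear N -> G}) (b : {linear G -> M}), S G /\ forall x, b (a x) = f x.

(** The category of arrows to M from modules of S. Finitely generated modules are
    represented by quotients of row modules, which keeps the category small. *)
Definition over_obj : Type :=
  {z : {z : {n : nat & submod ('rV[R]_n)} & {linear quotM (projT2 z) -> M}} |
     S (quotM (projT2 (projT1 z)))}.
HB.instance Definition _ := gen_eqMixin over_obj.
HB.instance Definition _ := gen_choiceMixin over_obj.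
Definition over_mod (z : over_obj) : lmodType R := quotM (projT2 (projT1 (sval z))).
Definition over_map (z : over_obj) : {linear over_mod z -> M} := projT2 (sval z).
Definition over_arr (z w : over_obj) : Type :=
  {h : hom (over_mod z) (over_mod w) | forall x, over_map w (h x) = over_map z x}.
HB.instance Definition _ z w := gen_eqMixin (over_arr z w).
HB.instance Definition _ z w := gen_choiceMixin (over_arr z w).
Lemma over_arr_eq z w (a b : over_arr z w) : (forall x, sval a x = sval b x) -> a = b.
Proof. by case: a b => [a aP] [b bP] /= /homP ab; apply: eq_exist. Qed.
Definition mk_over z w (h : hom (over_mod z) (over_mod w))
  (hP : forall x, over_map w (h x) = over_map z x) : over_arr z w := exist _ h hP.
Definition over_id z : over_arr z z :=
  @mk_over z z (hom_id (over_mod z)) (fun x => erefl).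
Definition over_comp z w t (b : over_arr w t) (a : over_arr z w) : over_arr z t :=
  @mk_over z t (hom_comp (sval b) (sval a)) (fun x => etrans (svalP b _) (svalP a x)).
Definition over_cat : small_category.
Proof.
exists (over_obj : choiceType) (fun z w => over_arr z w : choiceType) over_id over_comp.
- by move=> i j a; apply: over_arr_eq.
- by move=> i j a; apply: over_arr_eq.
- by move=> i j k l c b a; apply: over_arr_eq.
Defined.
Definition over_fun : functor over_cat (Mod R).
Proof.
exists (fun z : over_cat => over_mod z : Mod R) (fun z w a => sval a) => //.
Defined.

Lemma fin_gen_quot N : fin_gen N ->
  exists n (T : submod 'rV[R]_n), isomorphic N (quotM T).
Proof.
move=> [n [p pS]]; exists n, (kerS p).
have [g gP] := factor_surj (p := p) (f := qpi (kerS p)) pS (fun x => (qpi_ker (kerS p) x).2).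
have [h hP] := quot_factor (S := kerS p) (f := p) (fun x px => px).
exists g, h => [x|y]; first by have [v <-] := pS x; rewrite gP hP.
by have [v <-] := qpi_surj y; rewrite hP gP.
Qed.

Lemma over_fac N (f : {linear N -> M}) : fin_gen N ->
  exists (z : over_obj) (a : {linear N -> over_mod z}), forall x, over_map z (a x) = f x.
Proof.
move=> /(@fac N f)[G [a [b [SG ab]]]].
have [n [T iso]] := fin_gen_quot (Sfg SG).
have ST := Siso iso SG; have [u [v uK vK]] := iso.
have vL : linear v by move=> r x y; apply: (can_inj uK); rewrite linearP !vK.
pose z0 : {z : {n : nat & submod ('rV[R]_n)} & {linear quotM (projT2 z) -> M}} :=
  existT _ (existT (fun n : nat => submod ('rV[R]_n)) n T) (hom_comp b (mklin vL)).
exists (exist _ z0 ST), (hom_comp u a) => x.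
by rewrite -[LHS]/(b (v (u (a x)))) uK ab.
Qed.

Lemma over_fin_gen z : fin_gen (over_mod z).
Proof. exact/Sfg/(svalP z). Qed.

(** The two arrows to M induce one on the sum of their sources, and that map
    vanishes on (x, - y). It therefore factors through the quotient of the sum
    by (x, - y), and then through a module of S. *)
Lemma over_bound z w (x : over_mod z) (y : over_mod w) : over_map z x = over_map w y ->
  exists t (a : over_arr z t) (b : over_arr w t), sval a x = sval b y.
Proof.
move=> xy; pose P : lmodType R := (over_mod z * over_mod w)%type.
pose f : hom P M := hadd (hom_comp (over_map z) (pfst _ _)) (hom_comp (over_map w) (psnd _ _)).
pose k : {linear 'rV[R]_1 -> P} := rowmap (fun=> (x, - y)).
have fxy : f (x, - y) = 0.
  by rewrite haddE !hcompE [X in _ + X]linearN xy; exact: subrr.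
have [h hP] : exists h : {linear cokM k -> M}, forall u, h (qpi _ u) = f u.
  apply: quot_factor => _ [u <-]; rewrite rowmapE linear_sum big1 // => j _.
  by rewrite linearZ fxy /= scaler0.
have fgC : fin_gen (cokM k).
  apply: (fin_gen_surj (p := qpi (imS k))); first exact: qpi_surj.
  by apply: fin_gen_pair => //; exact: over_fin_gen.
have [t [a aP]] := over_fac h fgC.
have a1 u : over_map t (hom_comp a (hom_comp (qpi _) (pin1 _ _)) u) = over_map z u.
  rewrite !hcompE aP hP haddE !hcompE [X in _ + X](linear0 (over_map w)); exact: addr0.
have a2 u : over_map t (hom_comp a (hom_comp (qpi _) (pin2 _ _)) u) = over_map w u.
  rewrite !hcompE aP hP haddE !hcompE [X in X + _](linear0 (over_map z)); exact: add0r.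
exists t, (mk_over a1), (mk_over a2).
rewrite -[LHS]/(a (qpi (imS k) (x, 0))) -[RHS]/(a (qpi (imS k) (0, y))).
congr (a _); apply/eqP; rewrite -subr_eq0 -linearB; apply/eqP/qpi_ker.
exists (delta_mx 0 0); rewrite rowmap_delta.
by congr (_, _); rewrite ?subr0 ?sub0r.
Qed.

Lemma over_filtering : filtering over_cat.
Proof.
split.
- by have [z _] := over_fac (0 : hom 'rV[R]_0 M) (fin_gen_row R 0); exists z.
- move=> z w; have [|t [a [b _]]] := @over_bound z w 0 0; first by rewrite !linear0.
  by exists t, a, b.
move=> z w a b.
have [h hP] : exists h : {linear cokM (hsub (sval a) (sval b)) -> M},
    forall u, h (qpi _ u) = over_map w u.
  apply: quot_factor => _ [x <-]; rewrite hsubE linearB.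
  by rewrite (svalP a) (svalP b) subrr.
have [|t [c cP]] := over_fac h.
  by apply: (fin_gen_surj (p := qpi _)); [exact: qpi_surj|exact: over_fin_gen].
have cq u : over_map t (hom_comp c (qpi _) u) = over_map w u by rewrite hcompE cP hP.
exists t, (mk_over cq); apply: over_arr_eq => x.
rewrite -[LHS]/(c (qpi _ (sval a x))) -[RHS]/(c (qpi _ (sval b x))).
congr (c _); apply/eqP; rewrite -subr_eq0 -linearB; apply/eqP/qpi_ker.
by exists x.
Qed.

Lemma over_fcolim : fcolim (F := over_fun) over_map.
Proof.
have sL (m : M) : linear (fun u : 'rV[R]_1 => u 0 0 *: m).
  by move=> a u v; rewrite !mxE scalerDl scalerA.
split=> [z w a x|m|z x zx]; first exact: (svalP a x).
  have [z [a aP]] := over_fac (mklin (sL m)) (fin_gen_row R 1).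
  by exists z, (a (delta_mx 0 0)); rewrite aP mklinE mxE !eqxx scale1r.
have [|t [a [b ab]]] := @over_bound z z x 0; first by rewrite zx linear0.
by exists t, a; have := ab; rewrite linear0.
Qed.

(** The canonical diagram of arrows to M from modules of S is filtered, and its
    colimit is M. *)
Lemma filtered_colimits_of : filtered_colimits S M.
Proof.
exists over_cat, over_fun, over_map; split.
- exact: over_filtering.
- by move=> z; exact: (svalP z).
- exact: (fcolim_colim over_filtering over_fcolim).
Qed.
End Criterion.

Section Syzygies.
Variable R : comPzRingType.
Implicit Types (M N P Q K L X Y Z A B C E F G H : lmodType R).

(** Injective dimension at most n, by means of cosyzygies. *)
Fixpoint inj_dim_le n M : Prop :=
  if n is n.+1 then exists E Q (i : {linear M -> E}) (p : {linear E -> Q}),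
    [/\ injective_module E, ses i p & inj_dim_le n Q]
  else injective_module M.
Fixpoint Syz n X : Prop :=
  if n is n.+1 then exists P Y (i : {linear X -> P}) (p : {linear P -> Y}),
    [/\ projective P, ses i p & Syz n Y]
  else True.
(** Ext^1 (X, M) = 0, in the form of the extension property for all short exact
    sequences ending in X. *)
Definition ext1_vanishes X M := forall K A (i : {linear K -> A}) (p : {linear A -> X}),
  ses i p -> forall f : {linear K -> M}, exists g : {linear A -> M}, forall x, g (i x) = f x.

Lemma ses0 A B C (i : {linear A -> B}) (p : {linear B -> C}) x : ses i p -> p (i x) = 0.
Proof. by move=> [_ ip _]; apply/ip; exists x. Qed.

Lemma SyzS n X : Syz n.+1 X -> Syz n X.
Proof.
elim: n X => [//|n IH] X [P [Y [i [p [Pp s Yn]]]]].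
by exists P, Y, i, p; split=> //; exact: IH.
Qed.

Lemma Syz_iso n X Y : isomorphic X Y -> Syz n X -> Syz n Y.
Proof.
case: n => [//|n] /isom_sym[f [g fK gK]] [P [Z [i [p [Pp [iI ip pS] Zn]]]]].
exists P, Z, (hom_comp i f), p; split=> //; split=> // [x fx|x].
  by rewrite -(fK x) (iI _ fx) -(fK 0) linear0.
rewrite ip; split=> -[y <-]; last by exists (f y).
by exists (g y); rewrite hcompE gK.
Qed.

(** Dimension shifting: an n-th syzygy X and a cosyzygy of M are treated
    simultaneously, so that neither a resolution nor a connecting map is
    needed. *)
Lemma inj_dim_ext1 n M X : inj_dim_le n M -> Syz n X -> ext1_vanishes X M.
Proof.
elim: n M X => [|n IH] M X /=.
  by move=> MI _ K A i p [/injmP iI _ _] f; exact: MI.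
move=> [E [Q [u [v [EI suv QI]]]]] [P [Y [s [t [Pp sst Yn]]]]] K A i p sip f.
have [[iI ip pS] [uI uv vS]] := (sip, suv).
have [g gP] := EI _ _ i (hom_comp u f) ((injmP i).1 iI).
have [|h hP] := factor_surj (p := p) (f := hom_comp v g) pS.
  by move=> x /ip[y <-]; rewrite hcompE gP hcompE (ses0 _ suv).
have [h1 h1P] := IH Q Y QI Yn _ _ _ _ sst h.
have [h2 h2P] := Pp _ _ v h1 vS.
have [|w wP] := factor_inj (i := u) (f := hsub g (hom_comp (hom_comp h2 s) p)) uI.
  by move=> x; apply/uv; rewrite hsubE linearB !hcompE h2P h1P hP subrr.
exists w => x; apply: (injmP u).1 uI _ _ _; rewrite wP hsubE gP !hcompE (ses0 _ sip).
by rewrite (linear0 s) (linear0 h2) subr0.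
Qed.

(** A syzygy in a projective resolution of an n-th syzygy is again an n-th
    syzygy. *)
Lemma Syz_Ext n M X : inj_dim_le n M -> Syz n X ->
  forall i, (0 < i)%N -> Ext_vanishes i X M.
Proof.
move=> MI Xn i i0 Y [Y1 Ypos Yproj] eY f fd.
have zY1 : isomorphic X (cyc Y 1).
  apply: isom_sym; have [u [v uK vK]] := Y1.
  exists (hom_comp u (cyc_in Y 1)).
  have z2 x : d Y 1 (1 + 1) x = 0 by apply: Ypos.
  have [c cP] := choice (fun x => cyc_lift (z2 x)).
  exists (fun x => c (v x)) => [z|x].
    by apply: (injmP _).1 (@cyc_inI _ Y 1) _ _ _; rewrite cP hcompE uK.
  by rewrite hcompE cP vK.
have SZ k : Syz n (cyc Y (1 - k%:Z)).
  elim: k => [|k IH]; first by rewrite subr0; exact: Syz_iso Xn.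
  apply: SyzS.
  have [|p [s _]] := @cyc_ses _ Y eY (1 - k.+1%:Z) (1 - k%:Z); first by lia.
  by exists (Y (1 - k.+1%:Z)), (cyc Y (1 - k%:Z)), (cyc_in Y _), p; split=> //; apply: Yproj; lia.
case: i i0 f fd => // i _ f fd.
have e1 : - i.+1%:Z + 1 = - i.+1%:Z + 1 by [].
have [p [[_ pk pS] pP]] := cyc_ses eY e1.
have [|f1 f1P] := factor_surj (p := p) (f := f) pS.
  move=> x px; have : d Y (- i.+1%:Z) (- i.+1%:Z + 1) x = 0 by rewrite -pP px linear0.
  by move=> /eY[y <-].
have e2 : 1 - i%:Z = - i.+1%:Z + 1 + 1 by lia.
have [q [sq qP]] := cyc_ses eY e2.
have [g gP] := inj_dim_ext1 MI (SZ i) sq f1.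
by exists g => x; rewrite -f1P -gP pP.
Qed.

Lemma projective_retract P Q (s : {linear Q -> P}) (r : {linear P -> Q}) :
  (forall x, r (s x) = x) -> projective P -> projective Q.
Proof.
move=> rs Pp A B p f pS; have [g gP] := Pp A B p (hom_comp f r) pS.
by exists (hom_comp g s) => x; rewrite hcompE gP hcompE rs.
Qed.

Lemma projective_pair P Q : projective P -> projective Q -> projective (P * Q)%type.
Proof.
move=> Pp Qp A B p f pS.
have [g gP] := Pp A B p (hom_comp f (pin1 _ _)) pS.
have [h hP] := Qp A B p (hom_comp f (pin2 _ _)) pS.
exists (hadd (hom_comp g (pfst _ _)) (hom_comp h (psnd _ _))) => -[x y].
by rewrite haddE !hcompE linearD gP hP !hcompE -linearD -pinE.
Qed.

Lemma dual_row n : exists (s : {linear dual ('rV[R]_n) -> 'rV[R]_n})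
  (r : {linear 'rV[R]_n -> dual ('rV[R]_n)}),
  (forall x, r (s x) = x) /\ forall x v, r x v = \sum_k v 0 k * x 0 k.
Proof.
have sL : linear ((fun f => \row_k f (delta_mx 0 k)) : hom 'rV[R]_n R^o -> 'rV[R]_n).
  by move=> a f g; apply/rowP => k; rewrite !mxE.
have [||r rP] := @mkbil R 'rV[R]_n 'rV[R]_n R^o (fun x v => \sum_k v 0 k * x 0 k).
- move=> x a u v; rewrite scaler_sumr -big_split; apply: eq_bigr => k _ /=.
  by rewrite !mxE mulrDl -mulrA.
- move=> v a x y; rewrite scaler_sumr -big_split; apply: eq_bigr => k _ /=.
  by rewrite !mxE mulrDr mulrCA.
exists (mklin sL), r; split=> // f; apply: homP => v; rewrite rP (row_mapE f).
by apply: eq_bigr => k _; rewrite mklinE mxE.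
Qed.

Lemma projective_dual_row n : projective (dual 'rV[R]_n).
Proof.
have [s [r [rs _]]] := dual_row n.
exact: (projective_retract rs (@row_projective R n)).
Qed.

Lemma biduality_linear M : linear (@biduality R M).
Proof.
move=> a x y; apply: homP => f.
by rewrite -[LHS]/((f : hom M R^o) _) linearP.
Qed.
Definition bid M : {linear M -> dual (dual M)} := mklin (@biduality_linear M).
Lemma bidE M x (f : dual M) : (bid M x : hom (dual M) R^o) f = (f : hom M R^o) x.
Proof. by []. Qed.

Hypothesis noethR : noetherian R.
Section Gorenstein.
Variables (n : nat) (Rn : inj_dim_le n R^o).

Lemma fg_ses X : fin_gen X -> Syz n X -> exists k K (i : {linear K -> 'rV[R]_k})
  (p : {linear 'rV[R]_k -> X}), [/\ ses i p, fin_gen K & Syz n K].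
Proof.
move=> [k [p pS]] Xn; have s := ses_ker pS.
exists k, (kerM p), (incl (kerS p)), p; split=> //.
  by apply: (fin_gen_sub noethR); exact: fin_gen_row.
by apply: SyzS; exists 'rV[R]_k, X, (incl (kerS p)), p; split=> //; exact: row_projective.
Qed.

(** The dual of a free resolution by finitely generated modules is exact, so
    that the dual of X is a syzygy of any order. *)
Lemma Syz_dual m X : fin_gen X -> Syz n X -> Syz m (dual X).
Proof.
elim: m X => [//|m IH] X Xfg Xn.
have [k [K [i [p [s Kfg Kn]]]]] := fg_ses Xfg Xn.
exists (dual 'rV[R]_k), (dual K), (precomp R^o p), (precomp R^o i); split.
- exact: projective_dual_row.
- exact: (ses_hom_ext (inj_dim_ext1 Rn Xn s) s).
- exact: IH.
Qed.

(** A map R^k -> X is onto, and Hom (-, R) is exact on its kernel sequence and on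
    the dual sequence: an element of the bidual lifts to the bidual of R^k, which
    is R^k. *)
Lemma bid_surj X : fin_gen X -> Syz n X -> surjm (bid X).
Proof.
move=> Xfg Xn y.
have [k [K [i [p [s Kfg Kn]]]]] := fg_ses Xfg Xn.
have sd := ses_hom_ext (inj_dim_ext1 Rn Xn s) s.
have [Y YP] := inj_dim_ext1 Rn (Syz_dual n Kfg Kn) sd y.
have [s' [r [rs rE]]] := dual_row k.
exists (p (\row_j Y (r (delta_mx 0 j)))); apply: homP => f.
rewrite bidE -YP -[precomp _ _ _]rs; set x := s' _.
have e : f (p (\row_j Y (r (delta_mx 0 j)))) = r x (\row_j Y (r (delta_mx 0 j))).
  by rewrite /x rs.
rewrite e rE {2}(row_sum_delta x) !linear_sum; apply: eq_bigr => j _.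
by rewrite !linearZ mxE [RHS]mulrC.
Qed.

(** With the notation of [bid_surj], an element l of R^k that is killed in the
    bidual of X comes from the bidual of K, and [bid_surj] for K applies. *)
Lemma bid_inj X : fin_gen X -> Syz n X -> injm (bid X).
Proof.
move=> Xfg Xn x x0.
have xf (f : dual X) : f x = 0 by rewrite -bidE x0.
have [k [K [i [p [s Kfg Kn]]]]] := fg_ses Xfg Xn.
have sd := ses_hom_ext (inj_dim_ext1 Rn Xn s) s; have [_ sdk sdS] := sd.
have [_ _ pS] := s; have [l lx] := pS x.
have [|y yP] := factor_surj (p := precomp R^o i) (f := bid _ l) sdS.
  move=> f /sdk[g <-]; rewrite bidE.
  by rewrite -[LHS]/(g (p l)) lx xf.
have [z zy] := bid_surj Kfg Kn y.
suff e : l = i z by rewrite -lx e (ses0 _ s).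
have [s' [r [rs rE]]] := dual_row k.
apply/rowP => j.
have E v : r (delta_mx 0 j) v = v 0 j.
  rewrite rE (bigD1 j) //= mxE !eqxx mulr1 big1 ?addr0 // => j' /negbTE jj.
  by rewrite mxE jj andbF mulr0.
rewrite -!E -[LHS]bidE -yP -zy bidE; by [].
Qed.

Lemma Syz_Gproj X : fin_gen X -> Syz n X -> Gproj X.
Proof.
move=> Xfg Xn; split=> //.
- have [g [gK Kg]] := bij_inv (bid_inj Xfg Xn) (bid_surj Xfg Xn).
  by exists g.
- exact: (Syz_Ext Rn Xn).
- exact: (Syz_Ext Rn (Syz_dual n Xfg Xn)).
Qed.
End Gorenstein.

(** Apply the equational criterion to the images of the generators and to the
    matrix of the relations. *)
Lemma lazard F N (f : {linear N -> F}) : eqflat F -> fin_pres N ->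
  exists k (a : {linear N -> 'rV[R]_k}) (b : {linear 'rV[R]_k -> F}), forall x, b (a x) = f x.
Proof.
move=> Ff [n [m [p [q [pS pq]]]]].
pose A : 'M[R]_(n, m) := \matrix_(i, j) q (delta_mx 0 j) 0 i.
have [|k [K [y [KA xK]]]] := Ff n m A (fun i => f (p (delta_mx 0 i))).
  apply: prodP => j; rewrite mxactE prod0E.
  under eq_bigr => i _ do rewrite mxE -!linearZ.
  rewrite -!linear_sum -row_sum_delta (pq _).2 ?linear0 //.
  by exists (delta_mx 0 j).
have mulL : linear (fun v : 'rV[R]_n => v *m K^T).
  by move=> a u v; rewrite mulmxDl scalemxAl.
have [|a aP] := factor_surj (p := p) (f := mklin mulL) pS.
  move=> v /pq[w <-].
  rewrite -[LHS]/(hom_comp (mklin mulL) q w) -[RHS]/((0 : hom 'rV[R]_m 'rV[R]_k) w).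
  apply: row_ext => j; rewrite hcompE mklinE hom0E.
  have -> : q (delta_mx 0 j) = (col j A)^T by apply/rowP => i; rewrite !mxE.
  by rewrite -trmx_mul !colE mulmxA KA mul0mx; apply/matrixP => a b; rewrite !mxE.
exists k, a, (rowmap y) => x; have [v <-] := pS x; rewrite aP mklinE.
rewrite -[LHS]/(hom_comp (rowmap y) (mklin mulL) v) -[RHS]/(hom_comp f p v).
apply: row_ext => i; rewrite !hcompE mklinE rowmapE.
rewrite -[RHS]/((fun i => f (p (delta_mx 0 i)) : F) i).
have := congr1 (fun z : vec F n => z i) xK => /= ->.
by apply: eq_bigr => l _; rewrite -rowE !mxE.
Qed.

(** Induction on n. Factor N -> Z^i -> X^i through R^k; the cokernel N' of
    N -> R^k maps to the next cycle module, hence factors through an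
    (n-1)-th syzygy H. With a cover R^m -> H, the kernel of R^m + R^k -> H is an
    n-th syzygy; it receives N and maps to Z^i. *)
Lemma cyc_factor_Syz (X : complex R) : exact X -> (forall i, eqflat (X i)) ->
  forall n i N (f : {linear N -> cyc X i}), fin_gen N ->
  exists G (a : {linear N -> G}) (b : {linear G -> cyc X i}),
    [/\ fin_gen G, Syz n G & forall x, b (a x) = f x].
Proof.
move=> eX Xf; elim=> [|n IH] i N f Nfg; first by exists N, (hom_id N), f.
have [q [[_ qk qS] qP]] := cyc_ses eX (erefl (i + 1)).
have [k [al [be bal]]] := lazard (hom_comp (cyc_in X i) f) (Xf i) (fin_gen_pres noethR Nfg).
have [|f' f'P] := quot_factor (S := imS al) (f := hom_comp q be).
  move=> _ [x <-]; rewrite hcompE bal hcompE; apply/qk; by exists (f x).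
have Cfg : fin_gen (cokM al).
  by apply: (fin_gen_surj (p := qpi (imS al))); [exact: qpi_surj|exact: fin_gen_row].
have [H [ga [de [Hfg HS Hf]]]] := IH (i + 1) _ f' Cfg.
have [m [p pS]] := Hfg.
have [ka kaP] := row_projective (hom_comp ga (qpi (imS al))) pS.
have [la laP] := row_projective (hom_comp de p) qS.
pose P : lmodType R := ('rV[R]_m * 'rV[R]_k)%type.
have pL : linear ((fun u => p u.1) : P -> H) by move=> r u v; rewrite linearP.
have pS' : surjm (mklin pL) by move=> y; have [x xy] := pS y; exists (x, 0).
(* the n-th syzygy is the kernel of R^m + R^k -> H, and a : N -> G, b : G -> Z^i
   are induced by the pairs (ka al, al) and (la, si) *)
have aL : linear ((fun x => (ka (al x), al x)) : N -> P) by move=> r u v; rewrite !linearP.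
have [|a aP] := incl_factor (S := kerS (mklin pL)) (f := mklin aL).
  move=> x; rewrite /= kaP hcompE (qpi_ker _ _).2 ?linear0 //; by exists x.
have [|si siP] := factor_inj (i := cyc_in X i) (f := hsub be (hom_comp la ka)) (@cyc_inI _ X i).
  move=> v; apply/qk; rewrite hsubE linearB [X in _ - X]laP !hcompE kaP hcompE Hf f'P hcompE.
  by rewrite subrr.
have lL : linear ((fun u => la u.1 + cyc_in X i (si u.2)) : P -> X i).
  by move=> r u v; rewrite !linearP scalerDr addrACA.
have [|b bP] := factor_inj (i := cyc_in X i)
    (f := hom_comp (mklin lL) (incl (kerS (mklin pL)))) (@cyc_inI _ X i).
  move=> z; apply/qk; have pz := inclP z.
  rewrite hcompE mklinE linearD laP hcompE.
  have -> : p (incl _ z).1 = 0 by exact: pz.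
  rewrite linear0 add0r; apply/qk; by eexists.
exists (kerM (mklin pL)), a, b; split.
- apply: (fin_gen_sub noethR); apply: fin_gen_pair; exact: fin_gen_row.
- exists P, H, (incl (kerS (mklin pL))), (mklin pL); split=> //; last exact: ses_ker.
  by apply: projective_pair; exact: row_projective.
move=> x; apply: (injmP _).1 (@cyc_inI _ X i) _ _ _.
by rewrite bP hcompE aP (mklinE lL) (mklinE aL) siP hsubE hcompE addrC subrK bal.
Qed.

Lemma fin_inj_dim_le : finite_injective_dimension (R^o : lmodType R) -> exists n, inj_dim_le n R^o.
Proof.
move=> [n [Y [eY iso Yneg Yinj Ypos]]].
have H m i : 0 <= i -> n%:Z < i + m%:Z -> inj_dim_le m (cyc Y i).
  elim: m i => [|m IH] i i0 ni.
    move=> A B u f uI; exists (0 : hom B (cyc Y i)) => x; rewrite hom0E.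
    apply: (injmP _).1 (@cyc_inI _ Y i) _ _ _; rewrite linear0.
    by rewrite [RHS]Ypos //; lia.
  have [p [s _]] := cyc_ses eY (erefl (i + 1)).
  exists (Y i), (cyc Y (i + 1)), (cyc_in Y i), p; split=> //; first exact: Yinj.
  by apply: IH; lia.
have /isom_sym[f [g fK gK]] := iso.
have [p [[_ pk pS] _]] := cyc_ses eY (erefl (0 + 1 : int)).
exists n.+1, (Y 0), (cyc Y 1), (hom_comp (d Y (-1) 0) f), p; split.
- exact: Yinj.
- split=> [x dx|x|//].
    have [y yx] := (exactP Y).1 eY (-2) (-1) 0 erefl erefl _ dx.
    have y0 : y = 0 by apply: Yneg.
    by move: yx; rewrite y0 linear0 => /esym fx; rewrite -(fK x) fx -(fK 0) linear0.
  split=> [/pk[z <-]|[y <-]].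
    have [y yz] := (exactP Y).1 eY (-1) 0 1 erefl erefl _ (cycP z).
    by exists (g y); rewrite hcompE gK.
  by apply/pk; apply: cyc_lift; exact: d_comp.
by apply: H; lia.
Qed.

Lemma Gorenstein_GFlat_colim M : finite_injective_dimension (R^o : lmodType R) ->
  GFlat M -> filtered_colimits (@Gproj R) M.
Proof.
move=> /fin_inj_dim_le[n Rn] [F [eF Ff _ [i [k [kI kP]]]]].
have Ffe j : eqflat (F j) by apply: flatI_eqflat => //; apply: flat_flatI.
have [|u uP] := @cyc_factor R F i M k; first by move=> x; apply/kP; exists x.
have uS : surjm u.
  move=> z; have /kP[x xz] := cycP z; exists x.
  by apply: (injmP _).1 (@cyc_inI _ F i) _ _ _; rewrite uP.
have uI : injm u by move=> x ux; apply: kI; rewrite -uP ux !linear0.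
have [v [uK vK]] := bij_inv uI uS.
have := @filtered_colimits_of R (fun G => fin_gen G /\ Syz n G) M.
case.
- by move=> G [].
- move=> G H GH [Gfg GS]; split; last exact: Syz_iso GS.
  have [w [w' wK w'K]] := GH.
  by apply: (fin_gen_surj (p := w)) Gfg => y; exists (w' y).
- move=> N f Nfg.
  have [G [a [b [Gfg GS ab]]]] := cyc_factor_Syz eF Ffe n (hom_comp u f) Nfg.
  by exists G, a, (hom_comp v b); split=> // x; rewrite hcompE ab hcompE uK.
move=> I [Fu [c [fI FS cP]]]; exists I, Fu, c; split=> // j.
by have [Gfg GS] := FS j; exact: (Syz_Gproj Rn Gfg GS).
Qed.
End Syzygies.

(** * Filtered colimits as Gorenstein flat modules *)

Section Splice.
Variables (R : comPzRingType) (Z F : int -> lmodType R).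
Variables (e : forall i, {linear Z i -> F i}) (p : forall i, {linear F i -> Z (i + 1)}).
Hypothesis s : forall i, ses (e i) (p i).
Lemma splice2 i x : hom_comp (e (i + 1 + 1)) (p (i + 1)) (hom_comp (e (i + 1)) (p i) x) = 0.
Proof. by rewrite !hcompE (ses0 _ (s (i + 1))) linear0. Qed.
Definition splice : complex R := mkc splice2.
Lemma spliceE i j : j = i + 1 -> exists q : {linear F i -> Z j},
  ses (e i) q /\ forall x, d splice i j x = e j (q x).
Proof. by move=> ->; exists (p i); split=> // x; rewrite mkcE. Qed.
Lemma splice_exact : exact splice.
Proof.
apply/exactP => i j k ij jk x.
have [q [[_ _ qS] qP]] := spliceE ij; have [r [sr rP]] := spliceE jk.
have [eI _ _] := s k; rewrite rP => /eI rx.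
have [_ er _] := sr; have [z zx] := (er x).1 rx; have [y yz] := qS z.
by exists y; rewrite qP yz.
Qed.
Lemma splice_ker i y : d splice i (i + 1) y = 0 <-> exists x, e i x = y.
Proof.
have [q [[_ eq _] qP]] := spliceE (erefl (i + 1)); rewrite qP -eq.
split=> [|->]; last by rewrite linear0.
by have [eI _ _] := s (i + 1); exact: eI.
Qed.
End Splice.

Section Reindex.
Variables (R : comPzRingType) (X : complex R) (c : int).
Definition reindex : complex R.
Proof.
exists (fun i => X (i + c)) (fun i j => d X (i + c) (j + c)) => [i j ij|i j k x].
  by apply: d_shape; rewrite addrAC (inj_eq (addIr _)).
exact: d_comp.
Defined.
Lemma reindex_exact : exact X -> exact reindex.
Proof.
move=> /exactP eX; apply/exactP => i j k -> ->.
by apply: (eX (i + c) (i + 1 + c) (i + 1 + 1 + c)); rewrite addrAC.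
Qed.
End Reindex.

Section FreeRes.
Variable R : comPzRingType.
Implicit Types (M N P A B : lmodType R).

Definition Omega N : lmodType R := kerM (freecov N).
Definition omega_in N : {linear Omega N -> Free R N} := incl (kerS (freecov N)).
Lemma omega_ses N : ses (omega_in N) (freecov N).
Proof. exact: (ses_ker (@freecov_surj R N)). Qed.

Record stage := Stage { sZ : lmodType R; sY : lmodType R; se : {linear sZ -> sY} }.
Definition stage0 N := Stage (hom_id N).
Definition stageL (t : stage) := Stage (omega_in (sZ t)).
Definition stageR (t : stage) := stage0 'rV[R]_0.
Definition extR (t : stage) := forall f : {linear sZ t -> R^o},
  exists g : {linear sY t -> R^o}, forall x, g (se t x) = f x.
(** The free resolution of N by the modules Free, functorial in N, has an exact
    dual. *)
Definition cacyc N := forall k, extR (iter k.+1 stageL (stage0 N)).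

Lemma cacyc1 N (f : {linear Omega N -> R^o}) : cacyc N ->
  exists g : {linear Free R N -> R^o}, forall x, g (omega_in N x) = f x.
Proof. by move=> /(_ 0%N f). Qed.
Lemma cacyc_Omega N : cacyc N -> cacyc (Omega N).
Proof. by move=> Nc k; move: (Nc k.+1); rewrite !iterSr. Qed.

(** The free resolution, augmented by N, is one of the projective resolutions
    that may be used to compute Ext. *)
Lemma Ext_cacyc N : (forall i, (0 < i)%N -> Ext_vanishes i N R^o) -> cacyc N.
Proof.
move=> EN k; pose z := zseq (stage0 N) stageR stageL.
have zP i : exists p : {linear sY (z i) -> sZ (z (i + 1))}, ses (se (z i)) p.
  have id_ses M : ses (hom_id M) (0 : hom M 'rV[R]_0).
    split=> // [x|y]; first by split=> // _; exists x.
    by exists 0; rewrite linear0 (zero_row0 y).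
  apply: (@zseqP _ _ _ _ (fun i t u => exists p : {linear sY t -> sZ u}, ses (se t) p)).
    by case=> [|n]; exists (0 : hom _ 'rV[R]_0); exact: id_ses.
  by move=> n; exists (freecov _); exact: omega_ses.
pose p i := sval (cid (zP i)).
have s i : ses (se (z i)) (p i) := svalP (cid (zP i)).
pose Y := reindex (splice s) (-1).
have zneg i : i <= 0 -> exists n, i - 1 = Negz n.
  by case: i => [[|n]|n] // _; [exists 0%N|exists n.+1]; lia.
have Yaug : left_augmented (@projective R) N Y.
  split.
  - by exists (hom_id N), (hom_id N).
  - move=> i i1; have [n e] : exists n : nat, i - 1 = Posz n.+1.
      by case: i i1 => [[|[|n]]|n] // _; exists n; lia.
    by rewrite /Y /= e /=; exact: zero_row0.
  - move=> i /zneg[n e]; rewrite /Y /= e; exact: free_projective.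
have eY : exact Y by apply/reindex_exact/splice_exact.
have e : - k.+1%:Z + 1 - 1 = Negz k by lia.
suff : extR (z (- k.+1%:Z + 1 - 1)) by rewrite e.
move=> f0.
have jE : - k.+1%:Z + 1 - 1 = - k.+1%:Z - 1 + 1 by lia.
have [q [[_ _ qS] qP]] := spliceE s jE.
have [|g gP] := EN k.+1 isT Y Yaug eY (hom_comp f0 q).
  move=> x; have iE : - k.+1%:Z - 1 = - k.+1%:Z - 1 - 1 + 1 by lia.
  have [r [_ rP]] := spliceE s iE.
  have [q' [sq' q'P]] := spliceE s jE.
  rewrite -[d Y _ _ x]/(d (splice s) (- k.+1%:Z - 1 - 1) (- k.+1%:Z - 1) x) rP hcompE.
  suff -> : q (se (z (- k.+1%:Z - 1)) (r x)) = 0 by rewrite linear0.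
  have [I2 _ _] := s (- k.+1%:Z + 1 - 1); apply: I2.
  by rewrite -qP q'P (ses0 _ sq') linear0.
exists g => x; have [y <-] := qS x.
by rewrite -qP -[RHS]/(hom_comp f0 q y) gP.
Qed.

Lemma Fmap_ex M N (f : hom M N) : exists u : {linear Free R M -> Free R N},
  forall x, u (fbase R x) = fbase R (f x).
Proof. exact: free_univ. Qed.
Definition Fmap M N (f : hom M N) : hom (Free R M) (Free R N) := sval (cid (Fmap_ex f)).
Lemma FmapE M N (f : hom M N) x : Fmap f (fbase R x) = fbase R (f x).
Proof. exact: (svalP (cid (Fmap_ex f)) x). Qed.
Lemma Fmap1 M : Fmap (hom_id M) = hom_id _.
Proof. by apply: homP; apply: free_ext => x; rewrite FmapE. Qed.
Lemma FmapM M N P (g : hom N P) (f : hom M N) :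
  Fmap (hom_comp g f) = hom_comp (Fmap g) (Fmap f).
Proof. by apply: homP; apply: free_ext => x; rewrite FmapE !hcompE !FmapE. Qed.
Lemma Fmap_nat M N (f : hom M N) x : freecov N (Fmap f x) = f (freecov M x).
Proof.
rewrite -[LHS]/(hom_comp (freecov N) (Fmap f) x) -[RHS]/(hom_comp f (freecov M) x).
by apply: free_ext => y; rewrite !hcompE FmapE !freecovE.
Qed.
Lemma Omap_ex M N (f : hom M N) : exists u : {linear Omega M -> Omega N},
  forall x, omega_in N (u x) = Fmap f (omega_in M x).
Proof.
have [|u uP] := incl_factor (S := kerS (freecov N)) (f := hom_comp (Fmap f) (omega_in M)).
  by move=> x; rewrite /= Fmap_nat (ses0 _ (omega_ses M)) linear0.
by exists u.
Qed.
Definition Omap M N (f : hom M N) : hom (Omega M) (Omega N) := sval (cid (Omap_ex f)).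
Lemma OmapE M N (f : hom M N) x : omega_in N (Omap f x) = Fmap f (omega_in M x).
Proof. exact: (svalP (cid (Omap_ex f)) x). Qed.
Lemma omega_inj M x y : omega_in M x = omega_in M y -> x = y.
Proof. by apply: (injmP _).1; exact: incl_inj. Qed.
Lemma Omap1 M : Omap (hom_id M) = hom_id _.
Proof. by apply: homP => x; apply: omega_inj; rewrite OmapE Fmap1. Qed.
Lemma OmapM M N P (g : hom N P) (f : hom M N) :
  Omap (hom_comp g f) = hom_comp (Omap g) (Omap f).
Proof. by apply: homP => x; apply: omega_inj; rewrite OmapE FmapM !hcompE !OmapE. Qed.

(** Contravariant functors to modules. If the G_i form a filtered system, their
    duals form such a functor, and so do the free resolutions of the duals. *)
Record cofunctor (I : small_category) := Cofunctor {
  kobj :> I -> lmodType R;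
  kmap : forall i j, sarr i j -> hom (kobj j) (kobj i);
  kmap1 : forall i, kmap (sid i) = hom_id (kobj i);
  kmapM : forall i j k (b : sarr j k) (a : sarr i j),
    kmap (scomp b a) = hom_comp (kmap a) (kmap b) }.

Section Cof.
Variables (I : small_category) (K : cofunctor I).
Definition dualF : functor I (Mod R).
Proof.
exists (fun i => dual (K i) : Mod R) (fun i j a => precomp R^o (kmap K a) : hom _ _).
- by move=> i; apply: homP => f; apply: homP => x; rewrite kmap1.
- by move=> i j k b a; apply: homP => f; apply: homP => x; rewrite kmapM.
Defined.
Definition freeK : cofunctor I.
Proof.
exists (fun i => Free R (K i)) (fun i j a => Fmap (kmap K a)).
- by move=> i; rewrite kmap1 Fmap1.
- by move=> i j k b a; rewrite kmapM FmapM.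
Defined.
Definition omegaK : cofunctor I.
Proof.
exists (fun i => Omega (K i)) (fun i j a => Omap (kmap K a)).
- by move=> i; rewrite kmap1 Omap1.
- by move=> i j k b a; rewrite kmapM OmapM.
Defined.
End Cof.

(** Modules of this form include the filtered colimits of Gorenstein projectives
    ([Gproj_colim_dual]) and have coresolutions by flats ([colim_dual_step]). *)
Definition colim_dual M := exists (I : small_category) (K : cofunctor I)
  (c : forall i, {linear dualF K i -> M}),
  [/\ filtering I, forall i, cacyc (K i) & fcolim (F := dualF K) c].

Hypothesis noethR : noetherian R.

(** The colimit of the exact sequences 0 -> K* -> Free (K)* -> Omega (K)* -> 0.
    The middle term is flat, being a filtered colimit of products of copies of
    R, and the last one is of the same form as M. *)
Lemma colim_dual_step M : colim_dual M -> exists (F M' : lmodType R) (i : {linear M -> F})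
  (p : {linear F -> M'}), [/\ eqflat F, ses i p & colim_dual M'].
Proof.
move=> [I [K [c [fI Kc cP]]]].
pose FF := dualF (freeK K); pose FO := dualF (omegaK K).
have [gC gS g0] := colimP fI FF; have [hC hS h0] := colimP fI FO.
have [cC cS c0] := cP.
have [|i iP] := fcolim_map fI cP
    (f := fun i => hom_comp (colim_in fI FF i) (precomp R^o (freecov (K i)))).
  move=> i j a x; rewrite !hcompE -(gC _ _ a); congr (colim_in _ _ _ _).
  by apply: homP => y; rewrite /= Fmap_nat.
have [|p pP] := fcolim_map fI (colimP fI FF)
    (f := fun i => hom_comp (colim_in fI FO i) (precomp R^o (omega_in (K i)))).
  move=> k j a x; rewrite !hcompE -(hC _ _ a); congr (colim_in _ _ _ _).
  apply: homP => y; rewrite -[RHS]/(x (omega_in (K k) (Omap (kmap K a) y))) OmapE.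
  by [].
exists (colim fI FF), (colim fI FO), i, p; split.
- apply: (eqflat_fcolim fI (colimP fI FF)) => k; exact: eqflat_dual_free.
- split=> [m|y|y].
  + have [k [x <-]] := cS m; rewrite iP hcompE => /g0[j [a ax]].
    rewrite -(cC _ _ a) -[RHS](linear0 (c j)); congr (c j _).
    apply: homP => y; have [z <-] := freecov_surj y.
    have := congr1 (fun h : hom (Free R (K j)) R^o => h z) ax.
    by rewrite /= Fmap_nat.
  + split=> [|[m <-]].
      have [k [x <-]] := gS y; rewrite pP hcompE => /h0[j [a ax]].
      have [|z zP] := factor_surj (p := freecov (K j)) (f := fm FF a x) (@freecov_surj R _).
        move=> t t0; have [u <-] := (let: And3 _ e _ := omega_ses (K j) in (e t).1 t0).
        have := congr1 (fun h : hom (Omega (K j)) R^o => h u) ax.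
        by rewrite -[X in X = _]/(x (omega_in (K k) (Omap (kmap K a) u))) OmapE.
      exists (c j z); rewrite iP hcompE -(gC _ _ a); congr (colim_in _ _ _ _).
      by apply: homP => t; rewrite /= zP.
    have [k [x <-]] := cS m; rewrite iP hcompE pP hcompE -[RHS](linear0 (colim_in fI FO k)).
    congr (colim_in _ _ _ _); apply: homP => t.
    by rewrite /= (ses0 _ (omega_ses _)) linear0.
  have [k [x <-]] := hS y; have [g gP] := cacyc1 x (Kc k).
  exists (colim_in fI FF k g); rewrite pP hcompE; congr (colim_in _ _ _ _).
  exact: homP.
exists I, (omegaK K), (colim_in fI FO); split; first exact: fI.
  by move=> k; exact/cacyc_Omega/Kc.
exact: (colimP fI FO).
Qed.

Definition bidualK (I : small_category) (F : functor I (Mod R)) : cofunctor I.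
Proof.
exists (fun i => dual (F i)) (fun i j a => precomp R^o (fm F a)).
- by move=> i; apply: homP => f; apply: homP => x; rewrite /= fm1.
- by move=> i j k b a; apply: homP => f; apply: homP => x; rewrite /= fmM.
Defined.

(** A Gorenstein projective module is the dual of its dual, and Ext^i (-, R)
    vanishes on that dual. *)
Lemma Gproj_colim_dual M : filtered_colimits (@Gproj R) M -> colim_dual M.
Proof.
move=> [I [F [c [fI FG /(colim_fcolim fI)cP]]]].
have [cC cS c0] := cP.
pose K := bidualK F.
have bK i : exists b : {linear dual (dual (F i)) -> F i},
    (forall x, b (bid (F i) x) = x) /\ (forall x, bid (F i) (b x) = x).
  have [_ [b bK Kb] _ _] := FG i.
  have bL : linear b by move=> r x y; apply: (can_inj bK); rewrite Kb biduality_linear !Kb.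
  by exists (mklin bL).
pose b i := sval (cid (bK i)).
have b1 i x : b i (bid (F i) x) = x := (svalP (cid (bK i))).1 x.
have b2 i x : bid (F i) (b i x) = x := (svalP (cid (bK i))).2 x.
have nat i j (a : sarr i j) x : fm (dualF K) a (bid (F i) x) = bid (F j) (fm F a x).
  by apply: homP.
exists I, K, (fun i => hom_comp (c i) (b i)); split=> //.
  by move=> i; apply: Ext_cacyc; have [] := FG i.
split=> [i j a x|m|i x].
- by rewrite -[x in fm _ _ x]b2 !hcompE nat b1 cC.
- by have [i [x <-]] := cS m; exists i, (bid (F i) x); rewrite hcompE b1.
rewrite hcompE => /c0[j [a ax]]; exists j, a.
by rewrite -[x]b2 nat ax linear0.
Qed.

Inductive flat_coresolved : lmodType R -> Prop :=
| coresolved_colim M of colim_dual M : flat_coresolved M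
| coresolved_syz M N P (i : {linear M -> N}) (p : {linear N -> P}) of
    ses i p & eqflat N & flat_coresolved P : flat_coresolved M.

Lemma coresolved_step M : flat_coresolved M -> exists (F M' : lmodType R) (i : {linear M -> F})
  (p : {linear F -> M'}), [/\ eqflat F, ses i p & flat_coresolved M'].
Proof.
case=> {M}[M|M N P i p s Nf Pc]; last by exists N, P, i, p.
move=> /colim_dual_step[F [M' [i [p [Ff s M'c]]]]]; exists F, M', i, p.
by split=> //; exact: coresolved_colim.
Qed.

(** Coresolve by flats to the right, and take free covers to the left. *)
Lemma coresolved_exact M : flat_coresolved M -> exists X : complex R,
  [/\ exact X, forall i, eqflat (X i) & exists k : {linear M -> X 0}, injective k /\
    forall y, d X 0 (0 + 1) y = 0 <-> exists x, k x = y].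
Proof.
move=> Mc; pose T := {N : lmodType R | flat_coresolved N}.
pose rel (t u : T) := exists (F : lmodType R) (i : {linear sval t -> F}) (p : {linear F -> sval u}),
  eqflat F /\ ses i p.
have rightP (t : T) : exists u, rel t u.
  have [F [M' [i [p [Ff s M'c]]]]] := coresolved_step (svalP t).
  by exists (exist _ M' M'c), F, i, p.
have leftP (t : T) : exists u, rel u t.
  have s := omega_ses (sval t).
  have Ff : eqflat (Free R (sval t)).
    by apply: flatI_eqflat => //; apply: projective_flatI; exact: free_projective.
  by exists (exist _ _ (coresolved_syz s Ff (svalP t))), (Free R (sval t)), (omega_in _), (freecov _).
have [next nP] := choice rightP; have [prev pP] := choice leftP.
pose z := zseq (exist _ M Mc : T) next prev.
have zP i : rel (z i) (z (i + 1)).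
  by apply: (@zseqP _ _ _ _ (fun _ => rel)) => n; [exact: nP|exact: pP].
pose F i := sval (cid (zP i)).
pose e i := sval (cid (svalP (cid (zP i)))).
pose p i := sval (cid (svalP (cid (svalP (cid (zP i)))))).
have H i : eqflat (F i) /\ ses (e i) (p i) := svalP (cid (svalP (cid (svalP (cid (zP i)))))).
have s i : ses (e i) (p i) := (H i).2.
exists (splice s); split; first exact: splice_exact.
  by move=> i; exact: (H i).1.
exists (e 0); split; last by move=> y; exact: (splice_ker y).
by apply/injmP; have [] := s 0.
Qed.

Lemma Gorenstein_colim_GFlat M : finite_injective_dimension (R^o : lmodType R) ->
  filtered_colimits (@Gproj R) M -> GFlat M.
Proof.
move=> /fin_inj_dim_thick tR /Gproj_colim_dual Mc.
have [X [eX Xf [k [kI kP]]]] := coresolved_exact (coresolved_colim Mc).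
have Xi i : flatI (X i) by exact: eqflat_flatI.
exists X; split=> //; last by exists 0, k.
- by move=> i; apply: flatI_flat.
- by move=> J JI; apply: bal_tensor_exact; exact: (bal_thick_inj noethR).
Qed.
End FreeRes.

(** * A resolution of a dualizing complex *)

Section Resolution.
Variables (R : comPzRingType) (D : complex R) (N : nat).
Hypothesis noethR : noetherian R.
Hypothesis D0 : forall i, (N < `|i|)%N -> zero_module (D i).
Hypothesis Dfg : forall i, fin_gen_cohomology D i.

Let kk (n : nat) : int := N%:Z - n%:Z.
(* [kk n] is the degree, in D, of stage n; from stage [n0] on this degree is
   less than - N, and D vanishes there *)
Let n0 : nat := N.*2.+1.

(** The resolution is constructed degree by degree, from the right. At stage n
    the cone of the part constructed so far ends, on the left, in the map [stD]
    defined on A + D^(N-n), where A is the last module constructed. By [stE],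
    the cocycles of D in that degree are the cycles of the form (0, x). *)
Record state (n : nat) := State {
  stA : lmodType R; stS : lmodType R;
  stD : {linear (stA * D (kk n))%type -> stS};
  stF : fin_gen stA;
  stE : forall x, stD (0, x) = 0 <-> d D (kk n) (kk n + 1) x = 0 }.

(** [th] is the next piece of the resolution: it covers the cycles of the cone
    modulo the boundaries of D, by a projective module as long as n < n0, and by
    the module of cycles itself afterwards. *)
Definition good n (s : state n) (A' : lmodType R)
    (th : {linear A' -> (stA s * D (kk n))%type}) :=
  [/\ fin_gen A', forall a, stD s (th a) = 0,
      forall a x, stD s (a, x) = 0 -> exists a' x', th a' + (0, d D (kk n.+1) (kk n) x') = (a, x),
      (n < n0)%N -> projective A' & (n0 <= n)%N -> injm th].

(** Cycles (a, x) are generated, up to boundaries of D, by lifts of generators of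
    the possible a, and by representatives of generators of the cohomology
    of D. For n at least n0 the complex D vanishes in the relevant degree, and the
    cycles form a finitely generated module. *)
Lemma good_ex n (s : state n) : exists (A' : lmodType R) (th : {linear A' -> (stA s * D (kk n))%type}),
  good th.
Proof.
have [n0n|nn0] := leqP n0 n.
  have Dn : zero_module (D (kk n)) by apply: D0; rewrite /kk /n0 in n0n *; lia.
  exists (kerM (stD s)), (incl (kerS (stD s))); split=> //.
  - apply: (fin_gen_sub noethR); apply: fin_gen_pair; first exact: stF.
    by exists 0%N, (0 : hom 'rV[R]_0 (D (kk n))) => x; exists 0; rewrite linear0 (Dn x).
  - by move=> a; exact: (inclP a).
  - move=> a x ax; have [z zE] := @incl_lift _ _ (kerS (stD s)) (a, x) ax.
    exists z, 0; rewrite zE linear0; congr (_, _); exact: addr0.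
  - by rewrite ltnNge n0n.
  - by move=> _; exact: incl_inj.
pose Z := kerS (stD s).
have [m [g [gZ gG]]] := fin_gen_noeth noethR (stF s) (imgS (pfst _ _) Z).
have uex k : exists u : (stA s * D (kk n))%type, stD s u = 0 /\ u.1 = g k.
  by have [u Zu ug] := gZ k; exists u.
have [u uP] := choice uex.
have [p [z [zc zG]]] := Dfg (kk n).
pose th := rowmap (fun k : 'I_(m + p) => match split k with
  | inl i => u i | inr j => (0, z j) : (stA s * D (kk n))%type end).
have thE v w : th (row_mx v w) = rowmap u v + pin2 _ _ (rowmap z w).
  rewrite /th rowmapE big_split_ord; congr (_ + _).
    by apply: eq_bigr => i _; rewrite row_mxEl (unsplitK (inl _ i)).
  rewrite rowmapE linear_sum; apply: eq_bigr => i _.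
  by rewrite row_mxEr (unsplitK (inr _ i)) linearZ.
exists 'rV[R]_(m + p), th; split.
- exact: fin_gen_row.
- move=> v; rewrite -[LHS]/(hom_comp (stD s) th v) -[RHS]/((0 : hom _ (stS s)) v).
  apply: row_ext => k; rewrite hcompE rowmap_delta hom0E.
  case: (split k) => [i|j]; first by have [] := uP i.
  by apply/stE; exact: zc.
- move=> a x ax; have [|v va] := gG a; first by exists (a, x).
  have [y yE] : exists y, (a, x) = rowmap u v + (0, y).
    exists (x - (rowmap u v).2); rewrite [rowmap u v]surjective_pairing.
    congr (_, _); last by rewrite /= addrC subrK.
    rewrite /= addr0 -va !rowmapE -[RHS]/(pfst _ _ _) linear_sum.
    by apply: eq_bigr => k _; rewrite linearZ /= (uP k).2.
  have : stD s (0, y) = 0.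
    have : stD s (a, x) = 0 by [].
    rewrite yE linearD; have -> : stD s (rowmap u v) = 0; last by rewrite add0r.
    rewrite rowmapE linear_sum big1 // => k _; by rewrite linearZ (uP k).1 /= scaler0.
  move=> /stE/zG[c [y' yc]].
  have kk1 : kk n - 1 = kk n.+1 by rewrite /kk; lia.
  move: y' yc; rewrite kk1 => y' yc.
  exists (row_mx v (\row_k c k)), y'; rewrite thE yE -addrA; congr (_ + _).
  rewrite yc rowmapE -[LHS]/(_ + _, _ + _) /= addr0; congr (_, _ + _).
  by apply: eq_bigr => k _; rewrite mxE.
- by move=> _; exact: row_projective.
- by rewrite leqNgt nn0.
Qed.

Definition nextA n (s : state n) : lmodType R := sval (cid (good_ex s)).
Definition nextT n (s : state n) : {linear nextA s -> (stA s * D (kk n))%type} :=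
  sval (cid (svalP (cid (good_ex s)))).
Lemma nextP n (s : state n) : good (nextT s).
Proof. exact: svalP (cid (svalP (cid (good_ex s)))). Qed.
Definition nextD n (s : state n) :
  {linear (nextA s * D (kk n.+1))%type -> (stA s * D (kk n))%type} :=
  hadd (hom_comp (nextT s) (pfst _ _))
    (hom_comp (pin2 _ _) (hom_comp (d D (kk n.+1) (kk n)) (psnd _ _))).
Lemma nextDE n (s : state n) a x :
  nextD s (a, x) = nextT s a + (0, d D (kk n.+1) (kk n) x).
Proof. by []. Qed.
Lemma next_stE n (s : state n) x :
  nextD s (0, x) = 0 <-> d D (kk n.+1) (kk n.+1 + 1) x = 0.
Proof.
have -> : kk n.+1 + 1 = kk n by rewrite /kk; lia.
rewrite nextDE linear0 add0r; split=> [|->//].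
by move=> /(congr1 snd).
Qed.
Definition next n (s : state n) : state n.+1 :=
  @State n.+1 (nextA s) (stA s * D (kk n))%type (nextD s)
    (let: And5 f _ _ _ _ := nextP s in f) (next_stE s).
Lemma state0P x : (0 : hom ('rV[R]_0 * D (kk 0))%type 'rV[R]_0) (0, x) = 0 <->
  d D (kk 0) (kk 0 + 1) x = 0.
Proof.
split=> // _; have D1 : zero_module (D (kk 0 + 1)) by apply: D0; rewrite /kk; lia.
exact: D1.
Qed.
Definition state0 : state 0 :=
  @State 0 'rV[R]_0 'rV[R]_0 (0 : hom ('rV[R]_0 * D (kk 0))%type 'rV[R]_0) (fin_gen_row R 0) state0P.
Fixpoint st n : state n := if n is n.+1 then next (st n) else state0.

Definition rA n : lmodType R := stA (st n).
Definition rT n : {linear rA n.+1 -> (rA n * D (kk n))%type} := nextT (st n).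
Definition rd n : {linear rA n.+1 -> rA n} := hom_comp (pfst _ _) (rT n).
Definition rq n : {linear rA n.+1 -> D (kk n)} := hom_comp (psnd _ _) (rT n).

Lemma rA_fg n : fin_gen (rA n).
Proof. exact: stF. Qed.
Lemma rA_proj n : (n <= n0)%N -> projective (rA n).
Proof.
case: n => [|n] nn0; first exact: row_projective.
by have [_ _ _ P _] := nextP (st n); exact: P.
Qed.
Lemma rTE n a : rT n a = (rd n a, rq n a).
Proof. by rewrite [LHS]surjective_pairing. Qed.
Lemma rA_zero n : (n0.+1 < n)%N -> zero_module (rA n).
Proof.
case: n => [//|[//|n]]; rewrite !ltnS => nn0 a.
have [_ c _ _ I] := nextP (st n.+1); have [_ _ _ _ I'] := nextP (st n).
have Dn : zero_module (D (kk n.+1)) by apply: D0; rewrite /kk /n0 in nn0 *; lia.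
apply: I; first exact: leqW.
have := c a; rewrite -[nextT _]/(rT n.+1) rTE (Dn (rq n.+1 a)).
rewrite -[LHS]/(rT n (rd n.+1 a) + (0, d D (kk n.+1) (kk n) 0)) linear0.
rewrite [X in _ + X](_ : _ = 0) // addr0 => e.
by congr (_, _); exact: (I' nn0).
Qed.
Lemma rd2 n a : rd n (rd n.+1 a) = 0.
Proof.
have [_ c _ _ _] := nextP (st n.+1); have := congr1 fst (c a).
rewrite -[nextT _]/(rT n.+1) rTE.
rewrite -[X in fst X]/(rT n (rd n.+1 a) + (0, d D (kk n.+1) (kk n) _)) rTE /=.
by rewrite addr0.
Qed.
Lemma rq_anti n a : rq n (rd n.+1 a) + d D (kk n.+1) (kk n) (rq n.+1 a) = 0.
Proof.
have [_ c _ _ _] := nextP (st n.+1); have := congr1 snd (c a).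
rewrite -[nextT _]/(rT n.+1) rTE.
by rewrite -[X in snd X]/(rT n (rd n.+1 a) + (0, d D (kk n.+1) (kk n) _)) rTE.
Qed.
Lemma r_exact n a x : rd n a = 0 -> rq n a + d D (kk n.+1) (kk n) x = 0 ->
  exists a' x', rd n.+1 a' = a /\ rq n.+1 a' + d D (kk n.+2) (kk n.+1) x' = x.
Proof.
move=> ra qa; have [_ _ e _ _] := nextP (st n.+1).
have [|a' [x' ax]] := e a x.
  rewrite -[LHS]/(rT n a + (0, d D (kk n.+1) (kk n) x)) rTE.
  by congr (_, _); rewrite /= ?ra ?addr0.
exists a', x'; move: ax; rewrite -[nextT _]/(rT n.+1) rTE => ax.
split; first by rewrite -[RHS]/((a, x).1) -ax; exact: (esym (addr0 _)).
by rewrite -[RHS]/((a, x).2) -ax.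
Qed.
Lemma r_exact0 x : exists a' x', rq 0 a' + d D (kk 1) (kk 0) x' = x.
Proof.
have [_ _ e _ _] := nextP (st 0); have [//|a' [x' ax]] := e 0 x.
exists a', x'; move: ax; rewrite -[nextT _]/(rT 0) rTE => ax.
by rewrite -[RHS]/((0 : rA 0, x).2) -ax.
Qed.

Definition Bz (a : int) : lmodType R := if a is Posz n then rA n else 'rV[R]_0.
Definition rdn n m : hom (rA n) (rA m) :=
  if pselect (m.+1 = n) is left e then ecast k (hom (rA k) (rA m)) e (rd m) else 0.
Definition dB a b : hom (Bz a) (Bz b) :=
  match a, b with Posz n, Posz m => rdn n m | _, _ => 0 end.
Definition qB a j : hom (Bz a) (D j) :=
  match a with
  | Posz n.+1 => if pselect (kk n = j) is left e then ecast k (hom (rA n.+1) (D k)) e (rq n)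
                 else 0
  | _ => 0
  end.
Lemma dB_next n : dB n.+1%:Z n%:Z = rd n.
Proof. by rewrite /dB /rdn; case: pselect => // e; rewrite (Prop_irrelevance e erefl). Qed.
Lemma qB_next n : qB n.+1%:Z (kk n) = rq n.
Proof. by rewrite /qB; case: pselect => // e; rewrite (Prop_irrelevance e erefl). Qed.
Lemma dB_shape a b : a != b + 1 -> dB a b = 0.
Proof.
case: a b => n [] m //=; rewrite /rdn; case: pselect => // e h.
by exfalso; move: h; rewrite -e -addn1 PoszD eqxx.
Qed.
Lemma qB_shape a j : j != N%:Z - a + 1 -> qB a j = 0.
Proof.
case: a => [[|n]|n] //=; case: pselect => // e h.
by exfalso; move: h; rewrite -e /kk; lia.
Qed.
Lemma dB2 a b c x : dB b c (dB a b x) = 0.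
Proof.
have [ab|ab] := eqVneq a (b + 1); last by rewrite (dB_shape ab) hom0E linear0.
have [bc|bc] := eqVneq b (c + 1); last by rewrite (dB_shape bc).
case: c b a ab bc x => [n|n] [[|m]|m] [[|l]|l] ab bc x //; try lia.
have e1 : m = n by lia.
have e2 : l = n.+1 by lia.
by subst m l; rewrite !dB_next rd2.
Qed.
Lemma qB_anti a b i j k l : a = b + 1 -> i = N%:Z - a -> j = i + 1 -> k = j + 1 ->
  qB b k (dB a b l) + d D j k (qB a j l) = 0.
Proof.
move=> ab -> -> ->; case: b a ab l => [n|n] [[|m]|m] ab l; try lia.
- have e1 : m = n by lia.
  have -> : N%:Z - m.+1%:Z + 1 = kk n by rewrite /kk; lia.
  subst m; rewrite dB_next qB_next.
  case: n ab l => [|n] ab l; last first.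
    have -> : kk n.+1 + 1 = kk n by rewrite /kk; lia.
    by rewrite qB_next rq_anti.
  have D1 : zero_module (D (kk 0 + 1)) by apply: D0; rewrite /kk; lia.
  exact: D1.
- by rewrite (zero_row0 l) !linear0 addr0.
by rewrite (zero_row0 l) !linear0 addr0.
Qed.
Lemma B_exact a b c i j k (l : Bz b) (x : D j) :
  a = b + 1 -> b = c + 1 -> i = N%:Z - a -> j = N%:Z - b -> k = N%:Z - c ->
  dB b c l = 0 -> qB b k l + d D j k x = 0 ->
  exists l' x', dB a b l' = l /\ qB a j l' + d D i j x' = x.
Proof.
move=> ab bc ia jb kc; case: b ab bc jb l => [[|n]|n] ab bc jb l.
- have e1 : a = 1%N by lia.
  have e2 : j = kk 0 by rewrite /kk; lia.
  have e3 : i = kk 1 by rewrite /kk; lia.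
  clear ab ia jb; subst a j i; move=> _ _; have [a' [x' ax]] := r_exact0 x.
  have z0 (v : Bz 0) : v = 0 by exact: zero_row0.
  exists a', x'; split; first by rewrite [LHS]z0 [RHS]z0.
  by rewrite (qB_next 0).
- have e1 : a = n.+2 by lia.
  have e4 : c = n by lia.
  have e2 : j = kk n.+1 by rewrite /kk; lia.
  have e3 : i = kk n.+2 by rewrite /kk; lia.
  have e5 : k = kk n by rewrite /kk; lia.
  clear ab bc ia jb kc; subst a c j i k; rewrite dB_next qB_next => h1 h2.
  have [a' [x' [h3 h4]]] := r_exact h1 h2.
  by exists a', x'; rewrite dB_next qB_next.
have Dj : zero_module (D j) by apply: D0; lia.
exists 0, 0; rewrite !linear0 addr0; split; last by rewrite (Dj x).
by rewrite (zero_row0 l).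
Qed.

(** P is bounded, and its terms are projective except for the leftmost one. The
    map q, of degree 1, is a quasi-isomorphism from P to a shift of D: the last
    clause is exactness of its cone, and the sign in the clause before it is
    that of a shift. *)
Lemma dual_resolution : exists (P : complex R) (q : forall i j, {linear P i -> D j}),
  [/\ forall i, fin_gen (P i),
      forall i, i != - N.+2%:Z -> projective (P i),
      forall i, (N.+2 < `|i|)%N -> zero_module (P i),
      (forall i j, j != i + 1 -> forall l, q i j l = 0) /\
      (forall i j k l, j = i + 1 -> k = j + 1 -> q j k (d P i j l) + d D j k (q i j l) = 0) &
      forall i j k (l : P j) (x : D j), j = i + 1 -> k = j + 1 ->
        d P j k l = 0 -> q j k l + d D j k x = 0 ->
        exists l' x', d P i j l' = l /\ q i j l' + d D i j x' = x].
Proof.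
pose dP i j : {linear Bz (N%:Z - i) -> Bz (N%:Z - j)} := dB (N%:Z - i) (N%:Z - j).
have dP1 i j : j != i + 1 -> forall x, dP i j x = 0.
  by move=> ij x; rewrite /dP dB_shape //; lia.
have dP2 i j k x : dP j k (dP i j x) = 0 by exact: dB2.
exists (Complex dP1 dP2), (fun i j => qB (N%:Z - i) j); split.
- move=> i; rewrite /cobj /Bz; case: (N%:Z - i) => n; first exact: rA_fg.
  exact: fin_gen_row.
- move=> i ii; rewrite /cobj /Bz; case e: (N%:Z - i) => [n|n]; last exact: row_projective.
  have [nn0|] := leqP n n0; first exact: rA_proj.
  rewrite leq_eqVlt => /orP[/eqP nn0|nn0]; first by rewrite /n0 in nn0; lia.
  move=> A B p f _; exists (0 : hom _ _) => x.
  by rewrite (rA_zero nn0 x) !linear0.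
- move=> i ii; rewrite /cobj /Bz; case e: (N%:Z - i) => [n|n]; last exact: zero_row0.
  by apply: rA_zero; rewrite /n0; lia.
- split=> [i j ij l|]; first by rewrite qB_shape //; lia.
  by move=> i j k l ij jk; apply: (@qB_anti (N%:Z - i) (N%:Z - j) i j k l) => //; lia.
by move=> i j k l x ij jk; apply: (@B_exact (N%:Z - i) (N%:Z - j) (N%:Z - k) i j k l x); lia.
Qed.
End Resolution.

(** * Generating the ring from a dualizing complex *)

Section HomFamilies.
Variable R : comPzRingType.
Implicit Types X Y D : complex R.

Definition sgn (n : int) : R := (-1) ^+ `|n|%N.
Lemma sgnS n : sgn (n + 1) = - sgn n.
Proof.
rewrite /sgn; have [n0|n0] := leP 0 n.
  have -> : `|(n + 1)%R|%N = `|n|%N.+1 by lia.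
  by rewrite exprS mulN1r.
have -> : `|n|%N = `|(n + 1)%R|%N.+1 by lia.
by rewrite exprS mulN1r opprK.
Qed.
Lemma sgn2 n : sgn n * sgn n = 1.
Proof. by rewrite /sgn -expr2 sqrr_sign. Qed.
Lemma sgn0 : sgn 0 = 1. Proof. by []. Qed.

Definition family X Y := forall i j, {linear X i -> Y j}.
(** A cocycle of degree n of the complex Hom (X, Y), written in components;
    [cobd] is its coboundary relation. *)
Definition cocyc X Y n (f : family X Y) := forall i i' j j',
  i' = i + 1 -> j = i + n -> j' = j + 1 ->
  forall x, d Y j j' (f i j x) = sgn n *: f i' j' (d X i i' x).
Definition cobd X Y n (f h : family X Y) := forall i i' j j0,
  i' = i + 1 -> j = i + n -> j = j0 + 1 ->
  forall x, f i j x = d Y j0 j (h i j0 x) + sgn n *: h i' j (d X i i' x).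

(** The family with the single nonzero component g. *)
Definition castY Y (M : lmodType R) j (g : {linear M -> Y j}) j' : hom M (Y j') :=
  if pselect (j = j') is left e then ecast k (hom M (Y k)) e g else 0.
Lemma castY_same Y (M : lmodType R) j (g : {linear M -> Y j}) : castY g j = g.
Proof. by rewrite /castY; case: pselect => // e; rewrite (Prop_irrelevance e erefl). Qed.

(** The homotopy is built upwards, from a degree where D vanishes, by injectivity
    of the terms of D and exactness of X. *)
Lemma null_exact X D (B : nat) n (f : family X D) : exact X ->
  (forall i, injective_module (D i)) -> (forall i, (B < `|i|)%N -> zero_module (D i)) ->
  cocyc n f -> exists h, cobd n f h.
Proof.
move=> /exactP eX DI D0 fc.
(* the homotopy starts in a degree where its target is still zero *)
pose k : int := - B%:Z - 1 - n.
pose P i := forall j, hom (X i) (D j).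
pose Inv i (h : P i) := forall i0 j j0, i = i0 + 1 -> j = i + n -> j = j0 + 1 ->
  forall x : X i0, f i j (d X i0 i x) = d D j0 j (h j0 (d X i0 i x)).
pose Rel i (h : P i) (h' : P (i + 1)) := forall j j0, j = i + n -> j = j0 + 1 ->
  forall x, f i j x = d D j0 j (h j0 x) + sgn n *: h' j (d X i (i + 1) x).
have [||h [_ hP]] := @int_rec_up P k (fun i j => 0) Inv Rel (fun j => 0).
- move=> i0 j j0 _ jk _ x; have Dj : zero_module (D j) by apply: D0; rewrite jk /k; lia.
  by rewrite (Dj (f _ _ _)) hom0E linear0.
- move=> i h _ hI.
  have e0 : i + n = (i + n - 1) + 1 by rewrite subrK.
  have [|g gP] := inj_ext (p := d X i (i + 1))
      (f := hsub (f i (i + n)) (hom_comp (d D (i + n - 1) (i + n)) (h (i + n - 1)))) (DI _).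
    move=> x; have e1 : i = i - 1 + 1 by rewrite subrK.
    move=> /(eX (i - 1) i (i + 1) e1 erefl)[y <-].
    by rewrite hsubE hcompE (hI _ _ _ e1 erefl e0) subrr.
  exists (fun j => castY (sgn n *: (g : hom _ _) : hom _ _) j); split.
    move=> j j0 ji jj0 x; have e2 : j0 = i + n - 1 by rewrite -ji jj0 addrK.
    subst j j0; rewrite castY_same homZE scalerA sgn2 scale1r gP hsubE hcompE.
    by rewrite [RHS]addrC subrK.
  move=> i0 j j0 ii ji jj0 x.
  have e3 : i = i0 by apply: (addIr 1); rewrite -ii.
  have e4 : j0 = i + n by apply: (addIr 1); rewrite -jj0 ji addrAC.
  subst i0 j0; rewrite castY_same homZE linearZ /= gP hsubE linearB hcompE d_comp subr0.
  have ij : j = i + n + 1 by rewrite jj0.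
  by rewrite (fc i (i + 1) (i + n) j erefl erefl ij) scalerA sgn2 scale1r.
exists h => i i' j j0 -> ji jj0 x.
have [ki|ki] := leP k i; first by have [_ HR] := hP i ki; exact: HR.
have Dj : zero_module (D j) by apply: D0; rewrite /k in ki; lia.
by rewrite (Dj (f _ _ _)) [RHS]Dj.
Qed.

Section HomComplex.
Variables X Y : complex R.
(** All families of maps; the term of degree n of Hom (X, Y) is the submodule
    [homS] of those concentrated on j = i + n. This way the terms of Hom (X, Y)
    in different degrees consist of families of the same type. *)
Definition homAll : lmodType R := prodM (fun i => prodM (fun j => hom (X i) (Y j))).
Definition homS (n : int) : submod homAll.
Proof.
exists (fun f : homAll => forall i j, j != i + n -> f i j = 0) => //.
by move=> a f g fs gs i j ij; rewrite !prodDE !prodZE fs // gs // scaler0 addr0.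
Defined.
(** The factor with [m == n + 1] makes the differential vanish outside the
    consecutive degrees. *)
Definition homD (n m : int) (f : homAll) : homAll := fun i j =>
  (m == n + 1)%:R *: hsub (hom_comp (d Y (j - 1) j) (f i (j - 1)))
    (sgn n *: hom_comp (f (i + 1) j) (d X i (i + 1))).
Lemma homD_gen n m f i j x : homD n m f i j x = (m == n + 1)%:R *:
  (d Y (j - 1) j (f i (j - 1) x) - sgn n *: f (i + 1) j (d X i (i + 1) x)).
Proof. by []. Qed.
Lemma homD_next n f i j x : homD n (n + 1) f i j x =
  d Y (j - 1) j (f i (j - 1) x) - sgn n *: f (i + 1) j (d X i (i + 1) x).
Proof. by rewrite homD_gen eqxx scale1r. Qed.
Lemma homAll_lin a (f g : homAll) i j x : (a *: f + g) i j x = a *: f i j x + g i j x.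
Proof. by []. Qed.
Lemma homAllP (f g : homAll) : (forall i j x, f i j x = g i j x) -> f = g.
Proof. by move=> fg; apply: prodP => i; apply: prodP => j; apply: homP => x. Qed.
Lemma homD_linear n m : linear (homD n m).
Proof.
move=> a f g; apply: homAllP => i j x.
rewrite homAll_lin !homD_gen !homAll_lin linearP scalerA mulrC -scalerA -scalerDr.
congr (_ *: _); rewrite scalerBr addrACA -opprD; congr (_ - _).
by rewrite scalerDr !scalerA [sgn n * a]mulrC.
Qed.
Lemma homD_S n m (f : subM (homS n)) : homS m (homD n m (incl _ f)).
Proof.
move=> i j; rewrite /homD; have [->|mn _] := eqVneq m (n + 1); last by rewrite scale0r.
move=> ij; have fs := inclP f.
have -> : incl (homS n) f i (j - 1) = 0 by apply: fs; lia.
have -> : incl (homS n) f (i + 1) j = 0 by apply: fs; lia.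
by apply: homP => x; rewrite homZE hsubE homZE !hcompE !hom0E linear0 scaler0 subr0 scaler0.
Qed.
Lemma homDS_ex n m : exists D : {linear subM (homS n) -> subM (homS m)},
  forall f, incl _ (D f) = homD n m (incl _ f).
Proof.
exact: (incl_factor (S := homS m) (f := hom_comp (mklin (@homD_linear n m)) (incl (homS n)))
  (@homD_S n m)).
Qed.
Definition homDS n m := sval (cid (homDS_ex n m)).
Lemma homDSE n m f : incl _ (homDS n m f) = homD n m (incl _ f).
Proof. exact: (svalP (cid (homDS_ex n m)) f). Qed.
Lemma homDS_shape n m : m != n + 1 -> forall f, homDS n m f = 0.
Proof.
move=> mn f; apply: incl_inj; rewrite homDSE; apply: homAllP => i j x.
by rewrite homD_gen (negbTE mn) scale0r.
Qed.
Lemma homDS_comp n m k f : homDS m k (homDS n m f) = 0.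
Proof.
have [mn|mn] := eqVneq m (n + 1); last by rewrite (homDS_shape mn) linear0.
have [km|km] := eqVneq k (m + 1); last by rewrite (homDS_shape km).
subst m k; apply: incl_inj; rewrite !homDSE; apply: homAllP => i j x.
rewrite homD_next !homD_next linearB !d_comp sub0r linearZ /= linear0 scaler0 subr0.
by rewrite sgnS scaleNr opprK addNr.
Qed.
Definition homX : complex R := Complex homDS_shape homDS_comp.

Lemma homX_cocyc n (f : homX n) : d homX n (n + 1) f = 0 <->
  cocyc n (incl _ f : family X Y).
Proof.
split=> [fc i i' j j' -> -> -> x|fc].
  have := congr1 (fun g : subM (homS (n + 1)) => incl _ g i (i + n + 1) x) fc.
  rewrite [X in X = _](_ : _ = homD n (n + 1) (incl _ f) i (i + n + 1) x); last first.
    by rewrite -homDSE.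
  by rewrite homD_next addrK => /eqP; rewrite subr_eq0 => /eqP.
apply: incl_inj; rewrite [LHS]homDSE; apply: homAllP => i j x.
rewrite homD_next.
have [->|ij] := eqVneq j (i + n + 1).
  by rewrite addrK (fc i (i + 1) (i + n) _ erefl erefl erefl) subrr.
have fs := inclP f.
have -> : incl (homS n) f i (j - 1) = 0 by apply: fs; lia.
have -> : incl (homS n) f (i + 1) j = 0 by apply: fs; lia.
by rewrite !hom0E linear0 scaler0 subr0.
Qed.

Lemma homX_cobd n m (f : homX n) : n = m + 1 ->
  (exists g, d homX m n g = f) <-> exists h, cobd n (incl _ f : family X Y) h.
Proof.
move=> nm; split=> [[g <-]|[h fh]].
  exists (incl _ g) => i i' j j0 -> ji jj0 x.
  rewrite [LHS](_ : _ = homD m n (incl _ g) i j x); last by rewrite -homDSE.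
  by rewrite nm homD_next sgnS scaleNr jj0 addrK.
pose h' : homAll := fun i j => (j == i + m)%:R *: (h i j : hom _ _).
have hS : homS m h' by move=> i j /negbTE ij; rewrite /h' ij scale0r.
have [g gE] := incl_lift hS; exists g.
apply: ((injmP _).1 (@incl_inj _ _ (homS n))); rewrite [LHS]homDSE gE; apply: homAllP => i j x.
rewrite {1}nm homD_next /h'.
have [ij|ij] := eqVneq j (i + n); last first.
  rewrite (inclP f i j ij) hom0E.
  have /negbTE -> : j - 1 != i + m by lia.
  have /negbTE -> : j != i + 1 + m by lia.
  by rewrite !scale0r linear0 scaler0 subr0.
have -> : j - 1 == i + m by lia.
have -> : j == i + 1 + m by lia.
have jj : j = j - 1 + 1 by rewrite subrK.
by rewrite (fh i (i + 1) j (j - 1) erefl ij jj) nm sgnS scaleNr !homZE !scale1r.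
Qed.
End HomComplex.
End HomFamilies.

Section Dualizing.
Local Open Scope quotient_scope.
Variables (R : comPzRingType) (D : complex R) (N : nat).
Hypothesis D0 : forall i, (N < `|i|)%N -> zero_module (D i).
Hypothesis DI : forall i, injective_module (D i).
Hypothesis Dhom : bijective (fun r => \pi_(htp_class D D) (homothety D r)).
Hypothesis Dnull : forall n, n != 0 -> forall f : chain_map D (shift n D), null_homotopic f.
Local Notation sgn := (sgn R).

Let tr i j (e : i = j) : {linear D i -> D j} := ecast k (hom (D i) (D k)) e (hom_id (D i)).

(** The components of a cocycle of degree n form a chain map from D to the shift
    of D by n, which is null homotopic because D is dualizing. *)
Lemma cocyc_DD n (f : family D D) : n != 0 -> cocyc n f -> exists h, cobd n f h.
Proof.
move=> n0 fc.
have cP i j x : f j (j + n) (d D i j x) = d (shift n D) i j (f i (i + n) x).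
  have [ij|ij] := eqVneq j (i + 1); last first.
    by rewrite (d_shape ij) (d_shape (c := shift n D) ij) linear0.
  rewrite -[RHS]/(sgn n *: d D (i + n) (j + n) (f i (i + n) x)).
  have jn : j + n = i + n + 1 by rewrite ij addrAC.
  by rewrite (fc i j (i + n) (j + n) ij erefl jn) scalerA sgn2 scale1r.
pose c : chain_map D (shift n D) := @ChainMap R D (shift n D) (fun i => f i (i + n)) cP.
have [s sP] := Dnull n0 c.
pose h : family D D := fun i j =>
  sgn n *: hom_comp (tr (subrK n j)) (s i (j - n) : {linear D i -> D (j - n + n)}) : hom _ _.
have hE i m x : h i (m + n) x = sgn n *: s i m x.
  have E (m' : int) (e : m' + n = m + n) (y : {linear D i -> D (m' + n)}) :
      m' = m -> sgn n *: hom_comp (tr e) (s i m') x = sgn n *: s i m x.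
    by move=> mm; subst m'; rewrite (Prop_irrelevance e erefl).
  by apply: E; rewrite ?addrK.
exists h => i i' j j0 ii ji jj0 x; subst i' j.
have e0 : j0 = i - 1 + n by lia.
subst j0.
rewrite (hE i (i - 1)) (hE (i + 1) i) linearZ /= scalerA sgn2 scale1r; exact: sP.
Qed.

Lemma cocyc_DD0 (f : family D D) : cocyc 0 f -> exists (r : R) (h : family D D),
  forall i i' j0, i' = i + 1 -> i = j0 + 1 ->
  forall x, f i i x = r *: x + (d D j0 i (h i j0 x) + h i' i (d D i i' x)).
Proof.
move=> fc.
have cP i j x : f j j (d D i j x) = d D i j (f i i x).
  have [ij|ij] := eqVneq j (i + 1); last first.
    by rewrite (d_shape ij) (d_shape (c := D) ij) linear0.
  have ii : i = i + 0 by rewrite addr0.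
  by rewrite (fc i j i j ij ii ij) scale1r.
pose c : chain_map D D := @ChainMap R D D (fun i => f i i) cP.
have [inv _ invK] := Dhom.
have /eqP/htp_piP[h hP] := esym (invK (\pi_(htp_class D D) c)).
exists (inv (\pi_(htp_class D D) c)), h => i i' j0 ii ij0 x.
have e : j0 = i - 1 by rewrite ij0 addrK.
subst i' j0; rewrite -hP -[X in _ + X]/(f i i x - _ *: x).
by rewrite addrC subrK.
Qed.

Lemma homothety_null (r : R) (h : family D D) :
  (forall i i' j0, i' = i + 1 -> i = j0 + 1 ->
   forall x, r *: x = d D j0 i (h i j0 x) + h i' i (d D i i' x)) -> r = 0.
Proof.
move=> hP; apply: (bij_inj Dhom); apply/eqP/htp_piP; exists h => i x.
have e : i = i - 1 + 1 by rewrite subrK.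
rewrite -(hP i (i + 1) (i - 1) erefl e) -[LHS]/(r *: x - 0 *: x) scale0r subr0 //.
Qed.

Variables (P : complex R) (q : family P D).
Hypothesis Pproj : forall i, i != - N.+2%:Z -> projective (P i).
Hypothesis P0 : forall i, (N.+2 < `|i|)%N -> zero_module (P i).
Hypothesis qshape : forall i j, j != i + 1 -> forall l, q i j l = 0.
Hypothesis qanti : forall i j k l, j = i + 1 -> k = j + 1 ->
  q j k (d P i j l) + d D j k (q i j l) = 0.
Hypothesis coneE : forall i j k (l : P j) (x : D j), j = i + 1 -> k = j + 1 ->
  d P j k l = 0 -> q j k l + d D j k x = 0 ->
  exists l' x', d P i j l' = l /\ q i j l' + d D i j x' = x.

Definition coned i j : {linear (P i * D i)%type -> (P j * D j)%type} :=
  hadd (hom_comp (pin1 _ _) (hom_comp (d P i j) (pfst _ _)))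
       (hom_comp (pin2 _ _) (hadd (hom_comp (q i j) (pfst _ _)) (hom_comp (d D i j) (psnd _ _)))).
Lemma conedE i j l x : coned i j (l, x) = (d P i j l, q i j l + d D i j x).
Proof. by rewrite [RHS]pinE. Qed.
Lemma coned_shape i j : j != i + 1 -> forall z, coned i j z = 0.
Proof. by move=> ij [l x]; rewrite conedE !d_shape // qshape // addr0. Qed.
Lemma coned_comp i j k z : coned j k (coned i j z) = 0.
Proof.
case: z => l x.
have [ij|ij] := eqVneq j (i + 1); last by rewrite (coned_shape ij) linear0.
have [jk|jk] := eqVneq k (j + 1); last by rewrite (coned_shape jk).
by rewrite !conedE linearD !d_comp addr0 qanti.
Qed.
(** The mapping cone of q. *)
Definition cone : complex R := Complex coned_shape coned_comp.

Lemma cone_exact : exact cone.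
Proof.
apply/exactP => i j k ij jk [l x]; rewrite [LHS]conedE => e.
have [l' [x' [e1 e2]]] := coneE ij jk (congr1 fst e) (congr1 snd e).
by exists (l', x'); rewrite [LHS]conedE e1 e2.
Qed.

(** A cocycle F on P, extended by zero to the exact cone of q, becomes null
    homotopic there. The component on D of the homotopy is a cocycle g, and F is
    cohomologous to g q up to sign. *)
Lemma cobd_PD n (F : family P D) : cocyc n F ->
  exists (g : family D D) (k : family P D), cocyc (n - 1) g /\
    forall i i' j j0, i' = i + 1 -> j = i + n -> j = j0 + 1 -> forall l,
    F i j l = d D j0 j (k i j0 l) + sgn n *: k i' j (d P i i' l) + sgn n *: g i' j (q i i' l).
Proof.
move=> Fc; pose phi : family cone D := fun i j => hom_comp (F i j) (pfst _ _).
have [|eta etaP] := @null_exact R cone D N n phi cone_exact DI D0.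
  move=> i i' j j' ii ji jj [l x]; rewrite -[d cone _ _ _]/(coned i i' (l, x)) conedE.
  exact: Fc.
exists (fun i j => hom_comp (eta i j) (pin2 _ _)), (fun i j => hom_comp (eta i j) (pin1 _ _)).
have E i i' j j0 l x : i' = i + 1 -> j = i + n -> j = j0 + 1 ->
    F i j l = d D j0 j (eta i j0 (l, x)) +
      sgn n *: eta i' j (d P i i' l, q i i' l + d D i i' x).
  move=> ii ji jj; have := etaP i i' j j0 ii ji jj (l, x).
  by rewrite -[d cone _ _ _]/(coned i i' (l, x)) conedE => <-.
split=> [i i' j j' ii ji jj x|i i' j j0 ii ji jj l].
  have ji' : j' = i + n by lia.
  have := E i i' j' j 0 x ii ji' jj; rewrite !linear0 add0r => /esym/eqP.
  rewrite addr_eq0 => /eqP ->.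
  have -> : sgn (n - 1) = - sgn n.
    by rewrite -[n in RHS](subrK 1) sgnS opprK.
  by rewrite scaleNr.
rewrite (E i i' j j0 l 0 ii ji jj) -[RHS]addrA -scalerDr !hcompE -linearD -pinE.
by rewrite (linear0 (d D i i')) addr0.
Qed.

(** For n other than 1 the cocycle g of [cobd_PD] has nonzero degree n - 1, and
    is a coboundary. *)
Lemma coh_PD n (F : family P D) : n != 1 -> cocyc n F -> exists k, cobd n F k.
Proof.
move=> n1 /cobd_PD[g [k [gc FE]]].
have [|h hP] := cocyc_DD _ gc; first by rewrite subr_eq0.
pose k' : family P D := fun i j =>
  hadd (k i j) (sgn n *: hom_comp (h (i + 1) j) (q i (i + 1)) : hom _ _).
exists k' => i i' j j0 ii ji jj l; rewrite (FE i i' j j0 ii ji jj).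
rewrite !haddE linearD scalerDr addrACA; congr (_ + _).
have ji' : j = i' + (n - 1) by lia.
rewrite (hP i' (i' + 1) j j0 erefl ji' jj) scalerDr; congr (_ + _).
  by rewrite homZE linearZ hcompE -ii.
rewrite homZE hcompE.
have := qanti l ii (erefl (i' + 1)) => /eqP; rewrite addr_eq0 => /eqP ->.
have -> : sgn (n - 1) = - sgn n by rewrite -[n in RHS](subrK 1) sgnS opprK.
by rewrite scaleNr !scalerN !scalerA sgn2 !scale1r linearN.
Qed.

(** In degree 1 the cocycle g of [cobd_PD] is homotopic to a homothety. *)
Lemma coh_PD1 (F : family P D) : cocyc 1 F -> exists (r : R) k,
  cobd 1 (fun i j => hsub (F i j) (r *: (q i j : hom _ _) : hom _ _)) k.
Proof.
move=> /cobd_PD[g [k [gc FE]]].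
have [r [h hP]] : exists (r : R) (h : family D D),
  forall i i' j0, i' = i + 1 -> i = j0 + 1 ->
  forall x, g i i x = r *: x + (d D j0 i (h i j0 x) + h i' i (d D i i' x)).
  by apply: cocyc_DD0; rewrite -(subrr 1).
exists (sgn 1 * r).
exists (fun i j => hadd (k i j) (sgn 1 *: hom_comp (h (i + 1) j) (q i (i + 1)) : hom _ _)).
move=> i i' j j0 ii ji jj l; rewrite hsubE homZE.
have e : j = i' by rewrite ii.
rewrite e in ji jj *; rewrite (FE i i' i' j0 ii ji jj) (hP i' (i' + 1) j0 erefl jj).
rewrite !haddE !homZE !hcompE linearD linearZ /= -ii.
have := qanti l ii (erefl (i' + 1)) => /eqP; rewrite addr_eq0 => /eqP ->.
have -> : sgn 1 = -1 by rewrite /sgn expr1.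
rewrite linearN !mulN1r !scaleN1r scalerN scaleNr !opprK linearB.
rewrite -[LHS]addrA [X in _ + X]addrAC addNr add0r !opprD !addrA.
by congr (_ - _); rewrite addrAC.
Qed.

(** If r q is homotopic to zero, then multiplication by r on D extends to a map
    from the cone of q, which is exact; so it is null homotopic, and r = 0. *)
Lemma coh_rq (r : R) (k : family P D) :
  cobd 1 (fun i j => r *: (q i j : hom _ _) : hom _ _) k -> r = 0.
Proof.
move=> kP.
pose g i : {linear (P i * D i)%type -> D i} :=
  hadd (r *: (psnd _ _ : hom _ _) : hom _ _) (hom_comp (k i i) (pfst _ _)).
have gE i l x : g i (l, x) = r *: x + k i i l by [].
pose psi : family cone D := fun i j => castY (g i) j.
have [|eta etaP] := @null_exact R cone D N 0 psi cone_exact DI D0.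
  move=> i i' j j' ii ji jj [l x].
  have e1 : j = i by rewrite ji addr0.
  have e2 : j' = i' by rewrite jj e1 ii.
  clear ji jj; subst j j'; rewrite /psi !castY_same -[d cone _ _ _]/(coned i i' (l, x)) conedE !gE.
  rewrite sgn0 scale1r linearD linearZ /= scalerDr [X in _ = X + _]addrC -[RHS]addrA.
  congr (_ + _); have := kP i i' i' i ii ii ii l; rewrite homZE /sgn expr1 scaleN1r => ->.
  by rewrite subrK.
apply: (@homothety_null r (fun i j => hom_comp (eta i j) (pin2 _ _))).
move=> i i' j0 ii ij0 x.
have ei : i = i + 0 by rewrite addr0.
have := etaP i i' i j0 ii ei ij0 (0, x).
rewrite /psi castY_same gE linear0 addr0 => ->.
rewrite -[d cone _ _ _]/(coned i i' (0, x)) conedE !linear0 add0r sgn0 scale1r.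
by [].
Qed.

(** The modules Hom (P^i, D^j) belong to this class: they are injective when P^i is
    projective, and only the leftmost term of P need not be. *)
Definition dbase : mod_class R := fun M =>
  injective_module M \/ exists2 V, injective_module V & M = hom (P (- N.+2%:Z)) V :> lmodType R.

Lemma dbase_hom i j : thick dbase (hom (P i) (D j)).
Proof.
have [->|ii] := eqVneq i (- N.+2%:Z).
  by apply: thick_base; right; exists (D j).
by apply: thick_base; left; apply: projective_flatI => //; exact: Pproj.
Qed.

(** The families concentrated on i at most m: a finite filtration of Hom (P, D)
    with subquotients Hom (P^m, D^(m+n)). *)
Definition homSb (n m : int) : submod (homAll P D).
Proof.
exists (fun f : homAll P D => homS P D n f /\ forall i j, m < i -> f i j = 0).
  by split=> //; exact: sm0.
move=> a f g [fs fm] [gs gm]; split; first exact: smP.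
by move=> i j mi; rewrite !prodDE !prodZE fm // gm // scaler0 addr0.
Defined.

Lemma hom_zero i (M : lmodType R) (f : hom (P i) M) : (N.+2 < `|i|)%N -> f = 0.
Proof. by move=> /P0 Pi; apply: homP => x; rewrite (Pi x) linear0. Qed.

Lemma thick_homSb n (k : nat) : thick dbase (subM (homSb n (- N.+3%:Z + k%:Z))).
Proof.
elim: k => [|k IH].
  apply: thick_zero => f; apply: incl_inj; have [fs fm] := inclP f.
  apply: prodP => i; apply: prodP => j.
  have [ii|ii] := ltP (- N.+3%:Z + 0%:Z) i; first exact: fm.
  by apply: hom_zero; lia.
set m := - N.+3%:Z + k%:Z in IH; have -> : - N.+3%:Z + k.+1%:Z = m + 1 by rewrite /m; lia.
have [|u uP] := incl_factor (S := homSb n (m + 1)) (f := incl (homSb n m)).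
  move=> f; have [fs fm] := inclP f; split=> // i j mi; apply: fm; lia.
pose v : hom (subM (homSb n (m + 1))) (hom (P (m + 1)) (D (m + 1 + n))) :=
  hom_comp (prod_proj (fun j => hom (P (m + 1)) (D j)) (m + 1 + n))
   (hom_comp (prod_proj (fun i => prodM (fun j => hom (P i) (D j))) (m + 1)) (incl (homSb n (m + 1)))).
have vE f : v f = incl _ f (m + 1) (m + 1 + n) by [].
apply: (@thick_m _ _ _ _ _ u v _ IH (dbase_hom _ _)); split=> [f uf|f|g].
- by apply: incl_inj; rewrite -uP uf linear0.
- split=> [vf|[g <-]]; last first.
    by rewrite vE uP; have [_ gm] := inclP g; apply: gm; lia.
  have [fs fm] := inclP f.
  have fS : homSb n m (incl _ f).
    split=> // i j mi; have [mi'|mi'] := ltP (m + 1) i; first exact: fm.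
    have e : i = m + 1 by lia.
    subst i; have [->|jj] := eqVneq j (m + 1 + n); last exact: fs.
    by rewrite -vE.
  have [g gE] := incl_lift fS; exists g.
  by apply: ((injmP _).1 (@incl_inj _ _ (homSb n (m + 1)))); rewrite uP gE.
pose w : homAll P D := fun i j =>
  if pselect (m + 1 = i) is left e then ecast k (hom (P k) (D j)) e (castY g j) else 0.
have w1 j : w (m + 1) j = castY g j.
  by rewrite /w; case: pselect => // e; rewrite (Prop_irrelevance e erefl).
have w0 i j : i != m + 1 -> w i j = 0.
  by rewrite /w; case: pselect => // e h; exfalso; rewrite e eqxx in h.
have wS : homSb n (m + 1) w.
  split=> [i j ij|i j mi]; last by apply: w0; lia.
  have [e|/w0//] := eqVneq i (m + 1); subst i; rewrite w1 /castY.
  by case: pselect => // e; exfalso; rewrite -e eqxx in ij.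
have [f fE] := incl_lift wS; exists f.
by rewrite vE fE w1 castY_same.
Qed.

Lemma thick_homX n : thick dbase (homX P D n).
Proof.
apply: thick_iso (thick_homSb n (N + N + 6)); set m := - _ + _.
have [|u uP] := incl_factor (S := homS P D n) (f := incl (homSb n m)).
  by move=> f; have [] := inclP f.
have [|v vP] := incl_factor (S := homSb n m) (f := incl (homS P D n)).
  move=> f; split; first exact: inclP.
  by move=> i j mi; apply: hom_zero; rewrite /m in mi; lia.
exists u, v => f; apply/(injmP (incl _)).1; try exact: incl_inj.
  by rewrite vP uP.
by rewrite uP vP.
Qed.

(** Hom (P, D) has cohomology R, generated by q, in degree 1 only, and its terms
    are built from [dbase]. *)
Lemma thick_R : thick dbase R^o.
Proof.
pose qq : homAll P D := fun i j => q i j.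
have qqS a : homS P D 1 (scalar_map qq a).
  move=> i j ij; apply: homP => x.
  by rewrite -[LHS]/(a *: q i j x) qshape // scaler0.
have [f fE] := incl_factor qqS.
have qc : cocyc 1 q.
  move=> i i' j j' ii ji jj x; subst i' j.
  have := qanti x (erefl (i + 1)) jj => /eqP; rewrite addrC addr_eq0 => /eqP ->.
  by rewrite /sgn expr1 scaleN1r.
have fc a : d (homX P D) 1 (1 + 1) (f a) = 0.
  apply/homX_cocyc => i i' j j' ii ji jj x; rewrite fE.
  have E u v y : (scalar_map qq a : homAll P D) u v y = a *: q u v y by [].
  by rewrite !E linearZ /= (qc i i' j j' ii ji jj) !scalerA mulrC.
have [rho rhoE] := cyc_factor (X := homX P D) fc.
apply: (@thick_homology R dbase (homX P D) (4 * N + 10)%N 1 0 R^o rho (erefl _)).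
- move=> n nn F; apply: incl_inj; apply: prodP => i; apply: prodP => j.
  have [ii|ii] := leqP `|i|%N N.+2; last exact: hom_zero.
  have [ij|ij] := eqVneq j (i + n); last exact: (inclP F).
  have Dj : zero_module (D j) by apply: D0; lia.
  by apply: homP => x; rewrite [LHS]Dj.
- move=> i j j1 ij F Fc.
  apply/(homX_cobd F ij); apply: coh_PD => //.
  exact/homX_cocyc.
- exact: thick_homX.
- move=> z; have /homX_cocyc zc := cycP z.
  have [r [k kP]] := coh_PD1 zc.
  have [y yE] : exists y, d (homX P D) 0 1 y = cyc_in _ _ z - f r.
    apply/(homX_cobd _ (erefl (0 + 1))); exists k.
    move=> i i' j j0 ii ji jj x; rewrite -(kP i i' j j0 ii ji jj x).
    rewrite linearB fE; by [].
  by exists r, y; rewrite yE rhoE addrC subrK.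
move=> a y; rewrite rhoE => e; have [k kP] := (homX_cobd (f a) (erefl (0 + 1))).1 (ex_intro _ y (esym e)).
apply: (@coh_rq a k) => i i' j j0 ii ji jj x; rewrite -(kP i i' j j0 ii ji jj x).
by rewrite fE.
Qed.
End Dualizing.

(** * Products of Gorenstein flat modules *)

Section Presented.
Variables (R : comPzRingType) (C : lmodType R) (a b : nat).
Variables (p : {linear 'rV[R]_a -> C}) (q : {linear 'rV[R]_b -> 'rV[R]_a}).
Hypothesis pS : surjm p.
Hypothesis pq : forall v, p v = 0 <-> exists w, q w = v.

Let Q : 'M[R]_(b, a) := \matrix_(l, c) q (delta_mx 0 l) 0 c.
Let e c : C := p (delta_mx 0 c).

(** C is the module with generators [e] and relations the rows of [Q]. *)
Lemma pres_rel (M : lmodType R) (be : {linear C -> M}) l : \sum_c Q l c *: be (e c) = 0.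
Proof.
under eq_bigr => c _ do rewrite mxE -!linearZ.
rewrite -!linear_sum -row_sum_delta (pq _).2 ?linear0 //.
by exists (delta_mx 0 l).
Qed.

Lemma pres_factor (M : lmodType R) (m : 'I_a -> M) :
  (forall l, \sum_c Q l c *: m c = 0) -> exists f : {linear C -> M}, forall c, f (e c) = m c.
Proof.
move=> mP; have [|f fP] := factor_surj (p := p) (f := rowmap m) pS.
  move=> v /pq[w <-].
  rewrite -[LHS]/(hom_comp (rowmap m) q w) -[RHS]/((0 : hom 'rV[R]_b M) w).
  apply: row_ext => l; rewrite hcompE rowmapE -[RHS](mP l).
  by apply: eq_bigr => c _; rewrite mxE.
by exists f => c; rewrite fP rowmap_delta.
Qed.

Lemma pres_ext (M : lmodType R) (f g : {linear C -> M}) :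
  (forall c, f (e c) = g (e c)) -> forall x, f x = g x.
Proof.
move=> fg x; have [v <-] := pS x.
rewrite -[LHS]/(hom_comp f p v) -[RHS]/(hom_comp g p v).
by apply: row_ext => c; exact: fg.
Qed.

Definition vmap (M N : lmodType R) n (f : {linear M -> N}) : {linear vec M n -> vec N n} :=
  prod_map (fun c => hom_comp f (prod_proj (fun _ : 'I_n => M) c)).
Lemma vmapE (M N : lmodType R) n (f : {linear M -> N}) (x : vec M n) c :
  vmap n f x c = f (x c).
Proof. by []. Qed.

(** Exactness of C (x) T, in terms of elements and the presentation of C. This
    form visibly commutes with products of complexes. *)
Definition elem_exact (T : complex R) := forall i j k, j = i + 1 -> k = j + 1 ->
  forall (x : vec (T j) a) (w : vec (T k) b), vmap a (d T j k) x = mxact (T k) Q w ->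
  exists y z, x = vmap a (d T i j) y + mxact (T j) Q z.

Lemma bal_elem T : bal C T -> elem_exact T.
Proof.
move=> CT i j k ij jk x w xw.
have [E [EI Esep]] := cogenerator R.
pose h : hom (vec (T i) a * vec (T j) b)%type (vec (T j) a) :=
  hadd (hom_comp (vmap a (d T i j)) (pfst _ _)) (hom_comp (mxact (T j) Q) (psnd _ _)).
suff [[y z] yz] : imS h x by exists y, z; rewrite -yz.
apply: contrapT => /(Esep _)[phi [phiS]]; apply.
have phi1 y : phi (vmap a (d T i j) y) = 0.
  by apply: phiS; exists (y, 0); rewrite haddE !hcompE [X in _ + X]linear0 addr0.
have phi2 z : phi (mxact (T j) Q z) = 0.
  by apply: phiS; exists (0, z); rewrite haddE !hcompE [X in X + _]linear0 add0r.
have [|f fP] := @pres_factor (hom (T j) E) (fun c => hom_comp phi (singleM (T j) c)).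
  move=> l; apply: homP => t; rewrite hom_sumE -[RHS](phi2 (single l t)) vec_mapE.
  apply: eq_bigr => c _; rewrite homZE hcompE -!linearZ mxactE; congr (phi (singleM _ c _)).
  rewrite (bigD1 l) //= big1 => [|l' /negbTE ll].
    by rewrite /single eqxx scale1r addr0.
  by rewrite /single ll scale0r scaler0.
have [|g gP] := CT E EI i j k ij jk f.
  move=> v t; rewrite -[LHS]/(hom_comp (precomp E (d T i j)) f v t).
  rewrite -[RHS]/((0 : hom C (hom (T i) E)) v t); congr ((_ : hom _ _) t).
  apply: pres_ext => c; apply: homP => {}t; rewrite /= fP.
  rewrite -(phi1 (single c t)); congr (phi _); apply: prodP => c'.
  by rewrite vmapE /single linearZ.
rewrite vec_mapE (eq_bigr (fun c => \sum_l Q l c *: g (e c) (w l))); last first.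
  move=> c _; rewrite -[LHS]/(hom_comp phi (singleM _ c) (x c)) -fP gP.
  have := congr1 (fun z : vec (T k) a => z c) xw; rewrite /= => ->.
  by rewrite linear_sum; apply: eq_bigr => l _; rewrite linearZ.
rewrite exchange_big big1 // => l _.
have := congr1 (fun u : hom (T k) E => u (w l)) (pres_rel g l).
by rewrite hom_sumE hom0E => e0; rewrite -[RHS]e0; apply: eq_bigr.
Qed.

Lemma elem_bal T : elem_exact T -> bal C T.
Proof.
move=> CT E EI i j k ij jk f fd.
pose phi : hom (vec (T j) a) E := \sum_c hom_comp (f (e c)) (prod_proj (fun _ : 'I_a => T j : lmodType R) c).
have phiE x : phi x = \sum_c f (e c) (x c) by rewrite hom_sumE.
pose h : hom (vec (T j) a * vec (T k) b)%type (vec (T k) a) :=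
  hsub (hom_comp (vmap a (d T j k)) (pfst _ _)) (hom_comp (mxact (T k) Q) (psnd _ _)).
have [|psi psiP] := inj_ext (p := h) (f := hom_comp phi (pfst _ _)) EI.
  move=> [x w] /eqP; rewrite subr_eq0 => /eqP /(CT i j k ij jk)[y [z xE]].
  rewrite hcompE xE linearD !phiE big1 ?add0r => [|c _]; last exact: fd.
  under eq_bigr => c _ do rewrite mxactE linear_sum.
  rewrite exchange_big big1 // => l _.
  have := congr1 (fun u : hom (T j) E => u (z l)) (pres_rel f l).
  by rewrite hom_sumE hom0E => e0; rewrite -[RHS]e0; apply: eq_bigr => c _; rewrite linearZ.
have psi1 x : psi (vmap a (d T j k) x) = phi x.
  rewrite -[RHS]/(hom_comp phi (pfst _ (vec (T k) b)) (x, 0)) -psiP.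
  congr (psi _); rewrite /h hsubE !hcompE [X in _ - X]linear0 subr0; by [].
have psi2 w : psi (mxact (T k) Q w) = 0.
  have := psiP (0, - w); rewrite hcompE [RHS]linear0 => <-.
  congr (psi _); rewrite /h hsubE !hcompE [X in X - _]linear0 sub0r.
  by rewrite -[psnd _ _ _]/(- w) linearN opprK.
have [|g gP] := @pres_factor (hom (T k) E) (fun c => hom_comp psi (singleM (T k) c)).
  move=> l; apply: homP => t; rewrite hom_sumE -[RHS](psi2 (single l t)) vec_mapE.
  apply: eq_bigr => c _; rewrite homZE hcompE -!linearZ mxactE; congr (psi (singleM _ c _)).
  rewrite (bigD1 l) //= big1 => [|l' /negbTE ll].
    by rewrite /single eqxx scale1r addr0.
  by rewrite /single ll scale0r scaler0.
exists g => v t; rewrite -[RHS]/(hom_comp (precomp E (d T j k)) g v t).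
congr ((_ : hom _ _) t); apply: pres_ext => c; apply: homP => {}t; rewrite /= gP.
have -> : hom_comp psi (singleM _ c) (d T j k t) = psi (vmap a (d T j k) (single c t)).
  by rewrite hcompE; congr (psi _); apply: prodP => c'; rewrite vmapE /single linearZ.
rewrite psi1 phiE (bigD1 c) //= big1 => [|c' /negbTE cc].
  by rewrite /single eqxx scale1r addr0.
by rewrite /single cc scale0r linear0.
Qed.

(** Hom (Hom (C, V), E) is C (x) Hom (V, E) for finitely presented C and injective
    E; as Hom (V, E) is flat, exactness of C (x) T suffices. The isomorphism is
    not constructed: the map [pi] from tuples, indexed by the generators of C,
    of elements of Hom (V, E) is onto, and maps are defined on its source. *)
Lemma bal_hom_hom T V E : bal C T -> flatI (hom V E) ->
  injective_module V -> injective_module E -> bal (hom (hom C V) E) T.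
Proof.
move=> CT VEf VI EI Y YI i j k ij jk f fd.
pose ka c (phi : hom V E) : hom (hom C V) E := hom_comp phi (ev V c).
have kaL c : linear (ka c) by move=> r phi phi'; apply: homP.
have kaL2 phi : linear (ka^~ phi).
  by move=> r c c'; apply: homP => h; rewrite /ka /= linearP linearP.
pose bb c t : hom (hom V E) Y := hom_comp (ev Y t) (hom_comp f (mklin (kaL c))).
have [||f' f'P] := @mkbil R C (T j) (hom (hom V E) Y) bb.
- by move=> c r t t'; apply: homP => phi; rewrite /bb /= linearP.
- by move=> t r c c'; apply: homP => phi; rewrite /bb /= kaL2 linearP.
have [|g' g'P] := CT (hom (hom V E) Y) (VEf Y YI) i j k ij jk f'.
  by move=> c t; rewrite f'P; apply: homP => phi; exact: fd.
have [ka' ka'P] := @mkbil R C (hom V E) (hom (hom C V) E) ka kaL kaL2.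
pose pi : hom (vec (hom V E) a) (hom (hom C V) E) :=
  \sum_c hom_comp (ka' (e c)) (prod_proj (fun _ : 'I_a => hom V E : lmodType R) c).
have piE phi : pi phi = \sum_c ka (e c) (phi c).
  by rewrite hom_sumE; apply: eq_bigr => c _; rewrite hcompE ka'P.
have piEh phi h : pi phi h = \sum_c phi c (h (e c)) by rewrite piE hom_sumE.
have piS : surjm pi.
  move=> om; pose i0 : hom (hom C V) (vec V a) := prod_map (fun c => ev V (e c)).
  have [|Om OmP] := inj_ext (p := i0) (f := om) EI.
    move=> h h0; suff -> : h = 0 by rewrite linear0.
    apply: homP; apply: (pres_ext (f := h) (g := (0 : hom C V))) => c.
    exact: (congr1 (fun z : vec V a => z c) h0).
  exists (fun c => hom_comp Om (singleM V c)); apply: homP => h.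
  by rewrite piEh -OmP [RHS]vec_mapE.
have [||F FP] := @mkbil R (vec (hom V E) a) (T k) Y (fun phi t => \sum_c g' (e c) t (phi c)).
- move=> phi r t t'; rewrite scaler_sumr -big_split; apply: eq_bigr => c _ /=.
  by rewrite linearP.
- move=> t r phi phi'; rewrite scaler_sumr -big_split; apply: eq_bigr => c _ /=.
  by rewrite prodDE prodZE linearP.
have [|g gP] := factor_surj (p := pi) (f := F) piS.
  move=> phi pi0; apply: homP => t; rewrite FP hom0E.
  pose Phi : hom (vec V a) E := \sum_c hom_comp (phi c) (prod_proj (fun _ : 'I_a => V) c).
  have PhiE v : Phi v = \sum_c phi c (v c) by rewrite hom_sumE.
  have [|psi psiP] := inj_ext (p := mxact V Q^T) (f := Phi) EI.
    move=> v Qv; have [|h hP] := @pres_factor V v.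
      move=> l; have := congr1 (fun z : vec V b => z l) Qv; rewrite /= => vl.
      by rewrite -[RHS]vl; apply: eq_bigr => c _; rewrite [X in _ = X *: _]mxE.
    rewrite PhiE; transitivity (pi phi h); last by rewrite pi0.
    by rewrite piEh; apply: eq_bigr => c _; rewrite hP.
  have phiE c : phi c = \sum_l Q l c *: hom_comp psi (singleM V l).
    apply: homP => v; rewrite hom_sumE.
    have -> : phi c v = Phi (single c v).
      rewrite PhiE (bigD1 c) //= big1 => [|c' /negbTE cc].
        by rewrite /single eqxx scale1r addr0.
      by rewrite /single cc scale0r linear0.
    rewrite -psiP vec_mapE; apply: eq_bigr => l _.
    rewrite homZE hcompE -!linearZ mxactE; congr (psi (singleM _ l _)).
    rewrite (bigD1 c) //= big1 => [|c' /negbTE cc].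
      by rewrite /single eqxx scale1r addr0 mxE.
    by rewrite /single cc scale0r scaler0.
  under eq_bigr => c _ do rewrite phiE linear_sum.
  rewrite exchange_big big1 // => l _.
  have := congr1 (fun u : hom (T k) _ => (u t : hom _ _) (hom_comp psi (singleM V l))) (pres_rel g' l).
  by rewrite /= hom_sumE hom_sumE => e0; rewrite -[RHS]e0; apply: eq_bigr => c _; rewrite linearZ.
exists g => om t; have [phi <-] := piS om.
rewrite gP FP piE linear_sum hom_sumE; apply: eq_bigr => c _.
rewrite -g'P f'P; by [].
Qed.
End Presented.

Section Products.
Variables (R : comPzRingType) (J : Type) (F : J -> complex R).
Definition prodC : complex R.
Proof.
exists (fun i => prodM (fun j => F j i))
  (fun i k => prod_map (fun j => hom_comp (d (F j) i k) (prod_proj (fun j => F j i) j))).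
- by move=> i k ik x; apply: prodP => j; exact: d_shape.
- by move=> i k l x; apply: prodP => j; exact: d_comp.
Defined.
Lemma prodCE i k x j : d prodC i k x j = d (F j) i k (x j).
Proof. by []. Qed.
Lemma prod_exact : (forall j, exact (F j)) -> exact prodC.
Proof.
move=> eF; apply/exactP => i j k ij jk x dx.
have H l : exists y, d (F l) i j y = x l.
  apply: ((exactP (F l)).1 (eF l) i j k ij jk).
  by rewrite -prodCE dx.
exists (fun l => sval (cid (H l))); apply: prodP => l; rewrite prodCE.
exact: (svalP (cid (H l))).
Qed.

Lemma bal_prod C : fin_pres C -> (forall j, bal C (F j)) -> bal C prodC.
Proof.
move=> [a [b [p [q [pS pq]]]]] CF; apply: (elem_bal pS pq) => i j k ij jk x w xw.
have H l : exists yz : vec (F l i) a * vec (F l j) b,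
    (fun c => x c l) = vmap a (d (F l) i j) yz.1 + mxact (F l j) (\matrix_(l, c) q (delta_mx 0 l) 0 c) yz.2.
  have [|y [z yz]] := bal_elem pS pq (CF l) ij jk (x := fun c => x c l) (w := fun c => w c l).
    apply: prodP => c; rewrite vmapE -prodCE.
    have := congr1 (fun u : vec (prodC k) a => u c l) xw; rewrite /= => e.
    rewrite [LHS]e prod_sumE; by [].
  by exists (y, z).
exists (fun c l => (sval (cid (H l))).1 c), (fun c l => (sval (cid (H l))).2 c).
apply: prodP => c; apply: prodP => l.
have := congr1 (fun u : vec (F l j) a => u c) (svalP (cid (H l))); rewrite /= => e.
rewrite [LHS]e; congr (_ + _); by rewrite [RHS]prod_sumE.
Qed.
End Products.

Section GFlatProducts.
Variable R : comPzRingType.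
Hypothesis noethR : noetherian R.

(** The complex is reindexed so that the cycle module is in degree 0. *)
Lemma GFlat_resolution (M : lmodType R) : GFlat M -> exists F : complex R,
  [/\ exact F, forall i, flatI (F i), forall E, injective_module E -> bal E F &
    exists k : {linear M -> F 0}, injective k /\
      forall y, d F 0 (0 + 1) y = 0 <-> exists x, k x = y].
Proof.
move=> [F [eF Ff FI [i [k [kI kP]]]]]; exists (reindex F i); split.
- exact: reindex_exact.
- by move=> j; apply: flat_flatI; exact: Ff.
- move=> E EI Y YI a b c ab bc f fd.
  have bE := tensor_exact_bal (FI E EI).
  by apply: (bE Y YI (a + i) (b + i) (c + i)) fd; lia.
have G i' m : i' = i -> m = i + 1 -> exists k : {linear M -> F i'}, injective k /\
    forall y, d F i' m y = 0 <-> exists x, k x = y by move=> -> ->; exists k.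
by apply: (G (0 + i) (0 + 1 + i)); lia.
Qed.

(** The product T of the complexes consists of flats, because R is noetherian,
    and is exact. The module C, the leftmost term of P in [dual_resolution], is
    built from injectives and projectives by exactness of the cone, so that C (x) -
    is exact on each factor, hence on T ([bal_prod]). By [thick_R], it remains to
    consider Hom (Hom (C, V), E), which is [bal_hom_hom]. *)
Lemma GFlat_prod (J : Type) (M : J -> lmodType R) : has_dualizing_complex R ->
  (forall j, GFlat (M j)) -> GFlat (prodM M).
Proof.
move=> [D [[N D0] DI Dfg Dhom Dnull]] MG.
have H j := cid (GFlat_resolution (MG j)).
pose F j := sval (H j); pose T := prodC F.
have eF j : exact (F j) by have [] := svalP (H j).
have fF j i : flatI (F j i) by have [_ f _ _] := svalP (H j); exact: f.
have bF j E : injective_module E -> bal E (F j) by have [_ _ b _] := svalP (H j); exact: b.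
have kF j := cid (let: And4 _ _ _ k := svalP (H j) in k).
have eT : exact T by exact: prod_exact.
have fT i : flatI (T i).
  by apply: eqflat_flatI => //; apply: eqflat_prod => // j; exact: flatI_eqflat.
have [P [q [Pfg Pproj P0 [qs qa] cE]]] := dual_resolution noethR D0 Dfg.
have tR := thick_R D0 DI Dhom Dnull Pproj P0 qs qa cE.
set C := P (- N.+2%:Z) in tR.
have Cfp : fin_pres C := fin_gen_pres noethR (Pfg _).
pose A0 : mod_class R := fun M => injective_module M \/ projective M.
(* the cone in degree - N - 2 is C + D^(- N - 2), and its other terms belong to
   A0 or are sums of modules of A0 *)
have tC : thick A0 C.
  pose U := cone qs qa.
  have Ui i : thick A0 (D i) by apply: thick_base; left.
  apply: (thick_l (ses_pair C (D (- N.+2%:Z)))) (Ui _).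
  apply: (@thick_bounded R A0 U N.+2 (- N.+2%:Z)).
  - exact: (@cone_exact _ _ _ _ qs qa cE).
  - move=> i ii [x y]; congr (_, _); first by apply: P0; lia.
    by apply: D0; lia.
  move=> i ii; apply: (thick_m (ses_pair (P i) (D i))) (Ui _).
  by apply: thick_base; right; exact: Pproj.
have bC : bal C T.
  apply: bal_prod => // j; apply: (thick_bal (fF j) _ tC) => V [VI|VP]; first exact: bF.
  by apply: bal_flat => //; exact: projective_flatI.
have bT E : injective_module E -> bal E T.
  move=> EI; apply: bal_iso (hom_R_iso E) _.
  have flat_hom (V E' : lmodType R) : injective_module V -> injective_module E' -> flatI (hom V E').
    by move=> VI EI'; apply: eqflat_flatI => //; exact: (eqflat_hom_inj noethR VI EI').
  apply: (thick_bal_hom fT _ tR) => // V [VI|[V' VI ->]] {}E {}EI.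
    by apply: bal_flat => //; exact: flat_hom.
  have [a [b [p [r [pS pr]]]]] := Cfp.
  by apply: (bal_hom_hom pS pr bC) => //; exact: flat_hom.
exists T; split=> //.
- by move=> i; apply: flatI_flat.
- by move=> E EI; apply: bal_tensor_exact; exact: bT.
exists 0; exists (prod_map (fun j => hom_comp (sval (kF j)) (prod_proj M j))); split.
  apply/injmP => x kx; apply: prodP => j; have [kI _] := svalP (kF j).
  apply: kI; rewrite linear0; exact: (congr1 (fun z : prodM (fun j => F j 0) => z j) kx).
move=> y; split=> [yk|[x <-]].
  have G j : exists x, sval (kF j) x = y j.
    have [_ kP] := svalP (kF j); apply/(kP (y j)).
    exact: (congr1 (fun z : prodM (fun j => F j (0 + 1)) => z j) yk).
  exists (fun j => sval (cid (G j))); apply: prodP => j.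
  exact: (svalP (cid (G j))).
apply: prodP => j; have [_ kP] := svalP (kF j).
apply: (proj2 (kP _)); by exists (x j).
Qed.
End GFlatProducts.

(** * Gorenstein projective preenvelopes *)

Section Coproducts.
Variables (R : comPzRingType) (I : choiceType) (F : I -> lmodType R).
Variables (C : lmodType R) (inj : forall i, {linear F i -> C}).

Lemma coproduct_univ : @is_coproduct (Mod R) I F C inj ->
  forall (Y : lmodType R) (f : forall i, {linear F i -> Y}),
  exists u : {linear C -> Y}, forall i x, u (inj i x) = f i x.
Proof.
move=> CP Y f; have [u [uP _]] := CP Y f.
by exists u => i x; rewrite -[RHS](congr1 (fun g : hom _ _ => g x) (uP i)).
Qed.

Lemma coproduct_ext : @is_coproduct (Mod R) I F C inj ->
  forall (Y : lmodType R) (u v : {linear C -> Y}),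
  (forall i x, u (inj i x) = v (inj i x)) -> forall x, u x = v x.
Proof.
move=> CP Y u v uv x.
have [w [_ wu]] := CP Y (fun i => hom_comp u (inj i)).
have e1 : w = u by apply: wu.
have e2 : w = v by apply: wu => i; apply: homP => y; rewrite !hcompE uv.
by rewrite -e1 e2.
Qed.

Lemma coproductI :
  (forall (Y : lmodType R) (f : forall i, {linear F i -> Y}),
    exists u : {linear C -> Y}, forall i x, u (inj i x) = f i x) ->
  (forall (Y : lmodType R) (u v : {linear C -> Y}),
    (forall i x, u (inj i x) = v (inj i x)) -> forall x, u x = v x) ->
  @is_coproduct (Mod R) I F C inj.
Proof.
move=> ex uni Y f; have [u uP] := ex Y f.
exists u; split=> [i|v vP]; first by apply: homP => x; exact: uP.
apply: homP; apply: uni => i x.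
by rewrite uP -[LHS](congr1 (fun g : hom _ _ => g x) (vP i)).
Qed.

Fact coprojL i : linear (fun x : coprod F => sval x i). Proof. by []. Qed.
Definition coproj i : {linear coprod F -> F i} := mklin (coprojL i).
Lemma coproj_same i x : coproj i (coin F i x) = x. Proof. exact: coin_same. Qed.
Lemma coproj_diff i j x : i <> j -> coproj j (coin F i x) = 0.
Proof. exact: coin_diff. Qed.

(** The images of the generators have finite supports. *)
Lemma fin_gen_coprod (M : lmodType R) (f : {linear M -> coprod F}) : fin_gen M ->
  exists s, uniq s /\ forall m, f m = \sum_(i <- s) coin F i (coproj i (f m)).
Proof.
move=> /fin_genP[n [g gP]].
pose sk k := sval (cid (coprod_supp (f (g k)))).
have skP k i : i \notin sk k -> coproj i (f (g k)) = 0.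
  by have [_] := svalP (cid (coprod_supp (f (g k)))); apply.
exists (undup (flatten [seq sk k | k <- enum 'I_n])); split=> [|m]; first exact: undup_uniq.
apply: coprod_sum => [|i]; first exact: undup_uniq.
rewrite mem_undup => ni; rewrite -[LHS]/(hom_comp (coproj i) f m).
have [v <-] := gP m; rewrite rowmapE linear_sum big1 // => k _.
rewrite linearZ -[LHS]/(v 0 k *: coproj i (f (g k))) skP; first by rewrite scaler0.
apply: contra ni => ik.
by apply/flattenP; exists (sk k) => //; apply: map_f; rewrite mem_enum.
Qed.
End Coproducts.

Section Add.
Variables (R : comPzRingType) (A : mod_class R).
Implicit Types (M N X Y G : lmodType R).

Lemma Add_sub M : A M -> Add A M.
Proof.
move=> AM; exists unit, (fun _ => M), M, (fun _ => hom_id M); split=> //.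
  apply: coproductI => [Y f|Y u v uv x]; last exact: (uv tt).
  by exists (f tt) => -[].
by exists (hom_id M), (hom_id M).
Qed.

Lemma Add_zero M : zero_module M -> Add A M.
Proof.
move=> M0; exists void, (fun _ => M), M, (fun _ => hom_id M); split=> //.
  apply: coproductI => [Y f|Y u v uv x]; last by rewrite (M0 x) !linear0.
  by exists (0 : hom _ _) => -[].
by exists (hom_id M), (hom_id M).
Qed.

(** A presentation as a retract of a coproduct, as a record: for a family of
    modules, such presentations are then obtained by a single choice. *)
Record summand M := Summand {
  sI : choiceType; sF : sI -> lmodType R; sC : lmodType R;
  sinj : forall i, {linear sF i -> sC};
  sA : forall i, A (sF i); sP : @is_coproduct (Mod R) sI sF sC sinj;
  sec : {linear M -> sC}; ret : {linear sC -> M}; secK : cancel sec ret }.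

Lemma Add_coprod (J : choiceType) (F : J -> lmodType R) :
  (forall j, Add A (F j)) -> Add A (coprod F).
Proof.
move=> FA.
have [p _] : exists p : forall j, summand (F j), True.
  have H j : exists p : summand (F j), True.
    by have [I [G [C [inj [GA CP [s [r sr]]]]]]] := FA j; exists (Summand GA CP sr).
  by exists (fun j => sval (cid (H j))).
have [s sE] := coprod_univ (fun j => hom_comp (coin (fun j => sC (p j)) j) (sec (p j))).
have [r rE] := coprod_univ (fun j => hom_comp (coin F j) (ret (p j))).
exists {j : J & sI (p j)}, (fun t => sF (projT2 t)), (coprod (fun j => sC (p j))),
  (fun t => hom_comp (coin _ (projT1 t)) (sinj (projT2 t))); split.
- by move=> t; exact: sA.
- apply: coproductI => [Y f|Y u v uv].
    have H j := coproduct_univ (@sP _ (p j)) (fun i => f (existT _ j i)).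
    have [u uP] := coprod_univ (fun j => sval (cid (H j))).
    exists u => -[j i] x; rewrite hcompE uP; exact: (svalP (cid (H j))).
  apply: coprod_ext => j x; pose cj := coin (fun j => sC (p j)) j.
  apply: (coproduct_ext (@sP _ (p j)) (u := hom_comp u cj) (v := hom_comp v cj)) => i y.
  exact: (uv (existT _ j i)).
exists s, r => x; apply: (coprod_ext (u := hom_comp r s) (v := hom_id _)) => j y.
by rewrite hcompE sE hcompE rE hcompE secK.
Qed.

(** The image of M in the coproduct lies in a finite subcoproduct, and
    there the extension is done componentwise. *)
Lemma Add_extend M N (e : {linear M -> N}) X : fin_gen M -> Add A X ->
  (forall G (f : {linear M -> G}), A G -> exists g : {linear N -> G}, forall x, g (e x) = f x) ->
  forall f : {linear M -> X}, exists g : {linear N -> X}, forall x, g (e x) = f x.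
Proof.
move=> Mfg [I [F [C [inj [FA CP [s [r sr]]]]]]] ext f.
have [u uE] := coproduct_univ CP (coin F).
have [v vE] := coprod_univ inj.
have vu x : v (u x) = x.
  apply: (coproduct_ext CP (u := hom_comp v u) (v := hom_id _)) => i y.
  by rewrite hcompE uE vE.
pose f' := hom_comp u (hom_comp s f).
have [t [_ tE]] := fin_gen_coprod f' Mfg.
have gex i := ext (F i) (hom_comp (coproj F i) f') (FA i).
pose g : hom N C := \sum_(i <- t) hom_comp (inj i) (sval (cid (gex i))).
exists (hom_comp r g) => x; rewrite hcompE -[RHS]sr; congr (r _).
rewrite -[RHS]vu -[u _]/(f' x) [X in v X]tE hom_sumE linear_sum; apply: eq_bigr => i _.
by rewrite hcompE (svalP (cid (gex i))) vE hcompE.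
Qed.

Lemma Add_pure_projective X : (forall M, A M -> fin_pres M) -> Add A X -> pure_projective X.
Proof.
move=> Afp [I [F [C [inj [FA CP [s [r sr]]]]]]] Y Yp i f fd.
have H t : exists g : {linear F t -> Y (i - 1)}, forall x,
    d Y (i - 1) i (g x) = hom_comp f (hom_comp r (inj t)) x.
  by apply: (Yp _ (Afp _ (FA t))) => x; rewrite !hcompE fd.
have [g gE] := coproduct_univ CP (fun t => sval (cid (H t))).
exists (hom_comp g s) => x; rewrite hcompE -[RHS](congr1 f (sr x)).
apply: (coproduct_ext CP (u := hom_comp (d Y (i - 1) i) g) (v := hom_comp f r)) => t y.
by rewrite !hcompE gE (svalP (cid (H t))) !hcompE.
Qed.
End Add.

Section Preenvelope.
Variable R : comPzRingType.
Hypothesis noethR : noetherian R.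
Implicit Types (M N G : lmodType R).

(** The diagram with one object and one arrow. *)
Lemma filtered_colimits_self (A : mod_class R) M : A M -> filtered_colimits A M.
Proof.
move=> AM.
pose I := @SmallCategory unit (fun _ _ => unit) (fun _ => tt) (fun _ _ _ _ _ => tt)
  (fun _ _ a => let: tt := a in erefl) (fun _ _ a => let: tt := a in erefl)
  (fun _ _ _ _ _ _ _ => erefl).
pose F := @Functor I (Mod R) (fun _ => M) (fun _ _ _ => hom_id M) (fun _ => erefl)
  (fun _ _ _ _ _ => esym (hom_comp1m _)).
exists I, F, (fun _ => hom_id M); split=> //.
  split; first by exists tt.
    by move=> i j; exists tt, tt, tt.
  by move=> i j a b; exists tt, tt.
split=> [i j a|Y f _]; first exact: hom_comp1m.
exists (f tt); split=> [[]|u uP]; first exact: hom_compm1.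
by rewrite -(uP tt); exact: hom_compm1.
Qed.

Lemma GFlat_iso M N : isomorphic M N -> GFlat N -> GFlat M.
Proof.
move=> [f fb] [F [eF Ff FI [i [k [kI kP]]]]]; exists F; split=> //.
exists i, (hom_comp k f); split=> [|y]; first exact: (inj_comp kI (bij_inj fb)).
split=> [/kP[x <-]|[x <-]]; last by apply/kP; exists (f x).
by have [g _ gK] := fb; exists (g x); rewrite hcompE gK.
Qed.

Hypothesis dualR : has_dualizing_complex R.
Hypothesis GFlat_colim : forall M, filtered_colimits (@Gproj R) M <-> GFlat M.

(** All arrows from M to Gorenstein flat modules that are quotients of row
    modules. Up to isomorphism, these include the arrows from M to Gorenstein
    projective modules, and they form a set. *)
Record arrow_from M := ArrowFrom {
  an : nat; aS : submod 'rV[R]_an;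
  aG : GFlat (quotM aS); af : {linear M -> quotM aS} }.

(** The arrow from M to the product of the targets of all [arrow_from] M. The
    product is a filtered colimit of Gorenstein projectives, and M is finitely
    presented, so the arrow factors through one of them. Every arrow from M to a
    Gorenstein projective module factors through the product, hence through that
    module. *)
Lemma Gproj_preenvelope M : fin_gen M -> exists G (e : {linear M -> G}),
  Gproj G /\ forall (G' : lmodType R) (f : {linear M -> G'}), Gproj G' ->
    exists g : {linear G -> G'}, forall x, g (e x) = f x.
Proof.
move=> Mfg.
pose P := prodM (fun a : arrow_from M => quotM (aS a)).
have PG : GFlat P by apply: (GFlat_prod noethR dualR) => a; exact: aG.
have [I [F [c [fI FG cP]]]] := (GFlat_colim P).2 PG.
pose f : {linear M -> P} := prod_map (fun a : arrow_from M => af a).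
have [i [e eP]] := fcolim_fp fI (colim_fcolim fI cP) f (fin_gen_pres noethR Mfg).
exists (F i), e; split=> // G' f' G'G.
have [G'fg _ _ _] := G'G.
have [n [T [h hb]]] := fin_gen_quot G'fg.
have hi : injm h by apply/injmP; exact: (bij_inj hb).
have hs : surjm h by have [k _ kK] := hb => y; exists (k y).
have [k [hk kh]] := bij_inv hi hs.
have TG : GFlat (quotM T).
  apply: (@GFlat_iso _ G'); first by exists k; exists h.
  by apply/GFlat_colim; exact: filtered_colimits_self.
pose a := ArrowFrom TG (hom_comp h f').
exists (hom_comp k (hom_comp (prod_proj _ a) (c i))) => x.
by rewrite !hcompE eP -[X in k X]/(h (f' x)) hk.
Qed.
End Preenvelope.

(** * Coresolutions by preenvelopes *)

Section Coresolution.
Variables (R : comPzRingType) (X : mod_class R).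
Implicit Types (M N Y : lmodType R).

(** An X-preenvelope with finitely generated target. *)
Record envelope M := Envelope {
  eN : lmodType R; ee : {linear M -> eN}; efg : fin_gen eN; eX : X eN;
  eext : forall Y, X Y -> forall f : {linear M -> Y},
    exists g : {linear eN -> Y}, forall x, g (ee x) = f x }.

(** An X-coresolution of M starting in degree k: the complex
    0 -> M -> C^k -> C^(k+1) -> ... becomes exact under Hom (-, Y) for Y in X. *)
Record coresolution (k : int) M := Coresolution {
  rC :> complex R; re : {linear M -> rC k};
  rX : forall i, X (rC i);
  r0 : forall i, i < k -> zero_module (rC i);
  rde : forall j m, d rC k j (re m) = 0;
  rext : forall Y, X Y -> forall f : {linear M -> Y},
    exists g : {linear rC k -> Y}, forall x, g (re x) = f x;
  rext1 : forall Y, X Y -> forall l (f : {linear rC k -> Y}), l = k + 1 ->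
    (forall m, f (re m) = 0) -> exists g : {linear rC l -> Y}, forall x, g (d rC k l x) = f x;
  rext2 : forall Y, X Y -> forall i j l (f : {linear rC j -> Y}),
    k <= i -> j = i + 1 -> l = j + 1 -> (forall x, f (d rC i j x) = 0) ->
    exists g : {linear rC l -> Y}, forall x, g (d rC j l x) = f x }.

Hypothesis X0 : forall M, zero_module M -> X M.
Hypothesis preX : forall M, fin_gen M -> exists e : envelope M, True.

Definition env M (Mfg : fin_gen M) : envelope M := sval (cid (preX Mfg)).
Definition envelope0 : envelope 'rV[R]_0.
Proof.
apply: (@Envelope _ 'rV[R]_0 (hom_id _) (fin_gen_row _ 0) (X0 (@zero_row0 R))) => Y _ f.
by exists f.
Defined.
(** A module together with its envelope. The stages M_i of the construction are
    M in degree 0, the cokernel of the previous envelope to the right of it,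
    and zero to the left. *)
Definition costage := {M : lmodType R & envelope M}.
Definition st0 M (Mfg : fin_gen M) : costage := existT _ M (env Mfg).
Definition fg_cok (s : costage) : fin_gen (cokM (ee (projT2 s))) :=
  fin_gen_surj (@qpi_surj _ _ _) (efg (projT2 s)).
Definition st_next (s : costage) : costage := st0 (fg_cok s).
Definition st_prev (s : costage) : costage := existT envelope 'rV[R]_0 envelope0.

Variables (M : lmodType R) (Mfg : fin_gen M).
Definition stg (i : int) : costage := zseq (st0 Mfg) st_next st_prev i.
Definition cA i : lmodType R := eN (projT2 (stg i)).
Definition cE i : {linear projT1 (stg i) -> cA i} := ee (projT2 (stg i)).

Lemma cA_zero i : i < 0 -> zero_module (cA i).
Proof. by rewrite /cA /stg /zseq; case: i => // n _; exact: zero_row0. Qed.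

Lemma cp_ex i : exists p : {linear cA i -> projT1 (stg (i + 1))},
  (forall x, p (cE i x) = 0) /\
  (0 <= i -> surjm p /\ forall x, p x = 0 -> exists y, cE i y = x).
Proof.
apply: (@zseqP _ (st0 Mfg) st_next st_prev (fun i s t =>
  exists p : {linear eN (projT2 s) -> projT1 t}, (forall x, p (ee (projT2 s) x) = 0) /\
  (0 <= i -> surjm p /\ forall x, p x = 0 -> exists y, ee (projT2 s) y = x))) => n.
  exists (qpi _); split=> [x|_]; first by apply/qpi_ker; exists x.
  by split=> [|x /qpi_ker//]; exact: qpi_surj.
by exists (0 : hom _ _); split.
Qed.
Definition cp i := sval (cid (cp_ex i)).
Lemma cpE i x : cp i (cE i x) = 0.
Proof. by have [-> _] := svalP (cid (cp_ex i)). Qed.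
Lemma cp_surj i : 0 <= i -> surjm (cp i).
Proof. by have [_ H] := svalP (cid (cp_ex i)) => /H[]. Qed.
Lemma cp_ker i x : 0 <= i -> cp i x = 0 -> exists y, cE i y = x.
Proof. by have [_ H] := svalP (cid (cp_ex i)) => /H[_]; apply. Qed.

Definition cd i : {linear cA i -> cA (i + 1)} := hom_comp (cE (i + 1)) (cp i).
Lemma cd2 i x : cd (i + 1) (cd i x) = 0.
Proof. by rewrite -[LHS]/(cE _ (cp _ (cE _ (cp i x)))) cpE linear0. Qed.
Definition cores : complex R := mkc cd2.
Lemma cores_d i x : d cores i (i + 1) x = cE (i + 1) (cp i x).
Proof. by rewrite mkcE. Qed.

(** A map killing the image of M_i factors through the cokernel M_(i+1), and
    from there extends along the envelope. *)
Lemma cores_ext Y i (f : {linear cA i -> Y}) : X Y -> 0 <= i ->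
  (forall x, f (cE i x) = 0) ->
  exists g : {linear cores (i + 1) -> Y}, forall x, g (d cores i (i + 1) x) = f x.
Proof.
move=> XY i0 fe.
have [|g gP] := factor_surj (cp_surj i0) (f := f).
  by move=> x /(cp_ker i0)[y <-].
have [h hP] := eext (projT2 (stg (i + 1))) XY g; exists h => x.
by rewrite cores_d hP gP.
Qed.

Lemma coresolution_ex k : exists c : coresolution k M, True.
Proof.
(* stated in a degree j equal to 0, to be used for j = k - k *)
have G j : j = 0 -> exists e : {linear M -> cores j}, [/\ forall l m, d cores j l (e m) = 0,
    forall Y, X Y -> forall f : {linear M -> Y},
      exists g : {linear cores j -> Y}, forall x, g (e x) = f x &
    forall Y, X Y -> forall l (f : {linear cores j -> Y}), l = j + 1 ->
      (forall m, f (e m) = 0) -> exists g : {linear cores l -> Y}, forall x, g (d cores j l x) = f x].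
  move=> ->; exists (cE 0); split.
  - move=> l m; have [->|l1] := eqVneq l (0 + 1); last by rewrite d_shape.
    by rewrite cores_d cpE linear0.
  - by move=> Y XY f; exact: (eext (env Mfg) XY f).
  by move=> Y XY l f -> fe; exact: cores_ext.
have H Y i j l (f : {linear cores j -> Y}) : X Y -> 0 <= i -> j = i + 1 -> l = j + 1 ->
    (forall x, f (d cores i j x) = 0) ->
    exists g : {linear cores l -> Y}, forall x, g (d cores j l x) = f x.
  move=> XY i0 ji lj fd; subst j l; apply: cores_ext => // [|x]; first lia.
  by have [y <-] := cp_surj i0 x; rewrite -cores_d fd.
have [e [e1 e2 e3]] := G (k - k) (subrr k).
have zero i : i < k -> zero_module (reindex cores (- k) i).
  by move=> ik; apply: cA_zero; lia.
have ext1 Y (XY : X Y) l (f : {linear reindex cores (- k) k -> Y}) (lk : l = k + 1) :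
    (forall m, f (e m) = 0) ->
    exists g : {linear reindex cores (- k) l -> Y}, forall x, g (d (reindex cores (- k)) k l x) = f x.
  by apply: e3 => //; lia.
have ext2 Y (XY : X Y) i j l (f : {linear reindex cores (- k) j -> Y})
    (ki : k <= i) (ji : j = i + 1) (lj : l = j + 1) :
    (forall x, f (d (reindex cores (- k)) i j x) = 0) ->
    exists g : {linear reindex cores (- k) l -> Y}, forall x, g (d (reindex cores (- k)) j l x) = f x.
  by apply: H => //; lia.
by exists (@Coresolution k M (reindex cores (- k)) e (fun i => eX _) zero (fun j => e1 _) e2 ext1 ext2).
Qed.
End Coresolution.

Section MapsOut.
Variables (R : comPzRingType) (X : mod_class R) (k : int) (M : lmodType R).
Variables (C : coresolution X k M) (Y : complex R).
Hypothesis YX : forall i, X (Y i).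

(** The components of the chain map are constructed upwards by the extension
    properties of the coresolution. *)
Lemma coresolution_map (f : {linear M -> Y k}) : (forall x, d Y k (k + 1) (f x) = 0) ->
  exists F : chain_map C Y, forall x, F k (re C x) = f x.
Proof.
move=> fd; have [f0 f0P] := rext C (YX k) f.
have [||h [h0 hP]] := @int_rec_up (fun i => hom (C i) (Y i)) k (fun i => 0)
  (fun i p => exists p' : {linear C (i + 1) -> Y (i + 1)},
     forall x, p' (d C i (i + 1) x) = d Y i (i + 1) (p x))
  (fun i p p' => forall x, p' (d C i (i + 1) x) = d Y i (i + 1) (p x)) f0.
- apply: (rext1 (YX (k + 1)) (f := hom_comp (d Y k (k + 1)) f0)) => // m.
  by rewrite hcompE f0P.
- move=> i p ki [p' p'P]; exists p'; split=> //.
  apply: (rext2 (YX (i + 1 + 1)) (i := i) (f := hom_comp (d Y (i + 1) (i + 1 + 1)) p')) => // x.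
  by rewrite hcompE p'P d_comp.
have hc i j x : h j (d C i j x) = d Y i j (h i x).
  have [->|ij] := eqVneq j (i + 1); last by rewrite !d_shape // linear0.
  have [ki|ki] := leP k i; first by have [_] := hP i ki; exact.
  by rewrite (r0 ki x) !linear0.
by exists (ChainMap hc) => x; rewrite /= h0 f0P.
Qed.

(** A homotopy is constructed upwards in the same way as in [coresolution_map],
    starting from an extension of t. *)
Lemma coresolution_null (F : chain_map C Y) : null_homotopic F <->
  exists t : {linear M -> Y (k - 1)}, forall x, F k (re C x) = d Y (k - 1) k (t x).
Proof.
split=> [[s sP]|[t tP]].
  exists (hom_comp (s k (k - 1)) (re C)) => x.
  by rewrite sP rde linear0 addr0.
have [t0 t0P] := rext C (YX (k - 1)) t.
pose Rel i (p : forall j, hom (C i) (Y j)) (p' : forall j, hom (C (i + 1)) (Y j)) :=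
  forall x, F i x = d Y (i - 1) i (p (i - 1) x) + p' i (d C i (i + 1) x).
have mk i (p : forall j, hom (C i) (Y j)) (g : {linear C (i + 1) -> Y i}) :
    (forall x, g (d C i (i + 1) x) = F i x - d Y (i - 1) i (p (i - 1) x)) ->
    Rel i p (fun j => castY g j).
  by move=> gP x; rewrite castY_same gP addrC subrK.
have [||h [h0 hP]] := @int_rec_up (fun i => forall j, hom (C i) (Y j)) k (fun i j => 0)
  (fun i p => exists p', Rel i p p') Rel (fun j => castY t0 j).
- have [|g gP] := rext1 (YX k) (c := C) (l := k + 1)
      (f := hsub (F k) (hom_comp (d Y (k - 1) k) t0)) erefl.
    by move=> m; rewrite hsubE hcompE t0P tP subrr.
  exists (fun j => castY g j); apply: mk => x.
  by rewrite gP castY_same.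
- move=> i p ki [p' p'P]; exists p'; split=> //.
  have [||||g gP] := rext2 (YX (i + 1)) (c := C) (i := i) (j := i + 1) (l := i + 1 + 1)
    (f := hsub (F (i + 1)) (hom_comp (d Y i (i + 1)) (p' i))).
  + exact: ki.
  + by [].
  + by [].
  + move=> x; rewrite hsubE hcompE cmapP p'P linearD d_comp add0r subrr //.
  exists (fun j => castY g j); apply: mk => x.
  rewrite gP hsubE hcompE; congr (_ - _).
  by have -> : i + 1 - 1 = i by rewrite addrK.
exists (fun i j => h i j) => i x.
have [ki|ki] := leP k i; first by have [_] := hP i ki; exact.
by rewrite (r0 ki x) !linear0 addr0.
Qed.
End MapsOut.

(** * Coproducts and compact objects in the homotopy category *)

Local Open Scope quotient_scope.

Section Preadditive.
Variable T : preadditive.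
Implicit Types X Y Z : T.

Lemma compm0 X Y Z (g : Hom Y Z) : comp g (0 : Hom X Y) = 0.
Proof. by apply: (addrI (comp g 0)); rewrite -compDr !addr0. Qed.

Lemma comp_sumr X Y Z (g : Hom Y Z) (J : Type) (s : seq J) (f : J -> Hom X Y) :
  comp g (\sum_(j <- s) f j) = \sum_(j <- s) comp g (f j).
Proof.
by apply: (big_morph (comp g)) => [a b|]; [exact: compDr|exact: compm0].
Qed.

Lemma zero_object_id X : idm X = 0 -> is_zero_object X.
Proof.
move=> X0 Y; split=> f; first by rewrite -[f]compm1 X0 compm0.
have comp0m (h : Hom Y X) : comp (0 : Hom X X) h = 0.
  by apply: (addrI (comp (0 : Hom X X) h)); rewrite -compDl !addr0.
by rewrite -[f]comp1m X0 comp0m.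
Qed.

Lemma coproduct_iso (I : choiceType) (X : I -> T) C C' (inj : forall i, Hom (X i) C)
    (inj' : forall i, Hom (X i) C') : is_coproduct inj -> is_coproduct inj' ->
  exists (u : Hom C C') (v : Hom C' C), [/\ forall i, comp u (inj i) = inj' i,
    forall i, comp v (inj' i) = inj i & comp v u = idm C].
Proof.
move=> cC cC'; have [u [uP _]] := cC _ inj'; have [v [vP _]] := cC' _ inj.
exists u, v; split=> //; have [w [_ wP]] := cC _ inj.
rewrite -(wP (comp v u)); last by move=> i; rewrite -compA uP vP.
by apply: wP => i; rewrite comp1m.
Qed.

(** Any two coproducts of a family are isomorphic, so that compactness can be
    tested on one of them. *)
Lemma compact_of C : (forall (I : choiceType) (X : I -> T),
    exists (Y : T) (inj : forall i, Hom (X i) Y), [/\ is_coproduct inj,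
    forall f : Hom C Y, exists (s : seq I) (g : forall i, Hom C (X i)),
      uniq s /\ f = \sum_(i <- s) comp (inj i) (g i) &
    forall (s : seq I) (g : forall i, Hom C (X i)), uniq s ->
      \sum_(i <- s) comp (inj i) (g i) = 0 -> forall i, i \in s -> g i = 0]) ->
  compact C.
Proof.
move=> H I X Y inj cY; have [Y' [inj' [cY' H1 H2]]] := H I X.
have [u [v [uE vE vu]]] := coproduct_iso cY cY'; split=> [f|s g us e].
  have [s [g [us e]]] := H1 (comp u f); exists s, g; split=> //.
  rewrite -[f]comp1m -vu -compA e comp_sumr; apply: eq_bigr => i _.
  by rewrite compA vE.
apply: (H2 s g us); transitivity (comp u (\sum_(i <- s) comp (inj i) (g i))).
  by rewrite comp_sumr; apply: eq_bigr => i _; rewrite compA uE.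
by rewrite e compm0.
Qed.
End Preadditive.

Section ComplexCoproducts.
Variables (R : comPzRingType) (I : choiceType).

Section Map.
Variables F G : I -> lmodType R.
Variable f : forall t, {linear F t -> G t}.
Definition comap : {linear coprod F -> coprod G} :=
  sval (cid (coprod_univ (fun t => hom_comp (coin G t) (f t)))).
Lemma comap_in t x : comap (coin F t x) = coin G t (f t x).
Proof. exact: (svalP (cid (coprod_univ _))). Qed.
Lemma comap_proj t c : coproj G t (comap c) = f t (coproj F t c).
Proof.
apply: (coprod_ext (u := hom_comp (coproj G t) comap) (v := hom_comp (f t) (coproj F t))).
move=> s x; rewrite !hcompE comap_in.
have [e|st] := eqVneq s t; first by subst s; rewrite !coproj_same.
by rewrite !coproj_diff ?linear0 //; apply/eqP.
Qed.
End Map.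

Variable Y : I -> complex R.
Lemma coprodC_shape i j : j != i + 1 -> forall x, comap (fun t => d (Y t) i j) x = 0.
Proof.
move=> ij; apply: (coprod_ext (v := (0 : hom _ _))) => t x.
by rewrite comap_in d_shape // linear0.
Qed.
Lemma coprodC_comp i j k x :
  comap (fun t => d (Y t) j k) (comap (fun t => d (Y t) i j) x) = 0.
Proof.
apply: (coprod_ext (u := hom_comp (comap _) (comap _)) (v := (0 : hom _ _))) => t y.
by rewrite hcompE !comap_in d_comp linear0.
Qed.
Definition coprodC : complex R := Complex coprodC_shape coprodC_comp.

Lemma coinC_map t i j x :
  coin (fun t => Y t j) t (d (Y t) i j x) = d coprodC i j (coin (fun t => Y t i) t x).
Proof. by rewrite [RHS]comap_in. Qed.
Definition coinC t : chain_map (Y t) coprodC :=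
  @ChainMap R (Y t) coprodC (fun i => coin (fun t => Y t i) t) (coinC_map (t := t)).

Lemma coprodC_univ (Z : complex R) (f : forall t, chain_map (Y t) Z) :
  exists u : chain_map coprodC Z, forall t i x, u i (coinC t i x) = f t i x.
Proof.
pose u i := sval (cid (coprod_univ (fun t => f t i))).
have uE i t x : u i (coin (fun t => Y t i) t x) = f t i x := svalP (cid (coprod_univ _)) t x.
have uP i j x : u j (d coprodC i j x) = d Z i j (u i x).
  apply: (coprod_ext (u := hom_comp (u j) (d coprodC i j)) (v := hom_comp (d Z i j) (u i))).
  by move=> t y; rewrite !hcompE -coinC_map !uE cmapP.
by exists (@ChainMap R coprodC Z u uP) => t i x; exact: uE.
Qed.

(** Homotopies are glued by the universal property of the coproduct in each
    pair of degrees. *)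
Lemma coprodC_null (Z : complex R) (u : chain_map coprodC Z) :
  (forall t, null_homotopic (chain_comp u (coinC t))) -> null_homotopic u.
Proof.
move=> H; pose s t := sval (cid (H t)).
have sP t i x : u i (coinC t i x) = d Z (i - 1) i (s t i (i - 1) x) +
   s t (i + 1) i (d (Y t) i (i + 1) x) := svalP (cid (H t)) i x.
pose S i j := sval (cid (coprod_univ (fun t => s t i j))).
have SE i j t x : S i j (coin (fun t => Y t i) t x) = s t i j x := svalP (cid (coprod_univ _)) t x.
exists S => i; pose v := hadd (hom_comp (d Z (i - 1) i) (S i (i - 1)))
  (hom_comp (S (i + 1) i) (d coprodC i (i + 1))).
apply: (coprod_ext (v := v)) => t x.
by rewrite haddE !hcompE -coinC_map !SE -sP.
Qed.
End ComplexCoproducts.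

Section HomotopyCategory.
Variables (R : comPzRingType) (X : mod_class R).
Hypothesis Xcoprod : forall (I : choiceType) (F : I -> lmodType R),
  (forall i, X (F i)) -> X (coprod F).

Lemma pi_null (Y Z : complex R) (f : chain_map Y Z) :
  \pi_(htp_class Y Z) f = 0 <-> null_homotopic f.
Proof.
have e : f - 0 = f by rewrite subr0.
split=> [f0|fn]; last by rewrite -[RHS](raddf0 (\pi_(htp_class Y Z))); apply/eqP/htp_piP; rewrite e.
by rewrite -e; apply/htp_piP; rewrite f0 raddf0.
Qed.

Lemma chain_sumE (Y Z : complex R) (J : Type) (s : seq J) (f : J -> chain_map Y Z) i x :
  (\sum_(j <- s) f j) i x = \sum_(j <- s) f j i x.
Proof.
by elim: s => [|j s IH]; rewrite ?big_nil // !big_cons -IH.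
Qed.

Definition mkK (C : complex R) (CX : forall i, X (C i)) : K X :=
  exist (fun C : complex R => forall i, X (C i)) C CX.

Section Coproduct.
Variables (I : choiceType) (Y : I -> K X).
Definition coprodK : K X :=
  mkK (C := coprodC (fun t => sval (Y t))) (fun i => Xcoprod (fun t => svalP (Y t) i)).
Definition coinK t : Hom (Y t) coprodK :=
  \pi_(htp_class (sval (Y t)) (sval coprodK)) (coinC (fun t => sval (Y t)) t).

Lemma coprodKP : is_coproduct coinK.
Proof.
move=> Z f.
have [u uE] := coprodC_univ (fun t => repr (f t)).
have uP t : comp (\pi_(htp_class (sval coprodK) (sval Z)) u : Hom coprodK Z) (coinK t) = f t.
  rewrite -[RHS]reprK -[LHS]/(htp_comp _ _) htp_comp_pi.
  by congr (\pi_(htp_class _ _) _); apply: chain_map_eq => i x; exact: uE.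
exists (\pi_(htp_class _ _) u); split=> // v vP.
rewrite -[RHS]reprK; apply/eqP/htp_piP; apply: coprodC_null => t.
have e : \pi_(htp_class _ _) (chain_comp (repr v) (coinC (fun t => sval (Y t)) t)) = f t.
  by rewrite -htp_comp_pi reprK; exact: vP.
have e' : \pi_(htp_class _ _) (chain_comp u (coinC (fun t => sval (Y t)) t)) = f t.
  by rewrite -htp_comp_pi; exact: uP.
have /eqP/htp_piP := etrans e' (esym e).
by congr null_homotopic; apply: chain_map_eq.
Qed.
End Coproduct.

Lemma K_coproducts : has_coproducts (K X).
Proof. by move=> I Y; exists (coprodK Y), (coinK Y); exact: coprodKP. Qed.

(** By [coresolution_map] and [coresolution_null], maps from C to a complex over X
    are classes of cocycles on M. On a coproduct of complexes, a cocycle with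
    values in the coproduct has only finitely many nonzero components, because M
    is finitely generated. *)
Lemma coresolution_compact k M (C : coresolution X k M) : fin_gen M ->
  compact (mkK (rX C)).
Proof.
move=> Mfg; apply: compact_of => I Y; exists (coprodK Y), (coinK Y).
pose Ys t := sval (Y t); pose S := coprodC Ys.
have SX i : X (S i) := svalP (coprodK Y) i.
pose CK : K X := mkK (rX C).
pose cls t (G : chain_map C (Ys t)) : Hom CK (Y t) := \pi_(htp_class C (Ys t)) G.
have sumE (s : seq I) (G : forall t, chain_map C (Ys t)) :
    \sum_(t <- s) (comp (coinK Y t) (cls t (G t)) : htp_class C S) =
    \pi_(htp_class C S) (\sum_(t <- s) chain_comp (coinC Ys t) (G t)).
  by rewrite raddf_sum; apply: eq_bigr => t _; rewrite -[LHS]/(htp_comp _ _) htp_comp_pi.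
split=> [|f|s g us]; first exact: coprodKP.
  pose F : chain_map C S := repr (f : htp_class C S).
  pose phi := hom_comp (F k) (re C).
  have [s [us sP]] := fin_gen_coprod phi Mfg.
  have cyc t x : d (Ys t) k (k + 1) (hom_comp (coproj _ t) phi x) = 0.
    rewrite hcompE -(comap_proj (fun t => d (Ys t) k (k + 1))) -[comap _ _]/(d S _ _ (F k _)).
    by rewrite -cmapP rde !linear0.
  pose G t := sval (cid (coresolution_map C (svalP (Y t)) (cyc t))).
  have GE t x : G t k (re C x) = coproj _ t (phi x) :=
    svalP (cid (coresolution_map C (svalP (Y t)) (cyc t))) x.
  exists s, (fun t => cls t (G t)); split=> //.
  pose H : chain_map C S := \sum_(t <- s) chain_comp (coinC Ys t) (G t).
  rewrite -[RHS]/(\sum_(t <- s) (comp (coinK Y t) (cls t (G t)) : htp_class C S)).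
  rewrite sumE -[LHS]reprK; apply/eqP/htp_piP/(coresolution_null SX).
  exists (0 : hom _ _) => x; rewrite linear0 -[LHS]/(phi x - H k (re C x)).
  rewrite chain_sumE sP; apply/eqP; rewrite subr_eq0; apply/eqP; apply: eq_bigr => t _.
  by rewrite -[RHS]/(coin _ t (G t k (re C x))) GE.
pose G t : chain_map C (Ys t) := repr (g t : htp_class C (Ys t)).
have gE t : cls t (G t) = g t by exact: reprK.
move=> e i si.
have {}e : \sum_(t <- s) (comp (coinK Y t) (cls t (G t)) : htp_class C S) = 0.
  by rewrite -[RHS]e; apply: eq_bigr => t _; rewrite gE.
move: e; rewrite sumE => /pi_null/(coresolution_null SX)[th thP].
rewrite -gE; apply/pi_null/(coresolution_null (svalP (Y i))).
exists (hom_comp (coproj _ i) th) => x; rewrite hcompE.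
rewrite -(comap_proj (fun t => d (Ys t) (k - 1) k)) -[comap _ _]/(d S _ _ (th x)) -thP.
rewrite chain_sumE linear_sum (bigD1_seq i) //= [X in _ + X]big1 ?addr0.
  by rewrite -[RHS]/(coproj _ i (coin _ i _)) coproj_same.
move=> t ti; rewrite -[LHS]/(coproj _ i (coin _ t _)) coproj_diff //.
by apply/eqP.
Qed.
End HomotopyCategory.

(** * Pure exact complexes and generation *)

Local Open Scope quotient_scope.

Section Comparison.
Variables (R : comPzRingType) (U V : complex R) (a : int).
Hypothesis UV : forall i, i <= a -> hom_exact (U i) V.

(** One half of the comparison theorem for resolutions: the components are lifted
    one after the other, going down, since Hom (U i, V) is exact. *)
Lemma compare_map (f : {linear U a -> V a}) :
  (forall i l x, a = i + 1 -> l = a + 1 -> d V a l (f (d U i a x)) = 0) ->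
  exists h : forall i, {linear U i -> V i}, h a = f /\
    forall i j x, j = i + 1 -> j <= a -> d V i j (h i x) = h j (d U i j x).
Proof.
move=> fd.
have [||h [h0 hP]] := @int_rec_down (fun i => hom (U i) (V i)) a (fun i => 0)
  (fun i p => forall j l x, i = j + 1 -> l = i + 1 -> d V i l (p (d U j i x)) = 0)
  (fun i p p' => forall x, d V (i - 1) i (p' x) = p (d U (i - 1) i x)) f.
- exact: fd.
- move=> i p ia pP.
  have [||g gP] := UV (i := i - 1) _ (f := hom_comp p (d U (i - 1) i)); first by lia.
    by move=> x; rewrite hcompE; apply: pP; lia.
  exists g; split=> [x|j l x ij li]; first by rewrite gP.
  have {}li : l = i by lia.
  by subst l; rewrite gP hcompE d_comp linear0.
exists h; split=> // i j x ij ja; have [_ H] := hP j ja.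
have e : i = j - 1 by lia.
by subst i; exact: H.
Qed.

(** The other half of the comparison theorem, with the same recursion for the
    homotopy. *)
Lemma compare_null (f : forall i, {linear U i -> V i}) :
  (forall i j x, j = i + 1 -> j <= a -> d V i j (f i x) = f j (d U i j x)) ->
  (forall x, d V a (a + 1) (f a x) = 0) ->
  exists h : forall i j, {linear U i -> V j}, forall i j l x, j = i + 1 -> l = j + 1 -> l <= a ->
    f j x = d V i j (h j i x) + h l j (d U j l x).
Proof.
move=> fc fd; have [g0 g0P] := UV (lexx a) fd.
have [||h [h0 hP]] := @int_rec_down (fun i => forall j, hom (U i) (V j)) a (fun i j => 0)
  (fun i p => forall j x, i = j + 1 -> d V j i (p j (d U j i x)) = f i (d U j i x))
  (fun i p p' => forall j x, i - 1 = j + 1 ->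
     f (i - 1) x = d V j (i - 1) (p' j x) + p (i - 1) (d U (i - 1) i x)) (fun j => castY g0 j).
- move=> j x aj; have e : j = a - 1 by lia.
  by subst j; rewrite castY_same g0P.
- move=> i p ia pP; have e1 : i = i - 1 + 1 by lia.
  have e2 : i - 1 = i - 1 - 1 + 1 by lia.
  have UVi : hom_exact (U (i - 1)) V by apply: UV; lia.
  have [|g gP] := (hom_exactP _ _).1 UVi _ _ i e2 e1
     (hsub (f (i - 1)) (hom_comp (p (i - 1)) (d U (i - 1) i))).
    move=> x; rewrite hsubE hcompE linearB pP // (fc (i - 1) i) ?subrr //.
  exists (fun j => castY g j); split=> j x ij; have e : j = i - 1 - 1 by lia.
    by subst j; rewrite castY_same gP hsubE hcompE subrK.
  by subst j; rewrite castY_same gP hsubE hcompE d_comp linear0 subr0.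
exists h => i j l x ji lj la; have [_ H] := hP l la.
have e : j = l - 1 by lia.
by move: ji x; rewrite e => ji x; exact: (H i x ji).
Qed.
End Comparison.

Section Contraction.
Variable R : comPzRingType.
Implicit Types (M N : lmodType R).

Lemma reindex_hom_exact (X : complex R) c N : hom_exact N X -> hom_exact N (reindex X c).
Proof.
move=> /hom_exactP H; apply/hom_exactP => i j k -> -> f fd.
by apply: (H (i + c) (i + 1 + c) (i + 1 + 1 + c)) => //; lia.
Qed.

Variable X : complex R.
Hypothesis Xpure : pure_exact X.
Hypothesis Xproj : forall i, pure_projective (X i).

(** Compare the part of X to the left of the cycle module in degree m + n + 2
    with a pure projective resolution Y of that cycle module, of length n. Both
    are pure exact with pure projective terms, so that there are comparison maps
    al and be, and be al is homotopic to the identity. In the degree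
    corresponding to m the complex Y vanishes, and the homotopy contracts the
    identity of X there: it splits the cycles. *)
Lemma cycles_split (n : nat) m m0 : m = m0 + 1 ->
  (forall N, exists Y : complex R, [/\ left_augmented (@pure_projective R) N Y, pure_exact Y &
        forall i, i < - n%:Z -> zero_module (Y i)]) ->
  exists h : {linear X m -> X m0}, forall x, d X m (m + 1) x = 0 -> d X m0 m (h x) = x.
Proof.
move=> mm0 pgl; pose c := m + n%:Z + 1; pose U := reindex X c.
have Upure : pure_exact U by move=> N Nfp; apply: reindex_hom_exact; exact: Xpure.
have [Y [[[iso isob] Y2 Yproj] Ypure Y0]] := pgl (cyc U 1).
have UY i : hom_exact (U i) Y by exact: (Xproj Ypure).
have YU i : i <= 0 -> hom_exact (Y i) U by move=> i0; exact: (Yproj i i0 _ Upure).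
have isoi : injm iso by apply/injmP; exact: (bij_inj isob).
have isos : surjm iso by have [g _ gK] := isob => y; exists (g y).
have [iota [isoK iotaK]] := bij_inv isoi isos.
have [p pP] := cyc_factor (X := U) (i := 1) (f := d U 0 1) (fun x => @d_comp R U 0 1 (1 + 1) x).
have pd i x : p (d U i 0 x) = 0.
  by apply: cyc_inI; rewrite pP d_comp.
have [|al0 al0P] := (hom_exactP _ _).1 (UY 0) 0 1 (1 + 1) erefl erefl (hom_comp iota p).
  by move=> x; apply: Y2.
have [|al [alE alP]] := compare_map (a := 0) (fun i _ => UY i) (f := al0).
  move=> i l x _ ->; rewrite al0P hcompE pd linear0 //.
have [|be0 be0P] := (hom_exactP _ _).1 (YU 0 (lexx 0)) 0 1 (1 + 1) erefl erefl
    (hom_comp (cyc_in U 1) (hom_comp iso (d Y 0 1))).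
  by move=> x; rewrite cycP.
have [|be [beE beP]] := compare_map YU (f := be0).
  by move=> i l x _ ->; rewrite be0P !hcompE d_comp !linear0.
pose f i : {linear U i -> U i} := hsub (hom_id _) (hom_comp (be i) (al i)).
have UU i : i <= 0 -> hom_exact (U i) U by move=> _; exact: (Xproj Upure).
have [||h hP] := compare_null UU (f := f).
- move=> i j x ij j0; rewrite !hsubE !hcompE linearB; congr (_ - _).
  by rewrite (beP _ _ _ ij j0) (alP _ _ _ ij j0).
- move=> x; rewrite hsubE hcompE linearB alE beE be0P !hcompE al0P hcompE iotaK pP subrr //.
(* the first degree below the resolution Y *)
pose k : int := - n%:Z - 1.
have hk x : d U k (k + 1) x = 0 -> d U (k - 1) k (h k (k - 1) x) = x.
  have e1 : k = k - 1 + 1 by rewrite /k; lia.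
  have k0 : k + 1 <= 0 by rewrite /k; lia.
  move=> dx; have := hP (k - 1) k (k + 1) x e1 erefl k0; rewrite dx linear0 addr0 => <-.
  have Yk : zero_module (Y k) by apply: Y0; rewrite /k; lia.
  by rewrite hsubE hcompE (Yk (al k x)) linear0 subr0.
have G m' m0' : m' = k + c -> m0' = k - 1 + c -> exists h : {linear X m' -> X m0'},
    forall l x, l = k + 1 + c -> d X m' l x = 0 -> d X m0' m' (h x) = x.
  by move=> -> ->; exists (h k (k - 1)) => l x ->; exact: hk.
have [||g gP] := G m m0; try (rewrite /k /c; lia).
by exists g => x; apply: gP; rewrite /k /c; lia.
Qed.

(** For splittings sg of the cycles, sg (1 - sg d) is a contraction. *)
Lemma pure_exact_contractible : finite_pure_global_dimension R -> null_homotopic (chain_id X).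
Proof.
move=> [n pgl].
have H m m0 : exists h : {linear X m -> X m0},
    m = m0 + 1 -> forall x, d X m (m + 1) x = 0 -> d X m0 m (h x) = x.
  have [e|ne] := pselect (m = m0 + 1); last by exists (0 : hom _ _).
  by have [h hP] := cycles_split e pgl; exists h.
pose sg m m0 : hom (X m) (X m0) := sval (cid (H m m0)).
have sgP m m0 x : m = m0 + 1 -> d X m (m + 1) x = 0 -> d X m0 m (sg m m0 x) = x.
  by move=> e; exact: (svalP (cid (H m m0)) e).
exists (fun i j => hom_comp (sg i j)
  (hsub (hom_id _) (hom_comp (sg (i + 1) i) (d X i (i + 1))))) => i x.
rewrite !hcompE !hsubE !hcompE d_comp linear0 subr0.
rewrite sgP; first by rewrite -[RHS]/(x - _ + _) subrK.
  by rewrite subrK.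
by rewrite linearB sgP ?subrr // d_comp.
Qed.
End Contraction.

Section Generation.
Variable R : comPzRingType.
Hypothesis pgl : finite_pure_global_dimension R.
Variable X : mod_class R.
Hypothesis Xcoprod : forall (I : choiceType) (F : I -> lmodType R),
  (forall i, X (F i)) -> X (coprod F).
Hypothesis X0 : forall M, zero_module M -> X M.
Hypothesis Xenv : forall M, fin_gen M -> exists e : envelope X M, True.
Hypothesis Xproj : forall M, X M -> pure_projective M.

(** Finitely generated modules, represented by quotients of row modules, together
    with the degree in which the coresolution starts. *)
Definition generator : Type := ({n : nat & submod 'rV[R]_n} * int)%type.
HB.instance Definition _ := gen_eqMixin generator.
HB.instance Definition _ := gen_choiceMixin generator.

(** If X receives no nonzero maps from the coresolutions of finitely generated
    modules, then Hom (N, X) has no cohomology for finitely presented N. *)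
Lemma K_compactly_generated : compactly_generated (K X).
Proof.
split; first exact: K_coproducts.
have fgQ (g : generator) : fin_gen (quotM (projT2 g.1)).
  exact: (fin_gen_surj (@qpi_surj _ _ _) (fin_gen_row R _)).
pose C (g : generator) := sval (cid (coresolution_ex X0 Xenv (fgQ g) g.2)).
exists generator, (fun g => mkK (rX (C g))); split=> [g|Y Y0].
  exact: (coresolution_compact Xcoprod (C g) (fgQ g)).
have Ypure : pure_exact (sval Y).
  move=> N [n [m [p [q [pS _]]]]] i f fd.
  have Nfg : fin_gen N by exists n, p.
  have [n' [T [u ub]]] := fin_gen_quot Nfg.
  have ui : injm u by apply/injmP; exact: (bij_inj ub).
  have us : surjm u by have [g _ gK] := ub => y; exists (g y).
  have [v [uK vK]] := bij_inv ui us.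
  pose g : generator := (existT _ n' T, i).
  have [|F FP] := coresolution_map (C g) (svalP Y) (f := hom_comp f v).
    by move=> x; rewrite hcompE fd.
  have /pi_null/(coresolution_null (svalP Y))[t tP] := Y0 g (\pi_(htp_class (C g) (sval Y)) F).
  by exists (hom_comp t u) => x; rewrite hcompE -tP FP hcompE uK.
apply: zero_object_id; apply/pi_null; apply: pure_exact_contractible => // i.
by apply: Xproj; exact: (svalP Y).
Qed.
End Generation.

Theorem mainTheorem5 (R : comPzRingType) :
  noetherian R ->
  has_dualizing_complex R ->
  finite_pure_global_dimension R ->
  (finite_injective_dimension (R^o)%R ->
     forall M : lmodType R,
       filtered_colimits (@Gproj R) M <-> GFlat M) /\
  ((forall M : lmodType R, filtered_colimits (@Gproj R) M <-> GFlat M) ->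
     compactly_generated (K (Add (@Gproj R)))).
Proof.
move=> noethR dualR pgl; split=> [Rinj M|GC].
  by split; [exact: Gorenstein_colim_GFlat|exact: Gorenstein_GFlat_colim].
have Gfg (M : lmodType R) : Gproj M -> fin_gen M by case.
apply: (K_compactly_generated pgl).
- exact: Add_coprod.
- exact: Add_zero.
- move=> M Mfg; have [G [e [GG eP]]] := Gproj_preenvelope noethR dualR GC Mfg.
  have ext Y (YA : Add (@Gproj R) Y) := Add_extend Mfg YA (fun G' f G'G => eP G' f G'G).
  by exists (Envelope (Gfg _ GG) (Add_sub GG) ext).
- move=> M; apply: Add_pure_projective => G /Gfg; exact: fin_gen_pres.
Qed.
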